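(* Let $\mathcal{C}$ be a permutation class containing only finitely many simple permutations, and let $\mathcal{C}_n$ denote the set of permutations of length $n$ in $\mathcal{C}$. Then each of the following sequences has a generating function $\sum_n a_n x^n$ that is algebraic over $\mathbb{Q}(x)$: (1) $a_n$ = the number of alternating permutations in $\mathcal{C}_n$; (2) $a_n$ = the number of even permutations in $\mathcal{C}_n$; (3) $a_n$ = the number of Dumont permutations of the first kind in $\mathcal{C}_n$; (4) $a_n$ = the number of permutations in $\mathcal{C}_n$ avoiding every member of a given finite set of blocked or barred permutations; (5) $a_n$ = the number of involutions in $\mathcal{C}_n$. Moreover, these conditions can be combined in any finite manner: for any finite collection of the conditions listed in (1)–(5), the number of permutations in $\mathcal{C}_n$ satisfying all of them simultaneously has an algebraic generating function.
   Context: A permutation $\pi$ contains $\sigma$ if $\pi$ has a subsequence order-isomorphic to $\sigma$; a permutation class is a set of permutations closed downward under containment. An interval of $\pi\in S_n$ is a set of contiguous indices $[a,b]$ whose image under $\pi$ is a set of consecutive integers; $\pi$ is simple if its only intervals have size $0$, $1$, or $n$. A permutation $\pi\in S_n$ is alternating if for every $i\in[2,n-1]$, $\pi(i)$ does not lie between $\pi(i-1)$ and $\pi(i+1)$. A permutation is Dumont of the first kind if each even entry is immediately followed by a smaller entry and each odd entry is either immediately followed by a larger entry or is the last entry. A barred permutation is a permutation with some entries barred; $\pi$ avoids it if every subsequence of $\pi$ order-isomorphic to the unbarred entries can be extended (by adding entries of $\pi$ in the positions/relative values prescribed by the barred entries) to a subsequence order-isomorphic to the whole pattern. A blocked permutation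 is a permutation pattern with dashes between some consecutive entries; an occurrence in $\pi$ is a subsequence order-isomorphic to the pattern in which any two pattern entries that are adjacent in the pattern and not separated by a dash must occupy adjacent positions of $\pi$ (e.g. $513$ is an occurrence of $3\text{-}12$ in $51342$, but $514$ is not). *)

(* Defs.v *)
From mathcomp Require Import all_boot all_order all_algebra.
Set Implicit Arguments. Unset Strict Implicit. Unset Printing Implicit Defensive.
Import GRing.Theory Num.Theory.

Definition is_perm (s : seq nat) : Prop := perm_eq s (iota 1 (size s)).

Definition order_iso (s t : seq nat) : Prop :=
  size s = size t /\
  forall i j, i < size s -> j < size s ->
    (nth 0 s i < nth 0 s j) = (nth 0 t i < nth 0 t j).

Definition index_seq (pi : seq nat) (I : seq nat) : Prop :=
  sorted ltn I /\ all (fun i => i < size pi) I.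

Definition occ (pi I : seq nat) : seq nat := map (nth 0 pi) I.

Definition contains (pi sigma : seq nat) : Prop :=
  exists I, index_seq pi I /\ order_iso (occ pi I) sigma.

Definition perm_class (C : seq nat -> Prop) : Prop :=
  (forall pi, C pi -> is_perm pi) /\
  (forall pi sigma, C pi -> is_perm sigma -> contains pi sigma -> C sigma).

Definition is_interval (pi : seq nat) (a k : nat) : Prop :=
  a + k <= size pi /\ exists c, perm_eq (take k (drop a pi)) (iota c k).

Definition is_simple (pi : seq nat) : Prop :=
  forall a k, is_interval pi a k -> k = 0 \/ k = 1 \/ k = size pi.

Definition alternating (pi : seq nat) : Prop :=
  forall i, 0 < i -> i.+1 < size pi ->
    ~ ((nth 0 pi i.-1 < nth 0 pi i < nth 0 pi i.+1) \/
       (nth 0 pi i.+1 < nth 0 pi i < nth 0 pi i.-1)).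

Definition inversions (pi : seq nat) : nat :=
  \sum_(i < size pi) \sum_(j < size pi) ((i < j) && (nth 0 pi j < nth 0 pi i)).

Definition even_perm (pi : seq nat) : Prop := ~~ odd (inversions pi).

Definition dumont1 (pi : seq nat) : Prop :=
  forall i, i < size pi ->
    (~~ odd (nth 0 pi i) -> i.+1 < size pi /\ nth 0 pi i.+1 < nth 0 pi i) /\
    (odd (nth 0 pi i) -> i.+1 = size pi \/ nth 0 pi i < nth 0 pi i.+1).

(* involution (values are 1-based) *)
Definition involution (pi : seq nat) : Prop :=
  forall i, i < size pi -> nth 0 pi (nth 0 pi i).-1 = i.+1.

(* Barred pattern (tau, bars): bars has the same length as tau, [true] = barred.
   pi avoids it if every occurrence of the unbarred part extends to an
   occurrence of the whole pattern. *)
Definition avoids_barred (pi tau : seq nat) (bars : seq bool) : Prop :=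
  forall I, index_seq pi I ->
    order_iso (occ pi I) (mask (map negb bars) tau) ->
    exists J, index_seq pi J /\ order_iso (occ pi J) tau /\
              mask (map negb bars) J = I.

(* Blocked pattern (tau, dashes): dashes has length (size tau).-1, and
   nth dashes i = true means a dash between entries i and i+1 of tau. *)
Definition occurs_blocked (pi tau : seq nat) (dashes : seq bool) : Prop :=
  exists I, index_seq pi I /\ order_iso (occ pi I) tau /\
    forall i, i.+1 < size tau -> ~~ nth true dashes i ->
      nth 0 I i.+1 = (nth 0 I i).+1.

Definition counts (P : seq nat -> Prop) (a : nat -> nat) : Prop :=
  forall n, exists s : seq (seq nat),
    uniq s /\ size s = a n /\ forall pi, pi \in s <-> (size pi = n /\ P pi).

(* The generating function sum_n a_n x^n is algebraic over Q(x): there is a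
   nonzero P(x,y) in Q[x][y] with P(x, F(x)) = 0 as formal power series.
   The n-th coefficient of P(x,F) only depends on F mod x^(n+1). *)
Definition algebraic_gf (a : nat -> nat) : Prop :=
  exists P : {poly {poly rat}}, (P != 0)%R /\
    forall n, ((P.[\poly_(i < n.+1) ((a i)%:R : rat)])`_n = 0)%R.

(* Main.v *)
Require Import Defs.
From mathcomp Require Import all_boot all_order all_algebra.
From mathcomp Require Import zify ring mpoly.
From Stdlib Require Import Classical ClassicalEpsilon.
Set Implicit Arguments. Unset Strict Implicit. Unset Printing Implicit Defensive.
Import GRing.Theory.

(** A permutation in a class with finitely many simple permutations is built from [1] by inflating
    simple permutations, in a unique way once the first argument of [12] (of [21]) is required to
    be sum (skew) indecomposable.  So it suffices to find a finite set of states such that the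
    state of [inflate sg als] depends only on [sg] and on the states of [als], and such that all
    the properties considered depend only on the state: the generating functions of the states
    then satisfy a polynomial system.

    Except for parity and involutions, all properties are first-order in the language of two
    linear orders (positions and values) with a predicate for even values, so the [k]-round
    Ehrenfeucht-Fraisse type, which is compositional for inflations, serves as a state.
    Membership in the class is first-order too, because the substitution closure of finitely many
    simple permutations is well-quasi-ordered (minimal bad sequences), hence the class is cut out
    of it by finitely many forbidden patterns.

    In an involution [inflate sg als], [sg] is an involution and [als] is permuted by [sg] up to
    inverses; the argument chosen for a 2-cycle of [sg] counts twice.  The only exception is
    [sg = 21], where one also needs the form [321[a, b, inv a]].

    To see that the solution of a proper system [y_i = P_i(x, y)] is algebraic, perturb it to
    [y_i = P_i(x, y) + s^(w_i)].  By a dimension count, [x], the polynomials [Y_i - P_i(x, Y)] and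
    the desired sum of the [Y_i] are related by a polynomial [A <> 0]; at the perturbed solution
    this becomes a relation with [s^(w_i)] in place of [Y_i - P_i], which is still nontrivial when
    the [w_i] are powers of a large base.  Its lowest-order part in [s] is an algebraic equation
    for the unperturbed solution.  *)

(** * Algebraic dependence and proper polynomial systems *)

(** The class itself need not be closed under inflation, so what gets enumerated is a substitution
    closure containing it, and membership in the class becomes one more property read off the state.
    The finite list of forbidden patterns is what fixes the number of rounds in advance. The parity
    of a value is not local to a block, because a block is shifted by the lengths of the blocks
    below it; a state therefore also records the parity of the length.

    The form [321[a, b, inv a]] arises because in [21[a, b]] only [a] is indecomposable. Inversion
    gives [21[inv b, inv a]], whose first argument may be decomposable, so uniqueness does not
    apply; a [b] longer than [a] then ends in [inv a].

    Elimination without the perturbation can fail: [A] may vanish identically once all [Y_i - P_i]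
    are set to zero. With a base above all exponents, different monomials in the [Y_i - P_i] get
    different orders in [s], so nothing cancels in the lowest order. *)

Section AlgebraicDependence.
Local Open Scope ring_scope.

Lemma lin_dep (F : fieldType) (J T : finType) (v : J -> T -> F) :
  (#|T| < #|J|)%N ->
  exists c : J -> F, (exists j, c j != 0) /\ forall t, \sum_j c j * v j t = 0.
Proof.
move=> ltTJ.
pose M := \matrix_(i < #|J|, k < #|T|) v (enum_val i) (enum_val k).
have kerN0 : kermx M != 0.
  rewrite -mxrank_eq0 mxrank_ker -lt0n subn_gt0.
  exact: leq_ltn_trans (rank_leq_col M) ltTJ.
have /rowV0Pn[u /sub_kermxP uM u0] := kerN0.
exists (fun j => u 0 (enum_rank j)); split.
  have /rV0Pn[i ui] := u0.
  by exists (enum_val i); rewrite enum_valK.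
move=> t; have /matrixP/(_ 0 (enum_rank t)) := uM.
rewrite !mxE => h; rewrite -[RHS]h [RHS](reindex enum_rank) /=.
  by apply: eq_bigr => j _; rewrite mxE !enum_rankK.
by exists enum_val => i _; rewrite ?enum_rankK ?enum_valK.
Qed.

Lemma msize_prod_exp (F : fieldType) n (K : finType) (p : K -> {mpoly F[n]}) d B
    (e : {ffun K -> 'I_B}) :
  (forall k, msize (p k) < d)%N ->
  (msize (\prod_k p k ^+ e k) <= (\sum_k e k * d).+1)%N.
Proof.
move=> hd.
have sM (q r : {mpoly F[n]}) a b : (msize q < a -> msize r <= b.+1 ->
    msize (q * r) <= (a + b).+1)%N.
  by move=> h1 h2; apply: leq_trans (msizeM_le q r) _; lia.
have: (forall k q s, msize q <= s.+1 -> msize (p k ^+ e k * q) <= (e k * d + s).+1)%N.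
  move=> k q s; elim: (nat_of_ord (e k)) => [|m IH] hq; first by rewrite mul1r.
  by rewrite exprS -mulrA mulSn -addnA; apply: sM => //; apply: IH.
move=> h; elim/big_rec2: _ => [|k s q _]; first by rewrite msize1.
exact: h.
Qed.

(** There are more products than monomials: the [B ^ #|K|] products with exponents below [B] have
    total degree below [B * D], hence lie in a space of dimension at most [(B * D) ^ n]. The choice
    [B = D ^ n + 1] makes [B ^ n.+1] exceed this. *)
Lemma alg_dep (F : fieldType) n (K : finType) (p : K -> {mpoly F[n]}) :
  (n < #|K|)%N ->
  exists B (c : {ffun K -> 'I_B} -> F),
    (exists e, c e != 0) /\ \sum_e c e *: \prod_k p k ^+ e k = 0.
Proof.
move=> ltnK.
pose d := (\sum_k msize (p k)).+1; pose D := (#|K| * d).+1.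
have hd k : (msize (p k) < d)%N.
  by rewrite /d (bigD1 k) //=; lia.
pose B := (D ^ n).+1.
pose v (e : {ffun K -> 'I_B}) (t : {ffun 'I_n -> 'I_(B * D)}) : F :=
  (\prod_k p k ^+ e k)@_[multinom (t i : nat) | i < n].
have [|c [c0 hc]] := @lin_dep F _ _ v.
  rewrite !card_ffun !card_ord.
  rewrite expnMn; apply: (@leq_trans (B ^ n.+1)%N); last by rewrite leq_pexp2l.
  by rewrite expnS mulnC ltn_pmul2r // expn_gt0.
exists B, c; split=> //; apply/mpolyP => m; rewrite mcoeff0 raddf_sum /=.
have [ltm|gem] := ltnP (mdeg m) (B * D)%N.
  have mi i : (m i < B * D)%N.
    by apply: leq_ltn_trans ltm; rewrite mdegE (bigD1 i) //= leq_addr.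
  have := hc [ffun i => Ordinal (mi i)].
  move=> h; rewrite -[RHS]h; apply: eq_bigr => e _; rewrite mcoeffZ /v.
  by congr (_ * mcoeff _ _); apply/mnmP => i; rewrite mnmE ffunE.
rewrite big1 // => e _; rewrite mcoeffZ memN_msupp_eq0 ?mulr0 //.
apply: msize_mdeg_ge; apply: leq_trans gem; apply: leq_trans (msize_prod_exp _ hd) _.
rewrite -ltnS; apply: (@leq_trans (B * (#|K| * d)).+2); last first.
  by rewrite /D mulnS -[X in (_ < X)%N]addn1; have : (0 < B)%N by []; lia.
rewrite !ltnS mulnA -big_distrl /=; apply: leq_mul => //.
rewrite mulnC -sum_nat_const; apply: leq_sum => k _; exact: ltnW.
Qed.

End AlgebraicDependence.

(** * Solutions of proper polynomial systems *)

Section RuleSystems.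
Local Open Scope ring_scope.

(* [(n, [:: i; j])] stands for the monomial [x^n y_i y_j] *)
Definition rule (I : Type) : Type := (nat * seq I)%type.

Definition reval (A : comNzRingType) (I : Type) (x : A) (y : I -> A)
    (R : seq (rule I)) : A :=
  \sum_(r <- R) x ^+ r.1 * \prod_(j <- r.2) y j.

Lemma rmorph_reval (A B : comNzRingType) (f : {rmorphism A -> B}) (I : Type)
    (x : A) (y : I -> A) R :
  f (reval x y R) = reval (f x) (f \o y) R.
Proof.
rewrite /reval rmorph_sum; apply: eq_bigr => r _.
by rewrite rmorphM rmorphXn rmorph_prod.
Qed.

Lemma eq_reval (A : comNzRingType) (I : Type) (x : A) (y y' : I -> A) R :
  y =1 y' -> reval x y R = reval x y' R.
Proof.
by move=> h; apply: eq_bigr => r _; congr (_ * _); apply: eq_bigr => j _.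
Qed.

(* membership in the ideal [(x, s)^N] of [Q[x][s]] *)
Definition ord_ge (N : nat) (p : {poly {poly rat}}) : Prop :=
  forall i j, (i + j < N)%N -> p`_i`_j = 0.

Lemma ord_ge0 p : ord_ge 0 p. Proof. by []. Qed.

Lemma ord_geW N M p : (M <= N)%N -> ord_ge N p -> ord_ge M p.
Proof. by move=> h hp i j ij; apply: hp; apply: leq_trans h. Qed.

Lemma ord_ge_zero N : ord_ge N 0.
Proof. by move=> i j _; rewrite !coef0. Qed.

Lemma ord_geD N p q : ord_ge N p -> ord_ge N q -> ord_ge N (p + q).
Proof. by move=> hp hq i j ij; rewrite !coefD hp // hq // addr0. Qed.

Lemma ord_ge_sum N (T : Type) (s : seq T) (P : pred T) F :
  (forall t, P t -> ord_ge N (F t)) -> ord_ge N (\sum_(t <- s | P t) F t).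
Proof.
move=> h; elim/big_ind: _ => //; [exact: ord_ge_zero | exact: ord_geD].
Qed.

Lemma ord_geM N M p q : ord_ge N p -> ord_ge M q -> ord_ge (N + M) (p * q).
Proof.
move=> hp hq i j ij; rewrite coefM coef_sum big1 // => k _.
rewrite coefM big1 // => l _; have := ltn_ord k; have := ltn_ord l => lk ll.
have [h|h] := ltnP (k + l)%N N; first by rewrite hp ?mul0r.
by rewrite hq ?mulr0 //; lia.
Qed.

Lemma ord_geN N p : ord_ge N p -> ord_ge N (- p).
Proof. by move=> hp i j ij; rewrite !coefN hp ?oppr0. Qed.

Lemma ord_ge_X w : ord_ge w 'X^w.
Proof.
move=> i j ij; rewrite coefXn; case: eqP => [?|_]; last by rewrite coef0.
by lia.
Qed.

Lemma ord_ge_x w : ord_ge w ('X%:P ^+ w).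
Proof.
move=> i j ij; rewrite -rmorphXn /= coefC; case: eqP => [?|_]; last by rewrite coef0.
by rewrite coefXn; case: eqP => // ?; lia.
Qed.

Lemma ord_ge_mull N p q : ord_ge N q -> ord_ge N (p * q).
Proof. exact: (ord_geM (@ord_ge0 p)). Qed.

Lemma ord_ge_sub_exp N p q k : ord_ge N (p - q) -> ord_ge N (p ^+ k - q ^+ k).
Proof. by move=> h; rewrite subrXX mulrC; apply: ord_ge_mull. Qed.

Lemma ord_ge_sub_prod N (K : finType) (p q : K -> {poly {poly rat}}) :
  (forall k, ord_ge N (p k - q k)) -> ord_ge N (\prod_k p k - \prod_k q k).
Proof.
move=> h; elim/big_rec2: _ => [|k a b _ IH]; first by rewrite subrr; apply: ord_ge_zero.
have -> : p k * b - q k * a = b * (p k - q k) + q k * (b - a) by ring.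
by apply: ord_geD; apply: ord_ge_mull.
Qed.

Lemma ord_ge_prod (I : Type) (y : I -> {poly {poly rat}}) l :
  (forall j, ord_ge 1 (y j)) -> ord_ge (size l) (\prod_(j <- l) y j).
Proof.
move=> h; elim: l => [|j l IH]; first by rewrite big_nil.
by rewrite big_cons; apply: (@ord_geM 1 (size l)).
Qed.

(** Telescoping leaves in each term one difference and [size l - 1] factors of order 1; these
    factors are the gain of a nonlinear rule. *)
Lemma ord_ge_sub_word (I : eqType) (y y' : I -> {poly {poly rat}}) e l :
  (forall j, ord_ge 1 (y j)) -> (forall j, ord_ge 1 (y' j)) ->
  (forall j, j \in l -> ord_ge e (y' j - y j)) ->
  ord_ge (e + (size l).-1) (\prod_(j <- l) y' j - \prod_(j <- l) y j).
Proof.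
move=> hy hy'; elim: l => [|j l IH] h.
  by rewrite !big_nil subrr; apply: ord_ge_zero.
rewrite !big_cons.
set b' := \prod_(j <- l) y' j; set b := \prod_(j <- l) y j.
have -> : y' j * b' - y j * b = (y' j - y j) * b' + y j * (b' - b) by ring.
apply: ord_geD; first by apply: ord_geM; [apply: h; rewrite mem_head | exact: ord_ge_prod].
have {IH} IH : ord_ge (e + (size l).-1) (b' - b).
  by apply: IH => k kl; apply: h; rewrite in_cons kl orbT.
case: l @b @b' IH h => [|k l] b b' IH h.
  by rewrite /b /b' !big_nil subrr mulr0; apply: ord_ge_zero.
by apply: ord_geW (ord_geM (hy j) IH); rewrite /=; lia.
Qed.

(* [lev] bounds the depth of chains of unit rules *)
Definition proper (I : eqType) (lev : I -> nat) (R : I -> seq (rule I)) : Prop :=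
  forall i r, r \in R i ->
    [/\ forall j, j \in r.2 -> (lev j <= lev i)%N, r.2 = [::] -> (0 < r.1)%N &
        (0 < r.1)%N \/ (1 < size r.2)%N \/
        (forall j, j \in r.2 -> (lev j < lev i)%N)].

(** Iteration from 0 of [y_i = R_i(x, y) + t_i]. The term [t_i] is 0 for the original system and
    [s^(w_i)] for the perturbed one. *)
Fixpoint iterR (A : comNzRingType) (I : Type) (x : A) (t : I -> A)
    (R : I -> seq (rule I)) (N : nat) : I -> A :=
  if N is N'.+1 then fun i => reval x (iterR x t R N') (R i) + t i
  else fun=> 0.

Lemma rmorph_iterR (A B : comNzRingType) (f : {rmorphism A -> B}) (I : Type)
    (x : A) (t : I -> A) R N i :
  f (iterR x t R N i) = iterR (f x) (f \o t) R N i.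
Proof.
elim: N i => [|N IH] i /=; first by rewrite rmorph0.
by rewrite rmorphD rmorph_reval; congr (_ + _); apply: eq_reval => j /=; apply: IH.
Qed.

Section Perturbed.
Variables (I : finType) (lev : I -> nat) (R : I -> seq (rule I)) (w : I -> nat).
Hypothesis propR : proper lev R.
Hypothesis w_gt0 : forall i, (0 < w i)%N.

(** The outer variable of [{poly {poly rat}}] is [s], and ['X%:P] is [x]. *)
Let z := iterR ('X%:P : {poly {poly rat}}) (fun i => 'X^(w i)) R.

Lemma pert_ord1 N i : ord_ge 1 (z N i).
Proof.
elim: N i => [|N IH] i; first exact: ord_ge_zero.
apply: ord_geD; last by apply: ord_geW (w_gt0 i) _; apply: ord_ge_X.
rewrite /reval big_seq; apply: ord_ge_sum => r /propR[_ h _].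
apply: ord_geW; last exact: (ord_geM (@ord_ge_x r.1) (ord_ge_prod (l := r.2) IH)).
by case: r.2 h => [/(_ erefl)|j l _] /=; lia.
Qed.

(** Convergence in the [(x, s)]-adic sense. A rule with a factor [x] or with two letters raises the
    order by at least one; a unit rule need not, but it refers to a smaller level, which the bound
    [N.+1 - lev i] absorbs. *)
Lemma pert_cauchy N i : ord_ge (N.+1 - lev i) (z N.+1 i - z N i).
Proof.
elim: N i => [|N IH] i.
  rewrite [z 0 i]/(0) subr0; by apply: ord_geW (pert_ord1 1 i); lia.
have -> : z N.+2 i - z N.+1 i =
  \sum_(r <- R i) 'X%:P ^+ r.1 *
    (\prod_(j <- r.2) z N.+1 j - \prod_(j <- r.2) z N j).
  have zS M j : z M.+1 j = reval 'X%:P (z M) (R j) + 'X^(w j) by [].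
  rewrite zS [in X in _ - X]zS opprD addrACA subrr addr0 /reval -sumrB.
  by apply: eq_bigr => r _; rewrite mulrBr.
rewrite big_seq; apply: ord_ge_sum => r /propR[hle _ h].
have [lt|ltlev] : ((0 < r.1)%N \/ (1 < size r.2)%N) \/
    (forall j, j \in r.2 -> (lev j < lev i)%N) by tauto.
  apply: (@ord_geW (r.1 + ((N.+1 - lev i) + (size r.2).-1))%N); first by lia.
  apply: ord_geM; first exact: ord_ge_x.
  apply: ord_ge_sub_word => [j|j|j jr]; try exact: pert_ord1.
  by apply: ord_geW (IH j); have := hle j jr; lia.
apply: ord_ge_mull.
apply: (@ord_geW ((N.+2 - lev i) + (size r.2).-1)%N); first by lia.
apply: ord_ge_sub_word => [j|j|j jr]; try exact: pert_ord1.
by apply: ord_geW (IH j); have := ltlev j jr; lia.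
Qed.

End Perturbed.

Lemma eq_iterR (A : comNzRingType) (I : Type) (x : A) (t t' : I -> A) R N i :
  t =1 t' -> iterR x t R N i = iterR x t' R N i.
Proof.
move=> h; elim: N i => [|N IH] i //=; rewrite h; congr (_ + _); exact: eq_reval.
Qed.

Lemma coef_horner_trunc (P : {poly {poly rat}}) (p q : {poly rat}) n :
  (forall i, (i <= n)%N -> p`_i = q`_i) ->
  forall i, (i <= n)%N -> (P.[p])`_i = (P.[q])`_i.
Proof.
move=> h; elim/poly_ind: P => [|P c IH] i ilen; first by rewrite !horner0.
rewrite !hornerMXaddC !coefD; congr (_ + _); rewrite !coefM.
apply: eq_bigr => j _; have := ltn_ord j => jlt.
by rewrite IH ?h //; lia.
Qed.

Lemma digits_inj B m (f g : 'I_m -> nat) :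
  (forall i, (f i < B)%N) -> (forall i, (g i < B)%N) ->
  (\sum_(i < m) B ^ i * f i = \sum_(i < m) B ^ i * g i)%N -> f =1 g.
Proof.
elim: m f g => [|m IH] f g hf hg; first by move=> _ [].
rewrite !big_ord_recl /= !expn0 !mul1n.
have E (u : 'I_m.+1 -> nat) : (\sum_(i < m) B ^ bump 0 i * u (lift ord0 i) =
    B * \sum_(i < m) B ^ i * u (lift ord0 i))%N.
  by rewrite big_distrr /=; apply: eq_bigr => i _; rewrite /bump /= add1n expnS mulnA.
rewrite !E => e.
have B0 : (0 < B)%N by apply: leq_ltn_trans (hf ord0).
have e0 : f ord0 = g ord0.
  have := congr1 (modn^~ B) e.
  by rewrite /= ![(_ + B * _)%N]addnC ![(B * _)%N]mulnC !modnMDl !modn_small.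
have /IH h : (\sum_(i < m) B ^ i * f (lift ord0 i) =
              \sum_(i < m) B ^ i * g (lift ord0 i))%N.
  move: e; rewrite e0 => /eqP; rewrite eqn_add2l eqn_pmul2l // => /eqP //.
by move=> i; case: (unliftP ord0 i) => [j|] -> //; apply: h.
Qed.

Lemma prod_option (A : comNzRingType) (T : finType) (F : option T -> A) :
  \prod_j F j = F None * \prod_t F (Some t).
Proof.
rewrite (bigD1 None) //= (reindex_omap Some id) => [|[t|]] //=.
by congr (_ * _); apply: eq_bigl => t; rewrite eqxx.
Qed.

Theorem rules_algebraic (I : finType) (lev : I -> nat) (R : I -> seq (rule I))
    (A : pred I) (c0 : nat) (a : nat -> nat) :
  proper lev R ->
  (forall N n, (n <= N)%N ->
    (\sum_(i | A i) iterR 'X (fun=> 0) R N i + c0%:R : {poly rat})`_n = (a n)%:R) ->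
  algebraic_gf a.
Proof.
move=> propR ha.
(* [K] indexes [#|I| + 2] polynomials in [#|I| + 1] variables: [None] is the sum to be shown
   algebraic, [Some None] is [x], and [Some (Some i)] is the [i]-th equation. *)
pose K := option (option I); pose n := #|{: option I}|.
pose V : comNzRingType := {mpoly rat[n]}.
pose Xx : V := 'X_(enum_rank (None : option I)).
pose Yv i : V := 'X_(enum_rank (Some i)).
pose p (k : K) : V := match k with
  | None => \sum_(i | A i) Yv i + c0%:R
  | Some None => Xx
  | Some (Some i) => Yv i - reval Xx Yv (R i) end.
have [|B [c [[e0 ce0] hc]]] := @alg_dep _ n K p; first by rewrite card_option.
have B0 : (0 < B)%N by apply: leq_ltn_trans (ltn_ord (e0 None)).
(* All exponents in the relation are below [B], so the order [om e] in [s] of a monomial has the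
   exponents of the equations as its base-[B] digits. *)
pose w (i : I) := (B ^ enum_rank i)%N.
have w0 i : (0 < w i)%N by rewrite expn_gt0 B0.
pose om (e : {ffun K -> 'I_B}) := (\sum_i w i * e (Some (Some i)))%N.
have om_inj e e' : om e = om e' -> forall i, e (Some (Some i)) = e' (Some (Some i)).
  have omE f : om f = (\sum_(i < #|I|) B ^ i * f (Some (Some (enum_val i))))%N.
    rewrite /om (reindex (enum_val (A := mem I))) /=; last first.
      by exists enum_rank => i _; rewrite ?enum_rankK ?enum_valK.
    by apply: eq_bigr => i _; rewrite /w enum_valK.
  rewrite !omE => /digits_inj h i; apply: val_inj => /=.
  by have /= := h _ _ (enum_rank i); rewrite enum_rankK; apply.
pose e1 := [arg min_(e < e0 | c e != 0) om e].
have [ce1 e1min] : c e1 != 0 /\ forall e, c e != 0 -> (om e1 <= om e)%N.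
  by rewrite /e1; case: arg_minnP.
pose k := om e1.
(* The part of lowest order [k] in [s], as a polynomial in the sum with coefficients in [Q[x]]. On
   it the exponents of the equations are constant, so distinct [e] give distinct monomials and
   nothing cancels. *)
pose P : {poly {poly rat}} :=
  \sum_(e | om e == k) (c e *: 'X^(e (Some None))) *: 'X^(e None).
exists P; split.
  apply/eqP => /(congr1 (fun q : {poly {poly rat}} => q`_(e1 None)`_(e1 (Some None)))).
  rewrite !coef0 /P coef_sum coef_sum (bigD1 e1) //= big1 => [|e /andP[/eqP ek ne]].
    by rewrite !coefZ !coefXn eqxx mulr1 coefZ coefXn eqxx mulr1 addr0 => /eqP; apply/negP.
  rewrite !coefZ coefXn; case: eqP => [eN|_]; last by rewrite mulr0 coef0.
  rewrite mulr1 coefZ coefXn; case: eqP => [eS|_]; last by rewrite mulr0.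
  case/eqP: ne; apply/ffunP => -[[i|]|]; last 2 first.
  - by apply: val_inj.
  - by apply: val_inj.
  exact: om_inj.
move=> m.
(* The coefficient of [s^k x^m] is determined modulo [(x, s)^(m+k+1)]; the loss of up to [L] in
   [pert_cauchy] is compensated in [N]. *)
pose L := (\max_i lev i)%N; pose N := (m + k + L + 1)%N.
pose z := iterR ('X%:P : {poly {poly rat}}) (fun i => 'X^(w i)) R.
pose y : {poly rat} := \sum_(i | A i) iterR 'X (fun=> 0) R N i + c0%:R.
have -> : (P.[\poly_(i < m.+1) (a i)%:R])`_m = (P.[y])`_m.
  apply: (@coef_horner_trunc _ _ _ m) => // i ilem.
  by rewrite coef_poly ltnS ilem ha // /N; lia.
pose h (v : 'I_n) : {poly {poly rat}} :=
  if enum_val v is Some i then z N i else 'X%:P.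
pose f : {rmorphism rat -> {poly {poly rat}}} := polyC \o polyC.
pose phi : {rmorphism V -> {poly {poly rat}}} := mmap f h.
have phiX : phi Xx = 'X%:P by rewrite /phi /= mmapX mmap1U /h enum_rankK.
have phiY i : phi (Yv i) = z N i by rewrite /phi /= mmapX mmap1U /h enum_rankK.
pose yz := \sum_(i | A i) z N i + c0%:R.
pose q (j : K) : {poly {poly rat}} := match j with
  None => yz | Some None => 'X%:P | Some (Some i) => 'X^(w i) end.
have hq j : ord_ge (m + k).+1 (phi (p j) - q j).
  case: j => [[i|]|] /=.
  - rewrite rmorphB rmorph_reval phiX phiY.
    rewrite (@eq_reval _ _ _ (phi \o Yv) (z N)) //.
    (* At the [N]-th iterate the [i]-th equation takes the value [s^(w_i)] up to the difference of
       two consecutive iterates. *)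
    have -> : z N i - reval 'X%:P (z N) (R i) - 'X^(w i) = - (z N.+1 i - z N i).
      by rewrite opprB -addrA -opprD.
    apply/ord_geN; apply: (@ord_geW (N.+1 - lev i)); last exact: pert_cauchy.
    suff : (lev i <= L)%N by rewrite /N; lia.
    by rewrite /L (bigD1 i) //= leq_maxl.
  - by rewrite phiX subrr; apply: ord_ge_zero.
  rewrite rmorphD rmorph_nat rmorph_sum (eq_bigr (z N)) ?subrr //.
  exact: ord_ge_zero.
have hs : ord_ge (m + k).+1 (\sum_e f (c e) * \prod_j q j ^+ e j).
  have -> : \sum_e f (c e) * \prod_j q j ^+ e j =
    - (\sum_e f (c e) * (\prod_j phi (p j) ^+ e j - \prod_j q j ^+ e j)).
    have := congr1 phi hc; rewrite rmorph0 rmorph_sum => hc'.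
    rewrite [in RHS](eq_bigr (fun e => f (c e) * \prod_j phi (p j) ^+ e j -
                               f (c e) * \prod_j q j ^+ e j)) => [|e _]; last by rewrite mulrBr.
    rewrite sumrB -[X in - (X - _)](_ : 0 = _) ?sub0r ?opprK // -[LHS]hc'.
    apply: eq_bigr => e _; rewrite -mul_mpolyC rmorphM rmorph_prod; congr (_ * _).
      by rewrite /= mmapC.
    by apply: eq_bigr => j _; rewrite rmorphXn.
  apply/ord_geN; apply: ord_ge_sum => e _; apply: ord_ge_mull.
  by apply: ord_ge_sub_prod => j; apply: ord_ge_sub_exp.
have -> : (P.[y])`_m = (\sum_e f (c e) * \prod_j q j ^+ e j)`_k`_m; last first.
  by apply: hs; lia.
congr (polyseq _)`_m.
pose f0 : {rmorphism {poly {poly rat}} -> {poly rat}} := horner_eval 0.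
have f0E u : f0 u = u`_0 by rewrite /= /horner_eval horner_coef0.
have yz0 : f0 yz = y.
  rewrite rmorphD rmorph_nat rmorph_sum; congr (_ + _).
  apply: eq_bigr => i _; rewrite rmorph_iterR f0E coefC eqxx; apply: eq_iterR.
  by move=> j; rewrite /comp f0E coefXn; case: (w j) (w0 j).
have qE (e : {ffun K -> 'I_B}) :
    \prod_j q j ^+ e j = yz ^+ e None * 'X%:P ^+ e (Some None) * 'X^(om e).
  rewrite 2!prod_option /= mulrA; congr (_ * _); rewrite /om expr_sum.
  by apply: eq_bigr => i _; rewrite exprM.
rewrite coef_sum /P horner_sum [in RHS](bigID (fun e => om e == k)) /= [X in _ + X]big1 ?addr0.
  apply: eq_bigr => e /eqP ek; rewrite hornerZ hornerXn qE !mulrA coefMXn ek ltnn subnn.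
  rewrite -f0E !rmorphM !rmorphXn yz0 !f0E !coefC /= -mul_polyC; ring.
move=> e ne; have [->|ce] := eqVneq (c e) 0; first by rewrite rmorph0 mul0r coef0.
have ltk : (k < om e)%N by rewrite ltn_neqAle eq_sym ne; apply: e1min.
by rewrite qE !mulrA coefMXn ltk.
Qed.
End RuleSystems.

(** * Permutations and inflations *)

Lemma is_perm_uniq s : is_perm s -> uniq s.
Proof. by move=> h; rewrite (perm_uniq h) iota_uniq. Qed.

Lemma is_perm_mem s v : is_perm s -> (v \in s) = (0 < v <= size s).
Proof. by move=> h; rewrite (perm_mem h) mem_iota add1n ltnS. Qed.

Lemma is_perm_nth s i : is_perm s -> i < size s -> 0 < nth 0 s i <= size s.
Proof. by move=> h hi; rewrite -is_perm_mem // mem_nth. Qed.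

Lemma is_perm_inj s i j : is_perm s -> i < size s -> j < size s ->
  nth 0 s i = nth 0 s j -> i = j.
Proof. by move=> /is_perm_uniq u hi hj /eqP; rewrite nth_uniq // => /eqP. Qed.

Lemma is_perm_onto s v : is_perm s -> 0 < v <= size s ->
  exists2 i, i < size s & nth 0 s i = v.
Proof. by move=> h; rewrite -is_perm_mem // => /(nthP 0)[i hi <-]; exists i. Qed.

Lemma is_permI (s : seq nat) : uniq s -> (forall v, v \in s -> 0 < v <= size s) -> is_perm s.
Proof.
move=> u h; apply: uniq_perm => //; first exact: iota_uniq.
have sub : {subset s <= iota 1 (size s)} by move=> v /h; rewrite mem_iota add1n ltnS.
by have [] := uniq_min_size u sub; rewrite ?size_iota // => _ e v; rewrite e.
Qed.

Lemma map_nth_iota (s : seq nat) : map (nth 0 s) (iota 0 (size s)) = s.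
Proof. exact: mkseq_nth. Qed.

Lemma count_nth (P : pred nat) s : count P s = count (P \o nth 0 s) (iota 0 (size s)).
Proof. by rewrite -[in LHS](map_nth_iota s) count_map. Qed.

Lemma is_perm_count s i : is_perm s -> i < size s ->
  nth 0 s i = (count (fun u => u < nth 0 s i) s).+1.
Proof.
move=> hs hi; have /andP[v0 vn] := is_perm_nth hs hi.
move: (nth 0 s i) v0 vn => v v0 vn.
rewrite (permP hs) -size_filter.
have -> : [seq u <- iota 1 (size s) | u < v] = iota 1 v.-1.
  have -> : size s = v.-1 + (size s - v.-1) by lia.
  rewrite iotaD filter_cat (@eq_in_filter _ _ xpredT) ?filter_predT; last first.
    by move=> u; rewrite mem_iota; lia.
  rewrite (@eq_in_filter _ _ pred0) ?filter_pred0 ?cats0 //.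
  by move=> u; rewrite mem_iota /=; lia.
by rewrite size_iota prednK.
Qed.

(** The standard way below to prove two permutations equal: a value is one more than the number of
    smaller values, so comparisons determine it. *)
Lemma is_perm_order_inj s t : is_perm s -> is_perm t -> order_iso s t -> s = t.
Proof.
move=> hs ht [es h]; apply: (@eq_from_nth _ 0) => // i hi.
rewrite is_perm_count // (@is_perm_count t) -?es //; congr _.+1.
rewrite count_nth [RHS]count_nth -es; apply: eq_in_count => j.
by rewrite mem_iota add0n => /andP[_ hj] /=; rewrite h.
Qed.

Definition std (s : seq nat) : seq nat := [seq (count (fun u => u < v) s).+1 | v <- s].

Lemma size_std s : size (std s) = size s. Proof. exact: size_map. Qed.

Lemma std_order (s : seq nat) : order_iso s (std s).
Proof.
split=> [|i j hi hj]; first by rewrite size_std.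
rewrite !(nth_map 0) // ltnS.
have mono u v : u <= v -> count (ltn^~ u) s <= count (ltn^~ v) s.
  by move=> uv; apply: sub_count => x /= /leq_trans; apply.
case: (ltnP (nth 0 s i)) => h; last by apply/esym/negbTE; rewrite -leqNgt; apply: mono.
apply/esym.
have -> : count (ltn^~ (nth 0 s j)) s = count (ltn^~ (nth 0 s i)) s +
     count [pred u | nth 0 s i <= u < nth 0 s j] s.
  rewrite -count_predUI [X in _ + X](_ : _ = 0) ?addn0; last first.
    by apply/eqP; rewrite -leqn0 leqNgt -has_count; apply/hasPn => u _ /=; lia.
  by apply: eq_count => u /=; lia.
rewrite -[X in X < _]addn0 ltn_add2l -has_count; apply/hasP.
by exists (nth 0 s i); rewrite ?mem_nth //= leqnn.
Qed.

Lemma order_iso_sym s t : order_iso s t -> order_iso t s.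
Proof. by move=> [e h]; split=> // i j hi hj; rewrite h // e. Qed.

Lemma order_iso_trans s t u : order_iso s t -> order_iso t u -> order_iso s u.
Proof.
by move=> [e h] [e' h']; split=> [|i j hi hj]; rewrite ?e // h // h' // -e.
Qed.

Lemma order_iso_uniq (s t : seq nat) : uniq s -> order_iso s t -> uniq t.
Proof.
move=> u [e h]; apply/(uniqP 0) => i j; rewrite !inE -e => hi hj E.
have E1 := h i j hi hj; have E2 := h j i hj hi.
move: E1 E2; rewrite E ltnn => E1 E2; apply/eqP.
by rewrite -(nth_uniq 0 hi hj u) eqn_leq leqNgt E2 leqNgt E1.
Qed.

Lemma std_perm (s : seq nat) : uniq s -> is_perm (std s).
Proof.
move=> u; apply: is_permI; first exact: order_iso_uniq u (std_order s).
move=> v /mapP[x xs ->] /=; rewrite size_std -(count_predC (ltn^~ x) s).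
rewrite -[X in X < _]addn0 ltn_add2l -has_count; apply/hasP.
by exists x => //=; rewrite ltnn.
Qed.

Definition voff (sg : seq nat) (als : seq (seq nat)) i : nat :=
  \sum_(j < size sg | nth 0 sg j < nth 0 sg i) size (nth [::] als j).

Definition inflate (sg : seq nat) (als : seq (seq nat)) : seq nat :=
  flatten (mkseq (fun i => map (addn (voff sg als i)) (nth [::] als i)) (size sg)).

Definition vperm (s : seq nat) : bool := (0 < size s) && perm_eq s (iota 1 (size s)).

Lemma vperm_perm s : vperm s -> is_perm s. Proof. by case/andP. Qed.

Definition inflatable (sg : seq nat) (als : seq (seq nat)) : Prop :=
  [/\ is_perm sg, size als = size sg & all vperm als].

(** Block coordinates: [bpos] sends a block index and an offset to a position of the inflation, and
    [bidx], [boff] are the components of the inverse map. They depend only on the lengths of the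
    blocks. *)
Definition bpos (als : seq (seq nat)) i x := flatten_index (shape als) i x.
Definition bidx (als : seq (seq nat)) p := reshape_index (shape als) p.
Definition boff (als : seq (seq nat)) p := reshape_offset (shape als) p.

Lemma nth_shape (als : seq (seq nat)) i : nth 0 (shape als) i = size (nth [::] als i).
Proof.
have [lt|ge] := ltnP i (size als); first by rewrite (nth_map [::]).
by rewrite !nth_default ?size_map.
Qed.

Lemma bidxK als i x : x < size (nth [::] als i) -> bidx als (bpos als i x) = i.
Proof. by rewrite -nth_shape; apply: flatten_indexKl. Qed.

Lemma boffK als i x : x < size (nth [::] als i) -> boff als (bpos als i x) = x.
Proof. by rewrite -nth_shape; apply: flatten_indexKr. Qed.

Lemma bposK als p : bpos als (bidx als p) (boff als p) = p.
Proof. exact: reshape_indexK. Qed.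

Lemma bpos_lt als i j x y :
  x < size (nth [::] als i) -> y < size (nth [::] als j) ->
  (bpos als i x < bpos als j y) = (i < j) || (i == j) && (x < y).
Proof.
rewrite -!nth_shape /bpos /flatten_index; set sh := shape als.
have key a b u : a < b -> u < nth 0 sh a -> sumn (take a sh) + u < sumn (take b sh).
  move=> ab ua; have asz : a < size sh by rewrite ltnNge; apply/negP => /(nth_default 0) e; rewrite e in ua.
  have -> : b = a + (1 + (b - a.+1)) by lia.
  rewrite takeD sumn_cat ltn_add2l (drop_nth 0) //=; lia.
move=> hx hy; case: (ltngtP i j) => [ij|ij|->] /=; last by rewrite ltn_add2l.
  by have := key _ _ _ ij hx; lia.
by have := key _ _ _ ij hy; lia.
Qed.

Section Inflate.
Variables (sg : seq nat) (als : seq (seq nat)).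
Hypothesis inf : inflatable sg als.
Let s := inflate sg als.

Lemma infl_sg : is_perm sg. Proof. by case: inf. Qed.
Lemma infl_size : size als = size sg. Proof. by case: inf. Qed.

Lemma infl_al i : i < size sg -> vperm (nth [::] als i).
Proof. by case: inf => _ e /all_nthP h hi; apply: h; rewrite e. Qed.

Lemma shape_inflate : shape (mkseq (fun i => map (addn (voff sg als i)) (nth [::] als i))
    (size sg)) = shape als.
Proof.
rewrite /shape /mkseq -map_comp -[in RHS](@mkseq_nth _ [::] als) infl_size -map_comp.
by apply: eq_map => i /=; rewrite size_map.
Qed.

Lemma size_inflate : size s = sumn (shape als).
Proof. by rewrite /s /inflate size_flatten shape_inflate. Qed.

Lemma bidx_lt p : p < size s -> bidx als p < size sg.
Proof.
by rewrite size_inflate => /reshape_indexP; rewrite size_map infl_size.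
Qed.

Lemma boff_lt p : p < size s -> boff als p < size (nth [::] als (bidx als p)).
Proof. by rewrite size_inflate -nth_shape; apply: reshape_offsetP. Qed.

Lemma bpos_ltn i x : x < size (nth [::] als i) -> bpos als i x < size s.
Proof. by rewrite size_inflate -nth_shape => /flatten_indexP. Qed.

Lemma bpos_idx i x : x < size (nth [::] als i) -> i < size sg.
Proof.
by move=> h; rewrite -infl_size ltnNge; apply/negP => /(nth_default [::]) e; rewrite e in h.
Qed.

Lemma nth_inflate_idx p : p < size s ->
  nth 0 s p = voff sg als (bidx als p) + nth 0 (nth [::] als (bidx als p)) (boff als p).
Proof.
move=> hp; rewrite /s /inflate nth_flatten shape_inflate -/(bidx _ _) -/(boff _ _).
by rewrite nth_mkseq ?bidx_lt // (nth_map 0) // boff_lt.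
Qed.

Lemma nth_inflate i x : x < size (nth [::] als i) ->
  nth 0 s (bpos als i x) = voff sg als i + nth 0 (nth [::] als i) x.
Proof. by move=> h; rewrite nth_inflate_idx ?bpos_ltn // bidxK // boffK. Qed.

Lemma voff_le i j : i < size sg -> nth 0 sg i < nth 0 sg j ->
  voff sg als i + size (nth [::] als i) <= voff sg als j.
Proof.
move=> hi hij; rewrite /voff [X in _ <= X](bigD1 (Ordinal hi)) //= addnC leq_add2l.
rewrite [X in _ <= X]big_mkcond [X in X <= _]big_mkcond /=; apply: leq_sum => k _.
case: ifP => // hk; have -> : nth 0 sg k < nth 0 sg j by apply: ltn_trans hk hij.
have -> // : k != Ordinal hi by apply/eqP => e; rewrite e ltnn in hk.
Qed.

Lemma al_nth i x : x < size (nth [::] als i) ->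
  0 < nth 0 (nth [::] als i) x <= size (nth [::] als i).
Proof.
by move=> h; apply: (is_perm_nth (vperm_perm (infl_al (bpos_idx h))) h).
Qed.

Lemma inflate_cmp i j x y :
  x < size (nth [::] als i) -> y < size (nth [::] als j) ->
  (nth 0 s (bpos als i x) < nth 0 s (bpos als j y)) =
  if i == j then nth 0 (nth [::] als i) x < nth 0 (nth [::] als i) y
  else nth 0 sg i < nth 0 sg j.
Proof.
move=> hx hy; have hi := bpos_idx hx; have hj := bpos_idx hy.
rewrite !nth_inflate //; have [ex|ne] := eqVneq i j; first by rewrite ex ltn_add2l.
have /andP[x0 xn] := al_nth hx; have /andP[y0 yn] := al_nth hy.
case: (ltngtP (nth 0 sg i) (nth 0 sg j)) => h.
- have := voff_le hi h; lia.
- have := voff_le hj h; lia.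
- by have := is_perm_inj infl_sg hi hj h; move/eqP: ne.
Qed.

Lemma inflate_cmp_idx p q : p < size s -> q < size s ->
  (nth 0 s p < nth 0 s q) =
  if bidx als p == bidx als q
  then nth 0 (nth [::] als (bidx als p)) (boff als p) <
       nth 0 (nth [::] als (bidx als p)) (boff als q)
  else nth 0 sg (bidx als p) < nth 0 sg (bidx als q).
Proof.
move=> hp hq; rewrite -{1}(bposK als p) -{1}(bposK als q) inflate_cmp ?boff_lt //.
Qed.

Lemma inflate_perm : is_perm s.
Proof.
apply: is_permI.
  apply/(uniqP 0) => p q; rewrite !inE => hp hq.
  rewrite -(bposK als p) -(bposK als q).
  have := boff_lt hp; have := boff_lt hq.
  move: (bidx als p) (bidx als q) (boff als p) (boff als q) => i j x y hy hx E.
  have := inflate_cmp hx hy; have := inflate_cmp hy hx; rewrite E ltnn eq_sym.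
  have [ij|ne] := eqVneq i j.
    subst j => E1 E2; congr bpos; apply: (is_perm_inj (vperm_perm (infl_al (bpos_idx hx)))) => //.
    lia.
  move=> E1 E2; have e : nth 0 sg i = nth 0 sg j by lia.
  have := is_perm_inj infl_sg (bpos_idx hx) (bpos_idx hy) e => ij.
  by rewrite ij eqxx in ne.
move=> v /(nthP 0)[p hp <-]; rewrite -(bposK als p); have := boff_lt hp.
move: (bidx als p) (boff als p) => i x hx.
rewrite nth_inflate //; have /andP[x0 xn] := al_nth hx; have hi := bpos_idx hx.
apply/andP; split; first by lia.
apply: (@leq_trans (voff sg als i + size (nth [::] als i))); first by lia.
rewrite size_inflate sumnE big_map (big_nth [::]) big_mkord infl_size.
rewrite [X in _ <= X](bigD1 (Ordinal hi)) //= addnC leq_add2l /voff.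
rewrite [X in _ <= X]big_mkcond [X in X <= _]big_mkcond /=; apply: leq_sum => k _.
case: ifP => // hk; have -> // : k != Ordinal hi by apply/eqP => e; rewrite e ltnn in hk.
Qed.

Lemma bidx_mono p q : p <= q -> q < size s -> bidx als p <= bidx als q.
Proof.
move=> pq hq; rewrite leqNgt; apply/negP => h.
have hp : p < size s by lia.
have := bpos_lt (boff_lt hq) (boff_lt hp); rewrite !bposK h /=; lia.
Qed.

Lemma size_inflate_ge : size sg <= size s.
Proof.
rewrite size_inflate sumnE big_map -infl_size -sum1_size big_seq [X in _ <= X]big_seq.
apply: leq_sum => a ha; case: inf => _ _ /allP/(_ a ha) /andP[] //.
Qed.

Lemma size_al_inflate i : i < size sg ->
  size s = size (nth [::] als i) + \sum_(j < size sg | j != i :> nat) size (nth [::] als j).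
Proof.
move=> hi; rewrite size_inflate sumnE big_map (big_nth [::]) big_mkord infl_size.
by rewrite (bigD1 (Ordinal hi)).
Qed.

Lemma size_al_lt i : 1 < size sg -> i < size sg -> size (nth [::] als i) < size s.
Proof.
move=> h1 hi; rewrite (size_al_inflate hi) -[X in X < _]addn0 ltn_add2l.
pose j := if i == 0 then 1 else 0; have hj : j < size sg by rewrite /j; case: eqP; lia.
rewrite (bigD1 (Ordinal hj)) //=; last by rewrite /j eq_sym; case: (i =P 0) => [->|/eqP].
by rewrite addn_gt0; have /andP[-> _] := infl_al hj.
Qed.

End Inflate.

Lemma inflate_vperm sg als : inflatable sg als -> 0 < size sg -> vperm (inflate sg als).
Proof.
move=> h h0; rewrite /vperm [perm_eq _ _](inflate_perm h) andbT.
exact: leq_trans h0 (size_inflate_ge h).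
Qed.

(** * Intervals *)

(** An interval expressed by comparisons only: no position outside separates two positions inside by
    value. This form passes easily between an inflation and its quotient; for permutations it agrees
    with [is_interval]. *)
Definition module (s : seq nat) a k : Prop :=
  a + k <= size s /\ forall x y z, a <= x < a + k -> a <= y < a + k ->
    z < size s -> ~~ (a <= z < a + k) ->
    (nth 0 s x < nth 0 s z) = (nth 0 s y < nth 0 s z).

Lemma mem_block (s : seq nat) a k v : a + k <= size s ->
  reflect (exists2 x, a <= x < a + k & nth 0 s x = v) (v \in take k (drop a s)).
Proof.
move=> hk; have sz : size (take k (drop a s)) = k by rewrite size_takel // size_drop; lia.
apply: (iffP (nthP 0)) => [[x]|[x hx <-]].
  by rewrite sz => hx; rewrite nth_take // nth_drop; exists (a + x) => //; lia.
exists (x - a); first by rewrite sz; lia.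
by rewrite nth_take ?nth_drop; [congr nth; lia | lia].
Qed.

Lemma interval_module s a k : is_perm s -> is_interval s a k -> module s a k.
Proof.
move=> hs [hk [c hc]]; split=> // x y z hx hy hz hnz.
have V u : a <= u < a + k -> c <= nth 0 s u < c + k.
  by move=> hu; rewrite -mem_iota -(perm_mem hc); apply/mem_block => //; exists u.
have NV : ~~ (c <= nth 0 s z < c + k).
  rewrite -mem_iota -(perm_mem hc); apply/mem_block => // -[u hu] /is_perm_inj E.
  by move/negP: hnz; rewrite -(E hs) //; lia.
have := V x hx; have := V y hy; lia.
Qed.

(** With [c] the least value in the block, a value between [c] and a value [v] of the block cannot
    sit outside, since it would separate the two. Hence all of [c..v] is in the block, and
    [v < c + k]. *)
Lemma module_interval s a k : is_perm s -> module s a k -> is_interval s a k.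
Proof.
move=> hs [hk hm]; split=> //; case: k hk hm => [|k] hk hm; first by exists 0; rewrite take0.
set B := take k.+1 (drop a s).
have szB : size B = k.+1 by rewrite size_takel // size_drop; lia.
have uB : uniq B by apply/take_uniq/drop_uniq/is_perm_uniq.
have exB : exists v, v \in B by exists (nth 0 B 0); rewrite mem_nth ?szB.
case: (ex_minnP exB) => c cB cmin; exists c.
have sub : {subset B <= iota c k.+1}.
  move=> v vB; rewrite mem_iota cmin //=; rewrite -ltnS.
  have : size (iota c (v - c).+1) <= size B.
    apply: uniq_leq_size; first exact: iota_uniq.
    move=> u; rewrite mem_iota => hu.
    have cs : 0 < c by have /(mem_block _ hk)[x hx <-] := cB; have := @is_perm_nth s x hs; lia.
    have vs : v <= size s by have /(mem_block _ hk)[x hx <-] := vB; have := @is_perm_nth s x hs; lia.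
    have [|z hz zu] := @is_perm_onto s u hs; first by have := cmin _ vB; lia.
    have /(mem_block _ hk)[x hx xc] := cB; have /(mem_block _ hk)[y hy yv] := vB.
    apply/(mem_block _ hk); exists z => //; apply/negPn/negP => hnz.
    have := hm x y z hx hy hz hnz; rewrite xc yv zu => E.
    have ne : u != c.
      apply/eqP => uc; move/negP: hnz; apply.
      suff -> : z = x by [].
      by apply: (is_perm_inj hs) => //; [lia | rewrite zu uc].
    have := cmin _ vB; lia.
  by rewrite size_iota szB; have := cmin _ vB; lia.
have [|_ e] := uniq_min_size uB sub; first by rewrite size_iota szB.
by apply: uniq_perm => //; apply: iota_uniq.
Qed.

Lemma simple_module s a k : is_perm s -> is_simple s -> module s a k ->
  [\/ k = 0, k = 1 | k = size s].
Proof. by move=> hs hsim /(module_interval hs)/hsim[->|[->|->]]; constructor. Qed.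

Section Blocks.
Variables (sg : seq nat) (als : seq (seq nat)).
Hypothesis inf : inflatable sg als.
Let s := inflate sg als.

Lemma size_al_gt0 i : i < size sg -> 0 < size (nth [::] als i).
Proof. by move=> /(infl_al inf)/andP[]. Qed.

Lemma bposE i x : bpos als i x = bpos als i 0 + x.
Proof. by rewrite /bpos /flatten_index addn0. Qed.

Lemma bidx_start i : i < size sg -> bidx als (bpos als i 0) = i.
Proof. by move=> h; rewrite bidxK // size_al_gt0. Qed.

Lemma bpos_start_lt i : i < size sg -> bpos als i 0 < size s.
Proof. by move=> h; apply: bpos_ltn => //; apply: size_al_gt0. Qed.

Lemma blockP i p : i < size sg -> p < size s ->
  (bpos als i 0 <= p < bpos als i 0 + size (nth [::] als i)) = (bidx als p == i).
Proof.
move=> hi hp; apply/idP/eqP => [h|h].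
  have -> : p = bpos als i (p - bpos als i 0) by rewrite bposE; lia.
  by rewrite bidxK //; lia.
have := boff_lt inf hp; have := bposK als p; rewrite h bposE; lia.
Qed.

Lemma bidx0 : 0 < size sg -> bidx als 0 = 0.
Proof. by move=> h; rewrite -[X in bidx _ X](_ : bpos als 0 0 = 0) ?bidx_start // /bpos /flatten_index take0. Qed.

Lemma bidx_last : 0 < size sg -> bidx als (size s).-1 = (size sg).-1.
Proof.
move=> h; have s0 : 0 < size s by apply: leq_trans h (size_inflate_ge inf).
have h1 : (size s).-1 < size s by lia.
have := bidx_lt inf h1.
have h2 : (size sg).-1 < size sg by lia.
have := @bidx_mono _ _ inf (bpos als (size sg).-1 0) (size s).-1.
rewrite bidx_start // -/s; have := bpos_start_lt h2; lia.
Qed.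

Lemma bidx_succ p : p.+1 < size s -> bidx als p.+1 != bidx als p ->
  bidx als p.+1 = (bidx als p).+1.
Proof.
move=> hp ne; have le := @bidx_mono _ _ inf p p.+1 (leqnSn p) hp.
have lt := bidx_lt inf hp; rewrite -?/s in le lt.
apply/eqP; rewrite eqn_leq andbC; apply/andP; split; first by lia.
rewrite leqNgt; apply/negP => h.
have hi : (bidx als p).+1 < size sg by lia.
have E := bidx_start hi; have Q := bpos_start_lt hi.
have [qp|qp] := leqP (bpos als (bidx als p).+1 0) p.
  by have := @bidx_mono _ _ inf _ _ qp (ltnW hp); rewrite E; lia.
by have := @bidx_mono _ _ inf _ _ qp Q; rewrite E; lia.
Qed.

Lemma inflate_cmp_ne p q : p < size s -> q < size s -> bidx als p != bidx als q ->
  (nth 0 s p < nth 0 s q) = (nth 0 sg (bidx als p) < nth 0 sg (bidx als q)).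
Proof. by move=> hp hq /negbTE ne; rewrite (inflate_cmp_idx inf hp hq) ne. Qed.

Lemma block_module i : i < size sg -> module s (bpos als i 0) (size (nth [::] als i)).
Proof.
move=> hi; split.
  have h : (size (nth [::] als i)).-1 < size (nth [::] als i) by have := size_al_gt0 hi; lia.
  have := bpos_ltn inf h; rewrite bposE -/s; lia.
move=> x y z hx hy hz hnz.
have B : bpos als i 0 + size (nth [::] als i) <= size s.
  have h : (size (nth [::] als i)).-1 < size (nth [::] als i) by have := size_al_gt0 hi; lia.
  have := bpos_ltn inf h; rewrite bposE -/s; lia.
have hxs : x < size s by lia.
have hys : y < size s by lia.
rewrite blockP // in hnz; move: hx hy; rewrite !blockP // => /eqP hx /eqP hy.
by rewrite !inflate_cmp_ne ?hx ?hy // eq_sym.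
Qed.

Hypothesis sim : is_simple sg.
Hypothesis sg3 : 2 < size sg.

(** The blocks met by the module form a module of [sg], so they are a single block or all blocks. In
    the latter case the module still misses the first or the last position, and then the blocks
    other than the first or the last give an interval of [sg] of size [size sg - 1], which
    simplicity excludes as [size sg > 2]. *)
Lemma module_in_block a k x y : module s a k -> k < size s ->
  a <= x < a + k -> a <= y < a + k -> bidx als x = bidx als y.
Proof.
move=> [hk hm] ks hx hy.
have k0 : 0 < k by lia.
set i0 := bidx als a; set i1 := bidx als (a + k).-1.
have ha : a < size s by lia.
have hb : (a + k).-1 < size s by lia.
have mono := @bidx_mono _ _ inf.
have i01 : i0 <= i1 by apply: mono => //; lia.
have i1m : i1 < size sg by apply: bidx_lt.
have B u : a <= u < a + k -> i0 <= bidx als u <= i1.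
  by move=> hu; apply/andP; split; apply: mono; rewrite -/s; lia.
have rep i : i0 <= i <= i1 -> exists u, (a <= u < a + k) && (bidx als u == i).
  move=> hi; have [->|ne] := eqVneq i i0; first by exists a; rewrite eqxx; lia.
  have ism : i < size sg by lia.
  exists (bpos als i 0); rewrite bidx_start // eqxx andbT.
  have := bidx_start ism; have hs := bpos_start_lt ism; set u := bpos als i 0 => E.
  apply/andP; split; first by have := @mono u a; rewrite E -/i0 -/s; lia.
  have [h|h] := leqP u (a + k).-1; first by lia.
  have := @mono _ _ (ltnW h) hs; rewrite E -/i1 => E1.
  have ei : i = i1 by lia.
  have := bposK als (a + k).-1; rewrite -/i1 -ei bposE -/u; lia.
have sm : module sg i0 (i1 - i0).+1.
  split; first by lia.
  move=> i j l hi hj hl hnl.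
  have [|u /andP[hu /eqP ui]] := rep i; first by lia.
  have [|v /andP[hv /eqP vj]] := rep j; first by lia.
  have zl := bidx_start hl; have hz := bpos_start_lt hl; set z := bpos als l 0 in zl hz.
  have hnz : ~~ (a <= z < a + k).
    by apply: contra hnl => /B; rewrite zl; lia.
  have := hm u v z hu hv hz hnz.
  by rewrite !inflate_cmp_ne ?ui ?vj ?zl; rewrite -/s; lia.
have F l a' : l < size sg -> (exists z, [&& z < size s, ~~ (a <= z < a + k) & bidx als z == l]) ->
    i0 = 0 -> i1 = (size sg).-1 -> a' + (size sg).-1 <= size sg ->
    (forall i, a' <= i < a' + (size sg).-1 -> i < size sg /\ i != l) ->
    (forall i, i < size sg -> ~~ (a' <= i < a' + (size sg).-1) -> i = l) -> False.
  move=> hl [z /and3P[hz hnz /eqP zl]] e0 e1 ha' h1 h2.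
  have := @simple_module sg a' (size sg).-1 (infl_sg inf) sim.
  suff: module sg a' (size sg).-1 by move=> sm' /(_ sm') []; lia.
  split=> // i j l' hi hj hl' /(h2 _ hl') ->.
  have [hi' ni] := h1 i hi; have [hj' nj] := h1 j hj.
  have [|u /andP[hu /eqP ui]] := rep i; first by lia.
  have [|v /andP[hv /eqP vj]] := rep j; first by lia.
  have := hm u v z hu hv hz hnz.
  by rewrite !inflate_cmp_ne ?ui ?vj ?zl; rewrite -/s; lia.
case: (simple_module (infl_sg inf) sim sm) => // e.
  by have := B x hx; have := B y hy; lia.
have e0 : i0 = 0 by lia.
have e1 : i1 = (size sg).-1 by lia.
have [a0|a0] := posnP a.
  exfalso; apply: (F (size sg).-1 0) => //; try by lia.
  - exists (size s).-1; rewrite bidx_last ?eqxx; lia.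
exfalso; apply: (F 0 1) => //; try by lia.
by exists 0; rewrite bidx0 ?eqxx; lia.
Qed.

End Blocks.

(** Block indices grow by one exactly where the block changes, so the partition of the positions
    into blocks determines [bidx], and then comparisons determine [sg] and the arguments. *)
Lemma same_blocks sg als sg' als' : inflatable sg als -> inflatable sg' als' ->
  0 < size sg -> 0 < size sg' ->
  inflate sg als = inflate sg' als' ->
  (forall p q, p < size (inflate sg als) -> q < size (inflate sg als) ->
     (bidx als p == bidx als q) = (bidx als' p == bidx als' q)) ->
  sg = sg' /\ als = als'.
Proof.
move=> inf inf' g0 g0' E hb.
set s := inflate sg als in hb.
have s0 : 0 < size s by apply: leq_trans g0 (size_inflate_ge inf).
have eb p : p < size s -> bidx als p = bidx als' p.
  elim: p => [|p IH] hp; first by rewrite (bidx0 inf) ?(bidx0 inf').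
  have := hb p.+1 p hp (ltnW hp).
  have [e|ne] := eqVneq (bidx als p.+1) (bidx als p).
    by move=> /esym/eqP ->; rewrite e IH // ltnW.
  move=> /esym ne'; rewrite (bidx_succ inf) // (bidx_succ inf') -?E ?IH //; last by rewrite ne'.
  exact: ltnW.
have esz : size sg = size sg'.
  have A := bidx_last inf g0; have B := bidx_last inf' g0'.
  rewrite -/s in A; rewrite -E -/s in B.
  by have := eb (size s).-1; rewrite A B; lia.
have est i : i < size sg -> bpos als i 0 = bpos als' i 0.
  move=> hi; have hi' : i < size sg' by rewrite -esz.
  have h1 := bpos_start_lt inf hi; have h2 := bpos_start_lt inf' hi'.
  rewrite -E in h2.
  have := bposK als' (bpos als i 0); rewrite -eb // (bidx_start inf) // bposE.
  have := bposK als (bpos als' i 0); rewrite eb // (bidx_start inf') // [bpos als i (boff _ _)]bposE.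
  lia.
have esl i : i < size sg -> size (nth [::] als i) = size (nth [::] als' i).
  move=> hi; have hi' : i < size sg' by rewrite -esz.
  have key (b c : seq (seq nat)) (gb gc : seq nat) : inflatable gb b -> inflatable gc c ->
    inflate gb b = inflate gc c -> i < size gb -> i < size gc ->
    bpos b i 0 = bpos c i 0 ->
    (forall p, p < size (inflate gb b) -> bidx b p = bidx c p) ->
    size (nth [::] b i) <= size (nth [::] c i).
    move=> ib ic e hb1 hc1 est' eb'.
    have x0 : (size (nth [::] b i)).-1 < size (nth [::] b i) by have := size_al_gt0 ib hb1; lia.
    have hp := bpos_ltn ib x0; have := eb' _ hp; rewrite (bidxK x0) => e1.
    have := boff_lt ic; rewrite -e => /(_ _ hp); rewrite -e1.
    have := bposK c (bpos b i (size (nth [::] b i)).-1).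
    rewrite -e1 bposE [bpos b _ _]bposE est'; lia.
  apply/eqP; rewrite eqn_leq (key als als' sg sg') ?(key als' als sg' sg) ?est //.
  by move=> p; rewrite -E => /eb.
split.
  apply: (is_perm_order_inj (infl_sg inf) (infl_sg inf')); split=> // i j hi hj.
  have [->|ne] := eqVneq i j; first by rewrite !ltnn.
  have := inflate_cmp inf (size_al_gt0 inf hi) (size_al_gt0 inf hj); rewrite (negbTE ne) => <-.
  rewrite !est // E (inflate_cmp inf') ?(negbTE ne) //; apply: (size_al_gt0 inf'); by rewrite -esz.
apply: (@eq_from_nth _ [::]); first by rewrite (infl_size inf) (infl_size inf').
move=> i; rewrite (infl_size inf) => hi; have hi' : i < size sg' by rewrite -esz.
apply: is_perm_order_inj; [exact/vperm_perm/(infl_al inf) | exact/vperm_perm/(infl_al inf') |].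
split; first exact: esl.
move=> x y hx hy; have := inflate_cmp inf hx hy; rewrite eqxx => <-.
rewrite bposE [bpos als i y]bposE est // -!bposE E (inflate_cmp inf') ?eqxx // -esl //.
Qed.

(** * The substitution decomposition *)

(* [d = true] stands for direct sums and [d = false] for skew sums *)
Definition two (d : bool) : seq nat := if d then [:: 1; 2] else [:: 2; 1].

Definition cmp (d : bool) (u v : nat) : bool := if d then u < v else v < u.

(** [s] is the direct or skew sum of a nonempty prefix of length [a] and a nonempty rest. It is
    boolean because canonicity has to filter lists. *)
Definition cut (d : bool) (s : seq nat) (a : nat) : bool :=
  (0 < a < size s) &&
  all (fun x => all (fun y => cmp d (nth 0 s x) (nth 0 s y)) (iota a (size s - a)))
      (iota 0 a).

Lemma cutP d s a :
  reflect (0 < a < size s /\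
    forall x y, x < a -> a <= y < size s -> cmp d (nth 0 s x) (nth 0 s y)) (cut d s a).
Proof.
apply: (iffP andP) => -[ha h]; split=> //.
  move=> x y hx hy; have /allP/(_ x) := h; rewrite mem_iota => /(_ hx)/allP/(_ y).
  by rewrite mem_iota; apply; lia.
apply/allP => x; rewrite mem_iota => hx; apply/allP => y; rewrite mem_iota => hy.
by apply: h; lia.
Qed.

Definition dec (d : bool) (s : seq nat) : bool := has (cut d s) (iota 0 (size s)).

Lemma decP d s : reflect (exists a, cut d s a) (dec d s).
Proof.
apply: (iffP hasP) => [[a _ h]|[a h]]; exists a => //.
by rewrite mem_iota; case/andP: h; lia.
Qed.

Definition canon (sg : seq nat) (als : seq (seq nat)) : bool :=
  all (fun d => (sg == two d) ==> ~~ dec d (nth [::] als 0)) [:: true; false].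

Lemma canonP sg als :
  reflect (forall d, sg = two d -> ~~ dec d (nth [::] als 0)) (canon sg als).
Proof.
apply: (iffP allP) => h d.
  by move=> e; have := h d; rewrite e eqxx; case: d e => e /=; apply.
by move=> _; apply/implyP => /eqP; apply: h.
Qed.

Lemma two_perm d : is_perm (two d). Proof. by case: d. Qed.
Lemma size_two d : size (two d) = 2. Proof. by case: d. Qed.

Lemma simple_small s : size s <= 2 -> is_simple s.
Proof. by move=> h a k [hk _]; lia. Qed.

Lemma perm2 sg : is_perm sg -> size sg = 2 -> exists d, sg = two d.
Proof.
move=> h e; exists (nth 0 sg 0 < nth 0 sg 1).
apply: is_perm_order_inj => //; first exact: two_perm.
split; first by rewrite size_two.
have ne : nth 0 sg 0 <> nth 0 sg 1.
  by move=> /is_perm_inj; rewrite e => /(_ h isT isT).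
rewrite e => -[|[|i]] // [|[|j]] // _ _; rewrite ?ltnn; case: (ltnP (nth 0 sg 0) (nth 0 sg 1)); rewrite //=; lia.
Qed.

Lemma two_cmp d i j : i < 2 -> j < 2 -> i != j ->
  (nth 0 (two d) i < nth 0 (two d) j) = cmp d i j.
Proof. by case: d; move: i j => [|[|i]] // [|[|j]]. Qed.

Section Two.
Variables (d : bool) (als : seq (seq nat)).
Hypothesis inf : inflatable (two d) als.
Let s := inflate (two d) als.
Let n0 := size (nth [::] als 0).

Lemma bpos0 x : bpos als 0 x = x. Proof. by rewrite /bpos /flatten_index take0. Qed.

Lemma size_inflate2 : size s = n0 + size (nth [::] als 1).
Proof.
rewrite (size_inflate inf) /n0; have := infl_size inf; rewrite size_two.
by case: als => [|a [|b [|]]] //= _; rewrite addn0.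
Qed.

Lemma bidx_two p : p < size s -> bidx als p = (n0 <= p).
Proof.
move=> hp; have := @blockP _ _ inf 0 p; rewrite size_two bpos0 => /(_ isT hp).
have := bidx_lt inf hp; rewrite size_two -/n0 add0n /=.
by case: (leqP n0 p) => _; case: (bidx als p) => [|[|i]].
Qed.

Lemma nth0_two x y : x < n0 -> y < n0 ->
  (nth 0 s x < nth 0 s y) = (nth 0 (nth [::] als 0) x < nth 0 (nth [::] als 0) y).
Proof. by move=> hx hy; have := inflate_cmp inf hx hy; rewrite !bpos0. Qed.

Lemma cmp0_two x y : x < n0 -> y < n0 ->
  cmp d (nth 0 s x) (nth 0 s y) = cmp d (nth 0 (nth [::] als 0) x) (nth 0 (nth [::] als 0) y).
Proof. by move=> hx hy; rewrite /cmp -!nth0_two. Qed.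

Lemma al0_gt0 : 0 < n0. Proof. by apply: size_al_gt0 inf _ _; rewrite size_two. Qed.
Lemma al1_gt0 : 0 < size (nth [::] als 1).
Proof. by apply: size_al_gt0 inf _ _; rewrite size_two. Qed.

Lemma cut_two : cut d s n0.
Proof.
have h0 := al0_gt0; have h1 := al1_gt0.
apply/cutP; split=> [|x y hx hy]; first by rewrite size_inflate2; lia.
have xs : x < size s by lia.
have hy2 : y < size s by lia.
have := inflate_cmp_ne inf xs hy2; have := inflate_cmp_ne inf hy2 xs.
have -> : bidx als x = 0 by rewrite bidx_two //; lia.
have -> : bidx als y = 1 by rewrite bidx_two //; lia.
by rewrite /cmp -/s !two_cmp // => /(_ isT) -> /(_ isT) ->; case: (d).
Qed.

Lemma cut_two_lt a : cut d s a -> a < n0 -> cut d (nth [::] als 0) a.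
Proof.
move=> /cutP[ha h] lt; apply/cutP; split=> [|x y hx hy]; first by rewrite -/n0; lia.
rewrite -cmp0_two; rewrite -?/n0 in hy *; try lia.
by apply: h => //; rewrite size_inflate2; lia.
Qed.

End Two.

Lemma inflate2_inj d als d' als' :
  inflatable (two d) als -> inflatable (two d') als' ->
  inflate (two d) als = inflate (two d') als' ->
  size (nth [::] als 0) = size (nth [::] als' 0) -> d = d' /\ als = als'.
Proof.
move=> inf inf' E e.
have g d0 : 0 < size (two d0) by rewrite size_two.
have [|ed ->] := same_blocks inf inf' (g _) (g _) E.
  by move=> p q hp hq; rewrite !(bidx_two inf) // !(bidx_two inf') -?E // e.
by split=> //; move: ed; case: (d); case: (d').
Qed.

(** The first and the last entry lie on different sides of every cut, so their comparison gives the
    direction. *)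
Lemma cut_dir d d' s a a' : cut d s a -> cut d' s a' -> d = d'.
Proof.
move=> /cutP[ha h] /cutP[ha' h'].
have := h 0 (size s).-1; have := h' 0 (size s).-1.
move=> /(_ ltac:(lia) ltac:(lia)) H1 /(_ ltac:(lia) ltac:(lia)) H2.
by case: d d' H1 H2 {h h'} => -[] //=; lia.
Qed.

(** Blocks are proper modules, so by [module_in_block] each block of one decomposition lies in a
    block of the other if the latter inflates a simple permutation of length at least 3. If both
    inflate [12] or [21], the directions agree, and the shorter of two different first arguments
    would cut the longer one. *)
Theorem inflate_inj sg als sg' als' :
  inflatable sg als -> inflatable sg' als' -> is_simple sg -> is_simple sg' ->
  1 < size sg -> 1 < size sg' -> canon sg als -> canon sg' als' ->
  inflate sg als = inflate sg' als' -> sg = sg' /\ als = als'.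
Proof.
move=> inf inf' sim sim' g1 g1' can can' E.
have szE : size (inflate sg als) = size (inflate sg' als') by rewrite E.
have key (tg tg' : seq nat) (bls bls' : seq (seq nat)) :
    inflatable tg bls -> inflatable tg' bls' -> is_simple tg -> 2 < size tg -> 1 < size tg' ->
    inflate tg bls = inflate tg' bls' ->
    forall p q, p < size (inflate tg bls) -> q < size (inflate tg bls) ->
      bidx bls' p = bidx bls' q -> bidx bls p = bidx bls q.
  move=> i i' sm h h' e p q hp hq.
  rewrite e in hp hq => epq.
  have hi := bidx_lt i' hp; have B := block_module i' hi; rewrite -e in B.
  apply: (module_in_block i sm h B).
  - by rewrite e; apply: size_al_lt.
  - by rewrite (blockP i').
  - by rewrite (blockP i') // epq.
have [g2|g2] := ltnP 2 (size sg); have [g2'|g2'] := ltnP 2 (size sg').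
- apply: (same_blocks inf inf') => //; try lia.
  move=> p q hp hq; apply/eqP/eqP; last exact: (key _ _ _ _ inf inf').
  by apply: (key _ _ _ _ inf' inf) => //; rewrite -E.
- exfalso.
  have K p q := key _ _ _ _ inf inf' sim g2 g1' E p q.
  have P i : i < 3 -> bpos als i 0 < size (inflate sg als) by move=> h; apply: bpos_start_lt => //; lia.
  have D i j : i < 3 -> j < 3 -> i != j -> bidx als' (bpos als i 0) != bidx als' (bpos als j 0).
    move=> hi hj; apply: contra => /eqP/(K _ _ (P i hi) (P j hj)).
    by rewrite !(bidx_start inf); lia.
  have L i : i < 3 -> bidx als' (bpos als i 0) < 2.
    by move=> h; have := P i h; rewrite E => /(bidx_lt inf'); lia.
  have := D 0 1; have := D 0 2; have := D 1 2; have := L 0; have := L 1; have := L 2; lia.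
- exfalso.
  have K p q := key _ _ _ _ inf' inf sim' g2' g1 (esym E) p q.
  have P i : i < 3 -> bpos als' i 0 < size (inflate sg' als') by move=> h; apply: bpos_start_lt => //; lia.
  have D i j : i < 3 -> j < 3 -> i != j -> bidx als (bpos als' i 0) != bidx als (bpos als' j 0).
    move=> hi hj; apply: contra => /eqP/(K _ _ (P i hi) (P j hj)).
    by rewrite !(bidx_start inf'); lia.
  have L i : i < 3 -> bidx als (bpos als' i 0) < 2.
    by move=> h; have := P i h; rewrite -E => /(bidx_lt inf); lia.
  have := D 0 1; have := D 0 2; have := D 1 2; have := L 0; have := L 1; have := L 2; lia.
have [|d ed] := @perm2 sg (infl_sg inf); first by lia.
have [|d' ed'] := @perm2 sg' (infl_sg inf'); first by lia.
subst sg sg'.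
have c := cut_two inf; have c' := cut_two inf'; rewrite -E in c'.
have edd := cut_dir c c'; subst d'.
have /canonP/(_ d erefl)/decP nc := can; have /canonP/(_ d erefl)/decP nc' := can'.
suff e : size (nth [::] als 0) = size (nth [::] als' 0).
  by have [_ ->] := inflate2_inj inf inf' E e.
case: (ltngtP (size (nth [::] als 0)) (size (nth [::] als' 0))) => // h; exfalso.
  by apply: nc'; exists (size (nth [::] als 0)); apply: cut_two_lt; rewrite -?E.
by apply: nc; exists (size (nth [::] als' 0)); apply: cut_two_lt.
Qed.

(* a tiling of the positions of [s] by [m] consecutive nonempty modules, given by the map [b]
   sending each position to the index of its tile *)
Definition tiling (s : seq nat) (b : nat -> nat) (m : nat) : Prop :=
  [/\ forall x y, x <= y -> y < size s -> b x <= b y,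
      forall x, x < size s -> b x < m,
      forall i, i < m -> exists2 x, x < size s & b x = i &
      forall x y z, x < size s -> y < size s -> z < size s -> b x = b y -> b z <> b x ->
        (nth 0 s x < nth 0 s z) = (nth 0 s y < nth 0 s z)].

Lemma filter_level_split (b : nat -> nat) m l : sorted (fun x y => b x <= b y) l ->
  [seq x <- l | b x < m] ++ [seq x <- l | b x == m] = [seq x <- l | b x < m.+1].
Proof.
elim: l => //= x l IH hs; have {}IH := IH (path_sorted hs).
rewrite !ltnS; case: (ltngtP (b x) m) => h.
- by rewrite cat_cons IH.
- rewrite -IH //.
have hall : all (fun y => m <= b y) l.
  have tr : transitive (fun x y => b x <= b y) by move=> u v w; apply: leq_trans.
  by have := order_path_min tr hs; rewrite h.
have -> : [seq x <- l | b x < m] = [::].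
  rewrite (@eq_in_filter _ _ pred0) ?filter_pred0 // => y /(allP hall) /=; lia.
rewrite /=; congr cons; move: IH.
have -> // : [seq x <- l | b x < m] = [::].
rewrite (@eq_in_filter _ _ pred0) ?filter_pred0 // => y /(allP hall) /=; lia.
Qed.

Lemma tiling_inflate s b m : is_perm s -> tiling s b m ->
  exists sg als, [/\ inflatable sg als, size sg = m, s = inflate sg als &
    forall p, p < size s -> bidx als p = b p].
Proof.
move=> hs [mono bm surj hmod].
pose n := size s; pose blk i := [seq x <- iota 0 n | b x == i].
have blkP i x : (x \in blk i) = (x < n) && (b x == i).
  by rewrite mem_filter mem_iota andbC.
have uval i : uniq (map (nth 0 s) (blk i)).
  rewrite map_inj_in_uniq ?filter_uniq ?iota_uniq // => x y.
  by rewrite !blkP => /andP[hx _] /andP[hy _]; apply: is_perm_inj.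
pose rep i := head 0 (blk i).
have repP i : i < m -> rep i < n /\ b (rep i) = i.
  move=> /surj[x hx bx]; have : x \in blk i by rewrite blkP hx bx /=.
  rewrite /rep; have := blkP i; case: (blk i) => // y l h _ /=.
  by have := h y; rewrite mem_head => /esym/andP[-> /eqP ->].
pose als := mkseq (fun i => std (map (nth 0 s) (blk i))) m.
pose reps := mkseq (fun i => nth 0 s (rep i)) m.
exists (std reps), als.
have szr : size (std reps) = m by rewrite size_std size_mkseq.
have ureps : uniq reps.
  rewrite map_inj_in_uniq ?iota_uniq // => i j; rewrite !mem_iota => hi hj.
  have [h1 h2] := repP i hi; have [h3 h4] := repP j hj.
  by move=> /(is_perm_inj hs h1 h3) e; rewrite -h2 e h4.
have inf : inflatable (std reps) als.
  split; [exact: std_perm | by rewrite szr size_mkseq |].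
  apply/(all_nthP [::]) => i; rewrite size_mkseq => hi; rewrite nth_mkseq // /vperm.
  rewrite [perm_eq _ _](std_perm (uval i)) andbT size_std size_map.
  have [h1 h2] := repP i hi; have : rep i \in blk i by rewrite blkP h1 h2 /=.
  by case: (blk i).
have shE : shape als = shape (mkseq blk m).
  by rewrite /shape -!map_comp; apply: eq_map => i /=; rewrite size_std size_map.
have flat : flatten (mkseq blk m) = iota 0 n.
  have srt : sorted (fun x y => b x <= b y) (iota 0 n).
    rewrite (@sorted_pairwise _ (fun x y => b x <= b y)); last by move=> u v w; apply: leq_trans.
    have := iota_sorted 0 n; rewrite (sorted_pairwise leq_trans).
    move=> /(pairwiseP 0) h; apply/(pairwiseP 0) => i j; rewrite !inE size_iota => hi hj ij.
    by apply: mono; [apply: h; rewrite ?inE ?size_iota | rewrite nth_iota].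
  have -> : iota 0 n = [seq x <- iota 0 n | b x < m].
    apply/esym/all_filterP/allP => x; rewrite mem_iota; exact: bm.
  elim: (m) => [|k IH]; first by rewrite (@eq_filter _ _ pred0) ?filter_pred0.
  by rewrite /mkseq -addn1 iotaD map_cat flatten_cat -/(mkseq _ _) IH /= cats0 filter_level_split ?addn1.
have idx p : p < n -> [/\ bidx als p < m, nth 0 (blk (bidx als p)) (boff als p) = p,
    boff als p < size (blk (bidx als p)) & b p = bidx als p].
  move=> hp; have szf : p < sumn (shape (mkseq blk m)) by rewrite -size_flatten flat size_iota.
  have h1 : bidx als p < m.
    by have := reshape_indexP szf; rewrite -shE size_map size_mkseq.
  have h2 := reshape_offsetP szf; rewrite nth_shape in h2.
  rewrite -shE -/(bidx als p) -/(boff als p) nth_mkseq // in h2.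
  have h3 : nth 0 (blk (bidx als p)) (boff als p) = p.
    have := nth_iota 0 0 hp; rewrite -flat nth_flatten -shE -/(bidx als p) -/(boff als p).
    by rewrite nth_mkseq.
  split=> //; have := mem_nth 0 h2; rewrite h3 blkP => /andP[_ /eqP //].
have sz : size (inflate (std reps) als) = n.
  by rewrite (size_inflate inf) shE -size_flatten flat size_iota.
split=> //; last by move=> p /idx[_ _ _ ->].
apply: (is_perm_order_inj hs (inflate_perm inf)); split; first by rewrite sz.
move=> p q hp hq; rewrite (inflate_cmp_idx inf) ?sz //.
have [p1 p2 p3 p4] := idx p hp; have [q1 q2 q3 q4] := idx q hq.
have [e|ne] := eqVneq (bidx als p) (bidx als q).
  rewrite nth_mkseq //; have [_ <-] := std_order (map (nth 0 s) (blk (bidx als p))).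
  - by rewrite !(nth_map 0) ?p2 // ?e ?q2 // -e.
  - by rewrite size_map.
  - by rewrite size_map e.
have [_ <-] := std_order reps; rewrite ?size_mkseq // !nth_mkseq //.
have [r1 r2] := repP _ p1; have [r3 r4] := repP _ q1.
rewrite (hmod p (rep (bidx als p)) q) ?r2 ?p4 ?q4 //; last by apply/eqP; rewrite eq_sym.
have flip u v w : u < n -> v < n -> w < n -> b v = b w -> b u <> b v ->
    (nth 0 s u < nth 0 s v) = (nth 0 s u < nth 0 s w).
  move=> hu hv hw e ne'; have := hmod v w u hv hw hu e ne'.
  have d1 : nth 0 s u <> nth 0 s v by move=> /(is_perm_inj hs hu hv) E; apply: ne'; rewrite E.
  have d2 : nth 0 s u <> nth 0 s w by move=> /(is_perm_inj hs hu hw) E; apply: ne'; rewrite e -E.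
  lia.
by apply: flip => //; rewrite ?r2 ?r4 ?q4 //; apply/eqP.
Qed.

(** As long as the quotient [sg] is not simple, the tiles of one of its nontrivial intervals are
    merged. The number of tiles drops but stays above 1, as the interval is not all of [sg]. *)
Lemma simple_tiling s b m : is_perm s -> tiling s b m -> 1 < m ->
  exists sg als, [/\ inflatable sg als, is_simple sg, 1 < size sg & s = inflate sg als].
Proof.
move=> hs; elim/ltn_ind: m b => m IH b ht m1.
have [sg [als [inf szm E eb]]] := tiling_inflate hs ht.
have [sim|/not_all_ex_not[a /not_all_ex_not[k nsim]]] := classic (is_simple sg).
  by exists sg, als; split=> //; rewrite szm.
have [itv /not_or_and[k0 /not_or_and[k1 km]]] := imply_to_and _ _ nsim.
have [hk hm] := interval_module (infl_sg inf) itv.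
have [mono bm surj hmod] := ht.
rewrite szm in hk km hm.
pose c j := if j < a then j else if j < a + k then a else j - k + 1.
have cmono i j : i <= j -> c i <= c j by rewrite /c; do 4?case: ifP; lia.
apply: (IH (m - k + 1) _ (c \o b)); [lia | split | lia].
- by move=> x y xy hy; apply/cmono/mono.
- by move=> x /bm; rewrite /c /=; do 2?case: ifP; lia.
- move=> i hi; pose j := if i <= a then i else i + k - 1.
  have [|x hx bx] := surj j; first by rewrite /j; case: ifP; lia.
  by exists x; rewrite //= bx /c /j; do 3?case: ifP; lia.
move=> x y z hx hy hz /= cxy cz.
have [bxy|bxy] := eqVneq (b x) (b y).
  by apply: hmod => // e; apply: cz; rewrite e.
have cE j : [\/ j < a /\ c j = j, a <= j < a + k /\ c j = a | a + k <= j /\ c j = j - k + 1].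
  rewrite /c; case: (ltnP j a) => h1; first by constructor.
  by case: (ltnP j (a + k)) => h2; [constructor 2 | constructor 3].
rewrite neq_ltn in bxy.
have [hbx hby hbz] : [/\ a <= b x < a + k, a <= b y < a + k & ~~ (a <= b z < a + k)].
  have H := cE (b x); have H0 := cE (b y); have H1 := cE (b z).
  by split; move: cxy cz bxy; case: H => -[h ->]; case: H0 => -[h' ->]; case: H1 => -[h'' ->]; lia.
rewrite E !(inflate_cmp_ne inf) -?E // ?eb //; try by apply/eqP => e; move: hbz; rewrite -e ?hbx ?hby.
by apply: hm => //; rewrite ?bm.
Qed.

Lemma tiling_id s : is_perm s -> tiling s id (size s).
Proof.
move=> hs; split=> //; first by move=> i hi; exists i.
by move=> x y z _ _ _ ->.
Qed.

Lemma cut_cut d s c als : inflatable (two d) als -> s = inflate (two d) als ->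
  cut d (nth [::] als 0) c -> cut d s c.
Proof.
move=> inf -> /cutP[hc h]; have h1 := al1_gt0 inf.
have /cutP[_ h'] := cut_two inf.
have sz := size_inflate2 inf.
apply/cutP; split=> [|x y hx hy]; first by rewrite sz; lia.
have [lt|ge] := ltnP y (size (nth [::] als 0)); last by apply: h'; lia.
by rewrite (cmp0_two inf) //; [apply: h; lia | lia].
Qed.

Lemma cut_inflate d s a : is_perm s -> cut d s a ->
  exists als, [/\ inflatable (two d) als, s = inflate (two d) als & size (nth [::] als 0) = a].
Proof.
move=> hs ca; have /cutP[ha hcut] := ca.
have [|sg [als [inf sz E eb]]] := @tiling_inflate s (fun x => a <= x) 2 hs.
  split.
  - by move=> x y xy hy; case: (leqP a x) => //= h; have -> : a <= y by lia.
  - by move=> x _; case: (a <= x).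
  - by move=> [|[|i]] // _; [exists 0 | exists a]; lia.
  move=> x y z hx hy hz; case: (leqP a x) => h1; case: (leqP a y) => h2; case: (leqP a z) => h3 //= _ _.
    have := hcut z x h3; have := hcut z y h3; case: (d) => /=; lia.
  have := hcut x z h1; have := hcut y z h2; case: (d) => /=; lia.
have [d' ed] := perm2 (infl_sg inf) sz; subst sg.
have n0 : size (nth [::] als 0) = a.
  set n0 := size _; have sE := size_inflate2 inf; have h1 := al1_gt0 inf; have h0 := al0_gt0 inf.
  have B p : p < size s -> (n0 <= p : nat) = (a <= p).
    by move=> hp; rewrite -eb // (bidx_two inf) // -E.
  rewrite -E -/n0 in sE; have := B n0; have := B a; rewrite !leqnn; lia.
have dd : d' = d by have := cut_two inf; rewrite -E => h; apply: cut_dir h ca.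
by subst d'; exists als.
Qed.

(** In the decomposable case the least cut is taken: a cut of the prefix would be a smaller cut of
    [s]. Otherwise the tiling into single positions is coarsened, and the simple permutation
    obtained cannot be [12] or [21], so canonicity is vacuous. *)
Theorem decomposition s : is_perm s -> 1 < size s ->
  exists sg als, [/\ inflatable sg als, is_simple sg, 1 < size sg, canon sg als &
    s = inflate sg als].
Proof.
move=> hs s1.
have [[d /decP D]|nd] := classic (exists d, dec d s).
  case: (ex_minnP D) => a ca amin.
  have [als [inf E n0]] := cut_inflate hs ca.
  exists (two d), als; split=> //; first by apply: simple_small; rewrite size_two.
    by rewrite size_two.
  apply/canonP => d2 e; have <- : d = d2 by move: e; case: (d); case: (d2).
  apply/decP => -[c hc]; have := amin c (cut_cut inf E hc).
  by case/cutP: hc; rewrite n0; lia.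
have [sg [als [inf sim g1 E]]] := simple_tiling hs (tiling_id hs) s1.
exists sg, als; split=> //; apply/canonP => d e; exfalso; apply: nd; exists d.
by apply/decP; exists (size (nth [::] als 0)); rewrite E e; apply: cut_two; rewrite -e.
Qed.

(** * Inverses *)

Definition inv (s : seq nat) : seq nat := mkseq (fun v => (index v.+1 s).+1) (size s).

(* [s] as a map on 0-based positions *)
Definition pv (s : seq nat) p := (nth 0 s p).-1.

Lemma size_inv s : size (inv s) = size s. Proof. exact: size_mkseq. Qed.

Lemma pv_lt s p : is_perm s -> p < size s -> pv s p < size s.
Proof. by move=> hs hp; have := is_perm_nth hs hp; rewrite /pv; lia. Qed.

Lemma pvE s p : is_perm s -> p < size s -> (pv s p).+1 = nth 0 s p.
Proof. by move=> hs hp; have := is_perm_nth hs hp; rewrite /pv; lia. Qed.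

Lemma pv_ltE s p q : is_perm s -> p < size s -> q < size s ->
  (pv s p < pv s q) = (nth 0 s p < nth 0 s q).
Proof. by move=> hs hp hq; rewrite -ltnS !pvE. Qed.

Lemma nth_inv s p : is_perm s -> p < size s -> nth 0 (inv s) (pv s p) = p.+1.
Proof.
move=> hs hp; rewrite nth_mkseq ?pv_lt // pvE //.
by rewrite index_uniq // is_perm_uniq.
Qed.

Lemma pv_onto s q : is_perm s -> q < size s -> exists2 p, p < size s & pv s p = q.
Proof.
move=> hs hq; have [|p hp e] := @is_perm_onto s q.+1 hs; first by lia.
by exists p; rewrite // /pv e.
Qed.

Lemma pv_inj s p q : is_perm s -> p < size s -> q < size s -> pv s p = pv s q -> p = q.
Proof.
by move=> hs hp hq e; apply: (is_perm_inj hs) => //; rewrite -!pvE // e.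
Qed.

Lemma inv_perm s : is_perm s -> is_perm (inv s).
Proof.
move=> hs; apply: is_permI; last first.
  move=> v /(nthP 0)[q]; rewrite size_inv => hq <-.
  by have [p hp <-] := pv_onto hs hq; rewrite nth_inv.
apply/(uniqP 0) => q r; rewrite !inE size_inv => hq hr.
have [p hp <-] := pv_onto hs hq; have [p' hp' <-] := pv_onto hs hr.
by rewrite !nth_inv // => -[->].
Qed.

Lemma pv_inv s p : is_perm s -> p < size s -> pv (inv s) (pv s p) = p.
Proof. by move=> hs hp; rewrite /pv nth_inv. Qed.

Lemma inv_vperm s : vperm s -> vperm (inv s).
Proof. by case/andP=> h1 h2; rewrite /vperm size_inv h1; have := inv_perm h2; rewrite /is_perm size_inv. Qed.

Lemma inv_eq s t : is_perm s -> size t = size s ->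
  (forall p, p < size s -> nth 0 t (pv s p) = p.+1) -> t = inv s.
Proof.
move=> hs e h; apply: (@eq_from_nth _ 0); rewrite ?size_inv // e => q hq.
by have [p hp <-] := pv_onto hs hq; rewrite h // nth_inv.
Qed.

Lemma invK s : is_perm s -> inv (inv s) = s.
Proof.
move=> hs; apply/esym; apply: inv_eq; rewrite ?size_inv //; first exact: inv_perm.
move=> q hq; have [p hp <-] := pv_onto hs hq.
by rewrite pv_inv // pvE.
Qed.

Lemma involutionP s : is_perm s -> involution s <-> inv s = s.
Proof.
move=> hs; split=> [h|h p hp]; last by rewrite -/(pv s p) -{1}h nth_inv.
by apply/esym/inv_eq.
Qed.

(** The inverse is characterized by order: [f] is ordered like the values of [s], hence is the map
    [pv s], and [t] read along [f] is increasing. With this the inverse of an inflation is found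
    without computing shifts. *)
Lemma inv_char s t (f : nat -> nat) : is_perm s -> is_perm t -> size t = size s ->
  (forall p, p < size s -> f p < size s) ->
  (forall p q, p < size s -> q < size s -> (f p < f q) = (nth 0 s p < nth 0 s q)) ->
  (forall p q, p < size s -> q < size s -> (nth 0 t (f p) < nth 0 t (f q)) = (p < q)) ->
  t = inv s.
Proof.
move=> hs ht e hf fs ft.
have finj p q : p < size s -> q < size s -> f p = f q -> p = q.
  move=> hp hq E; apply: (is_perm_inj hs) => //.
  by have := fs p q hp hq; have := fs q p hq hp; rewrite E ltnn; lia.
have es : s = mkseq (fun p => (f p).+1) (size s).
  apply: (is_perm_order_inj hs); last first.
    by split=> [|i j hi hj]; rewrite ?size_mkseq // !nth_mkseq // ltnS fs.
  apply: is_permI.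
    by rewrite map_inj_in_uniq ?iota_uniq // => p q; rewrite !mem_iota => hp hq [/finj]; apply.
  by move=> v /mapP[p]; rewrite mem_iota size_mkseq => hp ->; rewrite /= hf.
apply: inv_eq => // p hp.
have fp q : q < size s -> f q = pv s q by move=> hq; rewrite /pv [in RHS]es nth_mkseq.
have eg : mkseq (fun p => nth 0 t (f p)) (size s) = iota 1 (size s).
  apply: is_perm_order_inj; last first.
  - split=> [|i j]; rewrite ?size_iota size_mkseq // => hi hj.
    by rewrite !nth_mkseq // !nth_iota // ft.
  - by rewrite /is_perm size_iota.
  apply: is_permI.
    rewrite map_inj_in_uniq ?iota_uniq // => x y; rewrite !mem_iota => hx hy.
    by move=> /(is_perm_inj ht); rewrite e => /(_ (hf _ hx) (hf _ hy)); apply: finj.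
  move=> v /mapP[x]; rewrite mem_iota size_mkseq -e => hx ->.
  by apply: is_perm_nth => //; rewrite e hf // -e.
by have := congr1 (nth 0 ^~ p) eg; rewrite /= nth_mkseq // nth_iota // fp.
Qed.

Definition inv_args (sg : seq nat) (als : seq (seq nat)) : seq (seq nat) :=
  mkseq (fun j => inv (nth [::] als (pv (inv sg) j))) (size sg).

Lemma nth_inv_args sg als i : is_perm sg -> i < size sg ->
  nth [::] (inv_args sg als) (pv sg i) = inv (nth [::] als i).
Proof. by move=> h hi; rewrite nth_mkseq ?pv_lt // pv_inv. Qed.

Lemma inv_inflatable sg als : inflatable sg als -> inflatable (inv sg) (inv_args sg als).
Proof.
move=> inf; have [h1 h2 h3] := inf; split; first exact: inv_perm.
  by rewrite size_inv size_mkseq.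
apply/(all_nthP [::]) => j; rewrite size_mkseq => hj.
have [i hi <-] := pv_onto h1 hj; rewrite nth_inv_args //.
exact/inv_vperm/(infl_al inf).
Qed.

Lemma inv_inflate sg als : inflatable sg als ->
  inv (inflate sg als) = inflate (inv sg) (inv_args sg als).
Proof.
move=> inf; have inf' := inv_inflatable inf; apply/esym.
have hsg := infl_sg inf.
set s := inflate sg als; set bls := inv_args sg als.
have hal i : i < size sg -> is_perm (nth [::] als i) by move=> /(infl_al inf)/vperm_perm.
(* The value of [s] at [p], in block coordinates of the inverse: block and offset are the values of
   [sg] and of the argument. *)
pose f p := bpos bls (pv sg (bidx als p)) (pv (nth [::] als (bidx als p)) (boff als p)).
have aux p : p < size s -> let i := bidx als p in let x := boff als p in
    [/\ i < size sg, x < size (nth [::] als i),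
        pv (nth [::] als i) x < size (nth [::] bls (pv sg i)) &
        nth [::] bls (pv sg i) = inv (nth [::] als i)].
  move=> hp i x; have hi : i < size sg := bidx_lt inf hp.
  have hx : x < size (nth [::] als i) := boff_lt inf hp.
  by split=> //; rewrite nth_inv_args // size_inv; apply: pv_lt => //; apply: hal.
have szE : size (inflate (inv sg) bls) = size s.
  rewrite (size_inflate inf') (size_inflate inf); apply: perm_sumn.
  have -> : shape bls = map (nth 0 (shape als)) (mkseq (pv (inv sg)) (size sg)).
    rewrite /shape /bls /inv_args -!map_comp; apply: eq_map => j /=.
    by rewrite size_inv nth_shape.
  rewrite perm_sym -{1}(map_nth_iota (shape als)) size_map (infl_size inf).
  apply: perm_map; rewrite perm_sym; apply: uniq_perm; rewrite ?iota_uniq //.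
    rewrite map_inj_in_uniq ?iota_uniq // => x y; rewrite !mem_iota => hx hy.
    by apply: pv_inj; rewrite ?size_inv //; apply: inv_perm.
  move=> v; apply/mapP/idP => [[j]|]; rewrite !mem_iota => hj.
    by move=> ->; have := @pv_lt (inv sg) j (inv_perm hsg); rewrite size_inv; apply.
  by exists (pv sg v); rewrite ?mem_iota ?pv_lt // pv_inv.
apply: (@inv_char _ _ f) => //.
- exact: inflate_perm inf.
- exact: inflate_perm inf'.
- by move=> p /aux[_ _ h _]; rewrite -szE /f; apply: bpos_ltn.
- move=> p q hp hq; have [i1 i2 i3 i4] := aux p hp; have [j1 j2 j3 j4] := aux q hq.
  rewrite /f bpos_lt // (inflate_cmp_idx inf) //.
  have [e|ne] := eqVneq (bidx als p) (bidx als q).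
    by rewrite -!e in j2 *; rewrite eqxx ltnn /= pv_ltE //; apply: hal.
  rewrite pv_ltE //; case: eqP => [/(pv_inj hsg i1 j1) e|_]; last by rewrite orbF.
  by rewrite e eqxx in ne.
move=> p q hp hq; have [i1 i2 i3 i4] := aux p hp; have [j1 j2 j3 j4] := aux q hq.
rewrite /f (inflate_cmp inf') //.
have -> : (p < q) = (bidx als p < bidx als q) ||
    (bidx als p == bidx als q) && (boff als p < boff als q).
  by rewrite -(bpos_lt i2 j2) !bposK.
have [e|ne] := eqVneq (bidx als p) (bidx als q).
  by rewrite -!e in j2 *; rewrite eqxx i4 !nth_inv ?ltnn ?ltnS //; apply: hal.
case: eqP => [/(pv_inj hsg i1 j1) e|_]; first by rewrite e eqxx in ne.
by rewrite !nth_inv // ltnS orbF.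
Qed.

Lemma interval_inv s a k : is_perm s -> is_interval s a k ->
  k = 0 \/ exists b, is_interval (inv s) b k.
Proof.
move=> hs [hk [c hc]]; case: k hk hc => [|k] hk hc; first by left.
right.
have V u : a <= u < a + k.+1 -> c <= nth 0 s u < c + k.+1.
  by move=> hu; rewrite -mem_iota -(perm_mem hc); apply/mem_block => //; exists u.
have sz : size (take k.+1 (drop a s)) = k.+1 by rewrite size_takel // size_drop; lia.
have W u : c <= u < c + k.+1 -> exists2 x, a <= x < a + k.+1 & nth 0 s x = u.
  by rewrite -mem_iota -(perm_mem hc) => /(mem_block _ hk).
have c0 : 0 < c by have [|x hx <-] := W c; [lia | have := @is_perm_nth s x hs; lia].
have ck : c + k <= size s.
  by have [|x hx E] := W (c + k); [lia | have := @is_perm_nth s x hs; lia].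
have hk' : c.-1 + k.+1 <= size (inv s) by rewrite size_inv; lia.
exists c.-1; split=> //; exists a.+1.
apply: uniq_perm; rewrite ?iota_uniq //; first exact/take_uniq/drop_uniq/is_perm_uniq/inv_perm.
move=> v; rewrite mem_iota; apply/(mem_block _ hk')/idP => [[x hx <-]|hv].
  have [|y hy E] := W x.+1; first by lia.
  have <- : pv s y = x by rewrite /pv E.
  by rewrite nth_inv //; lia.
exists (pv s v.-1); last by rewrite nth_inv //; lia.
by have := V v.-1; have := @pvE s v.-1 hs; lia.
Qed.

Lemma inv_simple s : is_perm s -> is_simple s -> is_simple (inv s).
Proof.
move=> hs sim a k itv; rewrite size_inv.
have [|[b]] := interval_inv (inv_perm hs) itv; first by left.
by rewrite invK // => /sim.
Qed.

Lemma inv_two d : inv (two d) = two d. Proof. by case: d. Qed.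

Lemma inv_args_true a b : inv_args (two true) [:: a; b] = [:: inv a; inv b].
Proof. by []. Qed.

Lemma inv_args_false a b : inv_args (two false) [:: a; b] = [:: inv b; inv a].
Proof. by []. Qed.

Lemma two_args sg als d : inflatable sg als -> sg = two d ->
  als = [:: nth [::] als 0; nth [::] als 1].
Proof.
by move=> inf e; have := infl_size inf; rewrite e size_two; case: als {inf} => [|a [|b [|]]].
Qed.

(** * Well-quasi-ordering of substitution closures *)

Lemma fun_choice (A B : Type) (R : A -> B -> Prop) :
  (forall x, exists y, R x y) -> exists f, forall x, R x (f x).
Proof.
move=> h; exists (fun x => proj1_sig (constructive_indefinite_description _ (h x))).
by move=> x; case: constructive_indefinite_description.
Qed.

(** Containment with a map on positions in place of an index list; such maps compose and can be
    glued block by block. *)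
Definition emb (s t : seq nat) : Prop :=
  exists f : nat -> nat, [/\ forall x, x < size s -> f x < size t,
    forall x y, x < size s -> y < size s -> (f x < f y) = (x < y) &
    forall x y, x < size s -> y < size s ->
      (nth 0 t (f x) < nth 0 t (f y)) = (nth 0 s x < nth 0 s y)].

Lemma sorted_ltn_nth I x y : sorted ltn I -> x < size I -> y < size I ->
  (nth 0 I x < nth 0 I y) = (x < y).
Proof.
move=> hI hx hy; have := sorted_ltn_nth ltn_trans 0 hI; move=> H.
have H1 a b : a < size I -> b < size I -> a < b -> nth 0 I a < nth 0 I b.
  by move=> ha hb; apply: H; rewrite inE.
case: (ltngtP x y) => h; first exact: H1.
  by apply/negbTE; rewrite -leqNgt ltnW // H1.
by rewrite h ltnn.
Qed.

Lemma containsP s t : contains t s <-> emb s t.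
Proof.
split=> [[I [[hI /allP aI] [e h]]]|[f [f1 f2 f3]]].
  rewrite size_map in e h; exists (nth 0 I); split.
  - by move=> x hx; apply: aI; rewrite mem_nth ?e.
  - by move=> x y hx hy; apply: sorted_ltn_nth; rewrite ?e.
  by move=> x y hx hy; rewrite -h ?e // !(nth_map 0) ?e.
exists (mkseq f (size s)); split; last first.
  split=> [|i j]; rewrite size_map size_mkseq // => hi hj.
  by rewrite /occ /mkseq !(nth_map 0) ?size_map ?size_iota // !nth_iota // f3.
split; last by apply/(all_nthP 0) => i; rewrite size_mkseq => hi; rewrite nth_mkseq // f1.
apply/(sortedP 0) => i; rewrite size_mkseq => hi; have hi' : i < size s by lia.
by rewrite !nth_mkseq //= f2.
Qed.

Lemma emb_trans s t u : emb s t -> emb t u -> emb s u.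
Proof.
move=> [f [f1 f2 f3]] [g [g1 g2 g3]]; exists (g \o f); split=> /=.
- by move=> x /f1/g1.
- by move=> x y hx hy; rewrite g2 ?f1 // f2.
by move=> x y hx hy; rewrite g3 ?f1 // f3.
Qed.

Lemma emb1 t : 0 < size t -> emb [:: 1] t.
Proof.
by move=> h; exists (fun=> 0); split=> // [x|] [|y] //= [|z]; rewrite // ?ltnn.
Qed.

Lemma emb_inflate_sg sg als : inflatable sg als -> emb sg (inflate sg als).
Proof.
move=> inf; exists (fun i => bpos als i 0); split.
- by move=> i hi; apply: bpos_start_lt.
- by move=> i j hi hj; rewrite bpos_lt ?(size_al_gt0 inf) // ltnn andbF orbF.
move=> i j hi hj; rewrite (inflate_cmp inf) ?(size_al_gt0 inf) // ltnn.
by case: eqP => // ->; rewrite ltnn.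
Qed.

Lemma emb_al sg als i : inflatable sg als -> i < size sg -> emb (nth [::] als i) (inflate sg als).
Proof.
move=> inf hi; exists (bpos als i); split.
- by move=> x hx; apply: bpos_ltn.
- by move=> x y hx hy; rewrite bpos_lt // ltnn eqxx.
by move=> x y hx hy; rewrite (inflate_cmp inf) // eqxx.
Qed.

Lemma emb_inflate sg als bls : inflatable sg als -> inflatable sg bls ->
  (forall i, i < size sg -> emb (nth [::] als i) (nth [::] bls i)) ->
  emb (inflate sg als) (inflate sg bls).
Proof.
move=> inf inf' h.
have /fun_choice[F hF] : forall i, exists f : nat -> nat, i < size sg ->
    let s := nth [::] als i in let t := nth [::] bls i in
    [/\ forall x, x < size s -> f x < size t,
    forall x y, x < size s -> y < size s -> (f x < f y) = (x < y) &
    forall x y, x < size s -> y < size s ->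
      (nth 0 t (f x) < nth 0 t (f y)) = (nth 0 s x < nth 0 s y)].
  move=> i; case: (ltnP i (size sg)) => [/h[f hf]|_]; first by exists f.
  by exists id.
exists (fun p => bpos bls (bidx als p) (F (bidx als p) (boff als p))).
have aux p : p < size (inflate sg als) -> [/\ bidx als p < size sg,
    boff als p < size (nth [::] als (bidx als p)) &
    F (bidx als p) (boff als p) < size (nth [::] bls (bidx als p))].
  move=> hp; have h1 := bidx_lt inf hp; have h2 := boff_lt inf hp; split=> //.
  by have [f1 _ _] := hF _ h1; apply: f1.
split.
- by move=> p /aux[_ _ h3]; apply: bpos_ltn.
- move=> p q hp hq; have [p1 p2 p3] := aux p hp; have [q1 q2 q3] := aux q hq.
  rewrite bpos_lt // -[in RHS](bposK als p) -[in RHS](bposK als q) bpos_lt //.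
  case: eqP => //= e; have [_ f2 _] := hF _ p1.
  by rewrite -e in q2 *; rewrite f2.
move=> p q hp hq; have [p1 p2 p3] := aux p hp; have [q1 q2 q3] := aux q hq.
rewrite (inflate_cmp inf') // (inflate_cmp_idx inf) //.
case: eqP => //= e; have [_ _ f3] := hF _ p1.
by rewrite -e in q2 *; rewrite f3.
Qed.

Inductive Wclosure (Sl : seq (seq nat)) : seq nat -> Prop :=
| W_one : Wclosure Sl [:: 1]
| W_inflate sg als : sg \in Sl -> inflatable sg als ->
    (forall a, a \in als -> Wclosure Sl a) -> Wclosure Sl (inflate sg als).

Definition incr (u : nat -> nat) : Prop := forall k, u k < u k.+1.

Lemma incr_lt u k l : incr u -> k < l -> u k < u l.
Proof.
move=> hu; elim: l => // l IH; rewrite ltnS leq_eqVlt => /orP[/eqP->|/IH h]; first exact: hu.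
exact: ltn_trans h (hu l).
Qed.

Lemma incr_le u k l : incr u -> k <= l -> u k <= u l.
Proof. by move=> hu; rewrite leq_eqVlt => /orP[/eqP->//|/(incr_lt hu)/ltnW]. Qed.

Lemma incr_comp u v : incr u -> incr v -> incr (u \o v).
Proof. by move=> hu hv k; apply: (incr_lt hu (hv k)). Qed.

Lemma subsequence (P : nat -> Prop) : (forall N, exists2 n, N <= n & P n) ->
  exists2 h, incr h & forall k, P (h k).
Proof.
move=> hP; have /fun_choice[f hf] : forall N, exists n, N <= n /\ P n.
  by move=> N; have [n h1 h2] := hP N; exists n.
exists (fun k => iter k (fun n => f n.+1) (f 0)).
  by move=> k /=; have [] := hf (iter k (fun n => f n.+1) (f 0)).+1.
by case=> [|k] /=; [have [] := hf 0 | have [] := hf (iter k (fun n => f n.+1) (f 0)).+1].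
Qed.

(** Only finitely many indices have no [R]-successor further on, since otherwise they would form a
    subsequence without any good pair. Past the last of them successors can be chained, and
    transitivity does the rest. *)
Lemma ascending (T : Type) (R : T -> T -> Prop) (c : nat -> T) :
  (forall x y z, R x y -> R y z -> R x z) ->
  (forall u, incr u -> exists k l, k < l /\ R (c (u k)) (c (u l))) ->
  forall v, incr v -> exists2 u, incr u & forall k l, k < l -> R (c (v (u k))) (c (v (u l))).
Proof.
move=> tr good v hv.
pose term k := forall l, k < l -> ~ R (c (v k)) (c (v l)).
have [N hN] : exists N, forall n, N <= n -> ~ term n.
  apply: NNPP => no; have [N|h hh th] := @subsequence term.
    apply: NNPP => no'; apply: no; exists N => n hn tn; apply: no'; by exists n.
  have [k [l [kl r]]] := good (v \o h) (incr_comp hv hh).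
  exact: th (incr_lt hh kl) r.
have /fun_choice[nx hnx] : forall k, exists l, N <= k -> k < l /\ R (c (v k)) (c (v l)).
  move=> k; have [hk|hk] := leqP N k; last by exists 0.
  have /not_all_ex_not[l hl] := hN k hk.
  by have [kl /NNPP r] := imply_to_and _ _ hl; exists l.
pose u k := iter k nx N.
have hu k : N <= u k.
  by elim: k => //= k IH; have [h _] := hnx _ IH; apply: leq_trans IH (ltnW h).
have iu : incr u by move=> k; have [] := hnx _ (hu k).
exists u => // k l; elim: l => // l IH; rewrite ltnS leq_eqVlt => /orP[/eqP->|/IH r].
  by have [] := hnx _ (hu l).
by apply: tr r _; have [] := hnx _ (hu l).
Qed.

Lemma infinite_pigeonhole (T : eqType) (l : seq T) (S : nat -> T) :
  (forall n, S n \in l) -> exists2 x, x \in l & forall N, exists2 n, N <= n & S n = x.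
Proof.
suff H M : (forall n, M <= n -> S n \in l) ->
    exists2 x, x \in l & forall N, exists2 n, N <= n & S n = x.
  by move=> h; apply: (H 0) => n _.
elim: l M => [|x l IH] M h; first by have := h M (leqnn M).
have [inf|/not_all_ex_not[N hN]] := classic (forall N, exists2 n, N <= n & S n = x).
  by exists x => //; apply: mem_head.
have [n hn|y yl hy] := IH (maxn M N); last by exists y => //; rewrite in_cons yl orbT.
have := h n; rewrite in_cons; case: eqP => [e|_]; last by apply; lia.
by case: hN; exists n => //; lia.
Qed.

Fixpoint greedy (T : Type) (nx : seq T -> T) n : seq T :=
  if n is n'.+1 then rcons (greedy nx n') (nx (greedy nx n')) else [::].

Lemma greedyE (T : Type) (nx : seq T -> T) n :
  greedy nx n = mkseq (fun k => nx (greedy nx k)) n.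
Proof. by elim: n => //= n {1}->; rewrite mkseqS. Qed.

Lemma min_size (P : seq nat -> Prop) : (exists x, P x) ->
  exists2 x, P x & forall y, P y -> size x <= size y.
Proof.
case=> x; have [n] := ubnP (size x); elim: n x => // n IH x hn px.
have [h|/not_all_ex_not[y hy]] := classic (forall y, P y -> size x <= size y).
  by exists x.
by have [py h] := imply_to_and _ _ hy; apply: (IH y) => //; move/negP: h; lia.
Qed.

Section WellQuasiOrder.
Variable Sl : seq (seq nat).
Hypothesis Sl1 : forall sg : seq nat, sg \in Sl -> 1 < size sg.

Definition bad (f : nat -> seq nat) : Prop :=
  (forall n, Wclosure Sl (f n)) /\ forall i j, i < j -> ~ emb (f i) (f j).

Definition bad_prefix (p : seq (seq nat)) : Prop :=
  exists2 f, bad f & mkseq f (size p) = p.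

Lemma W_vperm s : Wclosure Sl s -> vperm s.
Proof.
elim=> [|sg als hsg inf _ _] //; apply: inflate_vperm => //.
by apply: ltnW; apply: Sl1.
Qed.

(** Nash-Williams' construction: each term has least size among all continuations of the earlier
    terms to a bad sequence. Badness concerns two terms at a time, so it passes from the prefixes to
    the limit. *)
Lemma minimal_bad f : bad f -> exists2 g, bad g &
  forall n y, bad_prefix (rcons (mkseq g n) y) -> size (g n) <= size y.
Proof.
move=> bf.
have /fun_choice[nx hnx] : forall p, exists x, bad_prefix p ->
    bad_prefix (rcons p x) /\ forall y, bad_prefix (rcons p y) -> size x <= size y.
  move=> p; have [[g bg eg]|no] := classic (bad_prefix p); last by exists [::].
  have [|x hx hm] := @min_size (fun x => bad_prefix (rcons p x)); last by exists x.
  by exists (g (size p)); exists g; rewrite // size_rcons mkseqS eg.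
pose g k := nx (greedy nx k).
have bp n : bad_prefix (greedy nx n).
  by elim: n => [|n IH] /=; [exists f | have [] := hnx _ IH].
have gE n : greedy nx n = mkseq g n := greedyE nx n.
exists g; last by move=> n y; rewrite -gE => /(proj2 (hnx _ (bp n))).
split=> [n|i j ij].
  have [q [bq _] eq] := bp n.+1; have := congr1 (nth [::] ^~ n) eq.
  by rewrite gE size_mkseq /= !nth_mkseq // => <-.
have [q [_ bq] eq] := bp j.+1; have h k : k <= j -> q k = g k.
  move=> kj; have := congr1 (nth [::] ^~ k) eq.
  by rewrite gE size_mkseq /= !nth_mkseq.
by rewrite -!h //; [apply: bq | apply: ltnW].
Qed.

(** Infinitely many terms of a minimal bad sequence inflate the same [sg]. In each coordinate their
    arguments have no bad subsequence, so some subsequence ascends in all coordinates at once, and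
    [emb_inflate] gives a contradiction. *)
Theorem W_wqo f : (forall n, Wclosure Sl (f n)) -> exists i j, i < j /\ emb (f i) (f j).
Proof.
move=> Wf; apply: NNPP => no.
have [|g [Wg bg] gmin] := @minimal_bad f.
  by split=> // i j ij e; apply: no; exists i, j.
have /fun_choice[D hD] : forall n, exists d : seq nat * seq (seq nat), [/\ d.1 \in Sl,
    inflatable d.1 d.2, forall a, a \in d.2 -> Wclosure Sl a & g n = inflate d.1 d.2].
  move=> n; have := bg n n.+1 (ltnSn n); have /W_vperm/andP[h0 _] := Wg n.+1.
  case: (Wg n) => [|sg als h1 h2 h3 _]; first by case; apply: emb1.
  by exists (sg, als).
have [|sg hsg /subsequence[h ih hh]] := @infinite_pigeonhole _ Sl (fun n => (D n).1).
  by move=> n; have [] := hD n.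
pose c i k := nth [::] (D (h k)).2 i.
have hDh k : [/\ inflatable sg (D (h k)).2, forall a, a \in (D (h k)).2 -> Wclosure Sl a &
    g (h k) = inflate sg (D (h k)).2].
  by have := hD (h k); rewrite hh => -[].
have Wc i k : i < size sg -> Wclosure Sl (c i k).
  by move=> hi; have [inf hW _] := hDh k; apply: hW; rewrite mem_nth // (infl_size inf).
have cg i k : i < size sg -> emb (c i k) (g (h k)).
  by move=> hi; have [inf _ ->] := hDh k; apply: emb_al.
have good i : i < size sg -> forall u, incr u ->
    exists k l, k < l /\ emb (c i (u k)) (c i (u l)).
  move=> hi u iu; apply: NNPP => nogood; pose N := h (u 0).
  (* A bad sequence of arguments, put behind the first [N] terms of [g], stays bad, since a term
     embedding in an argument embeds in the inflation. It is smaller than [g] at [N]. *)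
  pose q n := if n < N then g n else c i (u (n - N)).
  suff /gmin : bad_prefix (rcons (mkseq g N) (c i (u 0))).
    have [inf _ ->] := hDh (u 0); rewrite leqNgt /c => /negP; apply.
    by apply: size_al_lt => //; apply: Sl1.
  exists q; last first.
    rewrite size_rcons size_mkseq mkseqS {2}/q ltnn subnn; congr rcons.
    by apply/eq_in_map => n; rewrite mem_iota /q => /= ->.
  split=> [n|a b ab]; first by rewrite /q; case: ifP => // _; apply: Wc.
  rewrite /q; case: (ltnP a N) => ha; case: (ltnP b N) => hb; try lia.
  - exact: bg.
  - move=> e; apply: (bg a (h (u (b - N)))); last by apply: emb_trans e (cg _ _ hi).
    by apply: leq_trans ha _; apply/(incr_le ih)/(incr_le iu).
  by move=> e; apply: nogood; exists (a - N), (b - N); split=> //; lia.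
have [u iu hu] : exists2 u, incr u & forall i, i < size sg -> forall k l, k < l ->
    emb (c i (u k)) (c i (u l)).
  suff H m : m <= size sg -> exists2 u, incr u & forall i, i < m -> forall k l, k < l ->
      emb (c i (u k)) (c i (u l)) by apply: H.
  elim: m => [|m IH] hm; first by exists id.
  have [u iu hu] := IH (ltnW hm).
  have [v iv hv] := ascending emb_trans (good m hm) iu.
  exists (u \o v); first exact: incr_comp.
  move=> i; rewrite ltnS leq_eqVlt => /orP[/eqP->|hi] k l kl; first exact: hv.
  by apply: hu => //; apply: incr_lt.
apply: (bg (h (u 0)) (h (u 1))); first by apply/(incr_lt ih)/iu.
have [inf _ ->] := hDh (u 0); have [inf' _ ->] := hDh (u 1).
by apply: emb_inflate => // i hi; apply: hu.
Qed.

(** Otherwise elements of the closure outside [C] could be chosen one after the other, none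
    containing an earlier one, against [W_wqo]. *)
Theorem finite_basis (C : seq nat -> Prop) : exists B : seq (seq nat),
  (forall b, b \in B -> Wclosure Sl b /\ ~ C b) /\
  (forall s, Wclosure Sl s -> ~ C s -> exists2 b, b \in B & emb b s).
Proof.
apply: NNPP => no.
pose ok (p : seq (seq nat)) := forall b, b \in p -> Wclosure Sl b /\ ~ C b.
have /fun_choice[nx hnx] : forall p, exists x, ok p ->
    [/\ Wclosure Sl x, ~ C x & forall b, b \in p -> ~ emb b x].
  move=> p; apply: NNPP => nx; apply: no; exists p; split.
    by apply: NNPP => nok; apply: nx; exists [::].
  move=> s Ws nC; apply: NNPP => ne; apply: nx; exists s => _; split=> // b bp e.
  by apply: ne; exists b.
pose g k := nx (greedy nx k).
have gE n : greedy nx n = mkseq g n := greedyE nx n.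
have hok n : ok (greedy nx n).
  elim: n => [|n IH] b //=; rewrite mem_rcons in_cons => /orP[/eqP->|/IH//].
  by have [] := hnx _ IH.
have [|i [j [ij e]]] := @W_wqo g; first by move=> n; have [] := hnx _ (hok n).
have [_ _ /(_ (g i))] := hnx _ (hok j); apply=> //.
by rewrite gE; apply/mapP; exists i; rewrite // mem_iota.
Qed.

End WellQuasiOrder.

(** * Ehrenfeucht-Fraisse equivalence of permutations *)

Definition atom (s t : seq nat) (p q : nat * nat) : Prop :=
  [/\ (p.1 < q.1) = (p.2 < q.2), (nth 0 s p.1 < nth 0 s q.1) = (nth 0 t p.2 < nth 0 t q.2) &
      odd (nth 0 s p.1) = odd (nth 0 t p.2)].

(* Duplicator wins the [k]-round Ehrenfeucht-Fraisse game on [s] and [t], viewed as structures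
   with the orders of positions and of values and a predicate for even values, from the
   position in which the pairs [zs] have been played. *)
Fixpoint eqv (k : nat) (s t : seq nat) (zs : seq (nat * nat)) : Prop :=
  if k is k'.+1 then
    [/\ eqv k' s t zs,
        forall x, x < size s -> exists2 y, y < size t & eqv k' s t ((x, y) :: zs) &
        forall y, y < size t -> exists2 x, x < size s & eqv k' s t ((x, y) :: zs)]
  else forall p q, p \in zs -> q \in zs -> atom s t p q.

Lemma eqv_refl k s zs : (forall p, p \in zs -> p.1 = p.2) -> eqv k s s zs.
Proof.
elim: k zs => [|k IH] zs h /=; first by move=> p q /h e /h e'; rewrite /atom e e'.
split; first exact: IH.
all: by move=> x hx; exists x => //; apply: IH => p; rewrite in_cons => /orP[/eqP->|/h].
Qed.

Lemma eqv_sym k s t zs zs' : eqv k s t zs ->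
  (forall p, p \in zs' -> (p.2, p.1) \in zs) -> eqv k t s zs'.
Proof.
elim: k zs zs' => [|k IH] zs zs' h hz /=.
  by move=> p q /hz hp /hz hq; have [] := h _ _ hp hq.
have [h0 h1 h2] := h; split; first exact: IH h0 hz.
- move=> x /h2[y hy e]; exists y => //; apply: IH e _ => p.
  by rewrite !in_cons => /orP[/eqP->|/hz->]; rewrite ?eqxx ?orbT.
- move=> x /h1[y hy e]; exists y => //; apply: IH e _ => p.
  by rewrite !in_cons => /orP[/eqP->|/hz->]; rewrite ?eqxx ?orbT.
Qed.

Lemma eqv_trans k s t u zs1 zs2 zs : eqv k s t zs1 -> eqv k t u zs2 ->
  (forall p, p \in zs -> exists y, ((p.1, y) \in zs1) && ((y, p.2) \in zs2)) ->
  eqv k s u zs.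
Proof.
elim: k zs1 zs2 zs => [|k IH] z1 z2 zs h h' hz /=.
  move=> p q /hz[y /andP[p1 p2]] /hz[y' /andP[q1 q2]].
  have [/= a1 a2 a3] := h _ _ p1 q1; have [/= b1 b2 b3] := h' _ _ p2 q2.
  by split; rewrite ?a1 ?a2 ?a3.
have [h0 h1 h2] := h; have [h0' h1' h2'] := h'.
have ext x y z p : p \in (x, z) :: zs ->
    exists w, ((p.1, w) \in (x, y) :: z1) && ((w, p.2) \in (y, z) :: z2).
  rewrite in_cons => /orP[/eqP->|/hz[w /andP[w1 w2]]]; first by exists y; rewrite !mem_head.
  by exists w; rewrite !in_cons w1 w2 !orbT.
split; first exact: IH h0 h0' hz.
- move=> x /h1[y /h1'[z hz' e'] e]; exists z => //; apply: IH e e' _; exact: ext.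
- move=> z /h2'[y /h2[x hx e] e']; exists x => //; apply: IH e e' _; exact: ext.
Qed.

Lemma eqv_le k l s t zs : k <= l -> eqv l s t zs -> eqv k s t zs.
Proof.
elim: l => [|l IH]; first by rewrite leqn0 => /eqP->.
by rewrite leq_eqVlt => /orP[/eqP->//|h] /= [h0 _ _]; apply: IH.
Qed.

Lemma eqv_mem k s t zs zs' : eqv k s t zs -> {subset zs' <= zs} -> eqv k s t zs'.
Proof.
elim: k zs zs' => [|k IH] zs zs' h hz /=; first by move=> p q /hz hp /hz hq; apply: h.
have sub p : {subset p :: zs' <= p :: zs}.
  by move=> q; rewrite !in_cons => /orP[->//|/hz->]; rewrite orbT.
have [h0 h1 h2] := h; split; first exact: IH h0 hz.
- by move=> x /h1[y hy e]; exists y => //; apply: IH e _.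
- by move=> x /h2[y hy e]; exists y => //; apply: IH e _.
Qed.

Lemma eqv_atom k s t zs p q : eqv k s t zs -> p \in zs -> q \in zs -> atom s t p q.
Proof. by move=> /(eqv_le (leq0n k)) h; apply: h. Qed.

Lemma odd_sum (I : Type) (r : seq I) (P : pred I) (f g : I -> nat) :
  (forall i, P i -> odd (f i) = odd (g i)) ->
  odd (\sum_(i <- r | P i) f i) = odd (\sum_(i <- r | P i) g i).
Proof.
move=> h; elim/big_ind2: _ => // a b c d ab cd.
by rewrite !oddD ab cd.
Qed.

Section EqvInflate.
Variables (sg : seq nat) (als bls : seq (seq nat)).
Hypotheses (inf : inflatable sg als) (inf' : inflatable sg bls).
Hypothesis sz_odd : forall i, i < size sg ->
  odd (size (nth [::] als i)) = odd (size (nth [::] bls i)).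

Lemma odd_voff i : odd (voff sg als i) = odd (voff sg bls i).
Proof. by apply: odd_sum => j _; apply: sz_odd. Qed.

(** Duplicator answers in the block with the same index, by the strategy for that block; [Z i] is
    the position of the game on block [i]. The parity of a value is that of the shift plus that
    inside the block, hence [sz_odd]. *)
Lemma eqv_inflate k (Z : nat -> seq (nat * nat)) zs :
  (forall i, i < size sg -> eqv k (nth [::] als i) (nth [::] bls i) (Z i)) ->
  (forall i q, i < size sg -> q \in Z i ->
     q.1 < size (nth [::] als i) /\ q.2 < size (nth [::] bls i)) ->
  (forall p, p \in zs -> exists i q, [/\ i < size sg, q \in Z i &
     p = (bpos als i q.1, bpos bls i q.2)]) ->
  eqv k (inflate sg als) (inflate sg bls) zs.
Proof.
elim: k Z zs => [|k IH] Z zs hZ bZ hz /=.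
  move=> _ _ /hz[i [p [hi pZ ->]]] /hz[j [q [hj qZ ->]]]; rewrite /atom /=.
  have [p1 p2] := bZ _ _ hi pZ; have [q1 q2] := bZ _ _ hj qZ.
  rewrite !bpos_lt // (inflate_cmp inf) // (inflate_cmp inf') //.
  rewrite (nth_inflate inf) // (nth_inflate inf') // !oddD odd_voff.
  have [_ _ ->] := hZ _ hi _ _ pZ pZ; split=> //.
    have [e|//] := eqVneq i j; subst j.
    by have [-> _ _] := hZ _ hi _ _ pZ qZ.
  have [e|//] := eqVneq i j; subst j.
  by have [_ -> _] := hZ _ hi _ _ pZ qZ.
have ext i x y : i < size sg -> x < size (nth [::] als i) -> y < size (nth [::] bls i) ->
    eqv k (nth [::] als i) (nth [::] bls i) ((x, y) :: Z i) ->
    eqv k (inflate sg als) (inflate sg bls) ((bpos als i x, bpos bls i y) :: zs).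
  move=> hi hx hy e.
  apply: (IH (fun j => if j == i then (x, y) :: Z i else Z j)).
  - move=> j hj; case: eqP => [-> //|_]; exact: eqv_le (hZ j hj).
  - move=> j q hj; case: eqP => [->|_]; last exact: bZ.
    by rewrite in_cons => /orP[/eqP->//|]; apply: bZ.
  move=> p; rewrite in_cons => /orP[/eqP->|/hz[j [q [hj qZ ->]]]].
    by exists i, (x, y); rewrite eqxx mem_head.
  exists j, q; split=> //; case: eqP => [e'|//]; subst j.
  by rewrite in_cons qZ orbT.
split.
- apply: (IH Z) => // i hi; exact: eqv_le (hZ i hi).
- move=> p hp; have hi := bidx_lt inf hp; have hx := boff_lt inf hp.
  have [_ h _] := hZ _ hi; have [y hy e] := h _ hx.
  exists (bpos bls (bidx als p) y); first exact: bpos_ltn.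
  by rewrite -{1}(bposK als p); apply: ext.
- move=> p hp; have hi := bidx_lt inf' hp; have hy := boff_lt inf' hp.
  have [_ _ h] := hZ _ hi; have [x hx e] := h _ hy.
  exists (bpos als (bidx bls p) x); first exact: bpos_ltn.
  by rewrite -{2}(bposK bls p); apply: ext.
Qed.

Lemma eqv_inflate_nil k :
  (forall i, i < size sg -> eqv k (nth [::] als i) (nth [::] bls i) [::]) ->
  eqv k (inflate sg als) (inflate sg bls) [::].
Proof. by move=> h; apply: (eqv_inflate (Z := fun=> [::])). Qed.

End EqvInflate.

(** Hintikka types: the invariant for [k.+1] rounds consists of the one for [k] rounds and of the
    set of those of all extensions by one more position. *)
Lemma eqv_finite_index k r : exists (F : finType) (c : seq nat -> seq nat -> F),
  forall s xs t ys, size xs = r -> size ys = r -> c s xs = c t ys -> eqv k s t (zip xs ys).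
Proof.
elim: k r => [|k IH] r.
  exists ({ffun 'I_r * 'I_r -> bool * bool} * {ffun 'I_r -> bool})%type.
  exists (fun s xs => ([ffun ij : 'I_r * 'I_r => (nth 0 xs ij.1 < nth 0 xs ij.2,
      nth 0 s (nth 0 xs ij.1) < nth 0 s (nth 0 xs ij.2))],
    [ffun i : 'I_r => odd (nth 0 s (nth 0 xs i))])).
  move=> s xs t ys hx hy [] /ffunP e1 /ffunP e2 p q.
  move=> /(nthP (0, 0))[i]; rewrite size_zip hx hy minnn => hi <-.
  move=> /(nthP (0, 0))[j]; rewrite size_zip hx hy minnn => hj <-.
  rewrite !nth_zip ?hx //; have := e1 (Ordinal hi, Ordinal hj); rewrite !ffunE /= => -[E1 E2].
  by have := e2 (Ordinal hi); rewrite !ffunE /= => E3; split.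
have [F [c hc]] := IH r; have [F' [c' hc']] := IH r.+1.
exists (F * {set F'})%type, (fun s xs => (c s xs, [set c' s (val x :: xs) | x : 'I_(size s)])).
move=> s xs t ys hx hy [] /hc e0 /setP e1; split; first exact: e0.
- move=> x hxs; have := e1 (c' s (x :: xs)).
  have -> : c' s (x :: xs) \in [set c' s (val x :: xs) | x : 'I_(size s)].
    by apply/imsetP; exists (Ordinal hxs).
  move=> /esym/imsetP[[y hyt] _ /=] E; exists y => //.
  by have := hc' s (x :: xs) t (y :: ys); rewrite /= hx hy; apply.
- move=> y hyt; have := e1 (c' t (y :: ys)).
  have -> : c' t (y :: ys) \in [set c' t (val x :: ys) | x : 'I_(size t)].
    by apply/imsetP; exists (Ordinal hyt).
  move=> /imsetP[[x hxs] _ /=] E; exists x => //.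
  by have := hc' s (x :: xs) t (y :: ys); rewrite /= hx hy; apply.
Qed.

(** * Inversions of inflations and the finite set of states *)

Lemma sum_blocks (sh : seq nat) (g : nat -> nat) :
  \sum_(0 <= p < sumn sh) g p =
  \sum_(0 <= i < size sh) \sum_(0 <= x < nth 0 sh i) g (sumn (take i sh) + x).
Proof.
elim: sh g => [|a sh IH] g; first by rewrite !big_nil.
rewrite /= big_nat_recl //= (big_cat_nat (n := a)) ?leq_addr //=.
congr (_ + _); rewrite -[X in \sum_(X <= _ < _) _]add0n big_addn addKn IH.
by apply: eq_bigr => i _; apply: eq_bigr => x _; congr g; lia.
Qed.

Lemma inversionsE s : inversions s =
  \sum_(0 <= p < size s) \sum_(0 <= q < size s) ((p < q) && (nth 0 s q < nth 0 s p)).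
Proof. by rewrite big_mkord; apply: eq_bigr => i _; rewrite big_mkord. Qed.

(** Blocks contribute their own inversions, and each inverted pair of blocks the product of its
    lengths. Modulo 2, only parities of the arguments matter. *)
Lemma inversions_inflate sg als : inflatable sg als ->
  inversions (inflate sg als) =
  \sum_(i < size sg) inversions (nth [::] als i) +
  \sum_(i < size sg) \sum_(j < size sg)
    ((i < j) && (nth 0 sg j < nth 0 sg i)) * (size (nth [::] als i) * size (nth [::] als j)).
Proof.
move=> inf; rewrite inversionsE (size_inflate inf) sum_blocks -big_split /=.
rewrite size_map (infl_size inf) big_mkord; apply: eq_bigr => i _.
have -> : \sum_(j < size sg) ((i < j) && (nth 0 sg j < nth 0 sg i)) *
      (size (nth [::] als i) * size (nth [::] als j)) =
    \sum_(0 <= x < size (nth [::] als i)) \sum_(j < size sg)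
      ((i < j) && (nth 0 sg j < nth 0 sg i)) * size (nth [::] als j).
  rewrite sum_nat_const_nat subn0 big_distrr /=; apply: eq_bigr => j _; lia.
rewrite inversionsE nth_shape -big_split /= !big_mkord; apply: eq_bigr => x _.
rewrite sum_blocks size_map (infl_size inf) [LHS]big_mkord.
have -> : \sum_(0 <= q < size (nth [::] als i))
    ((x < q) && (nth 0 (nth [::] als i) q < nth 0 (nth [::] als i) x)) =
   \sum_(j < size sg) (i == j) * \sum_(0 <= q < size (nth [::] als i))
    ((x < q) && (nth 0 (nth [::] als i) q < nth 0 (nth [::] als i) x)).
  rewrite [RHS](bigD1 i) //= eqxx mul1n [X in _ + X]big1 ?addn0 // => j ne.
  by rewrite eq_sym (negbTE ne).
rewrite -big_split; apply: eq_bigr => j _ /=.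
have -> : ((i < j) && (nth 0 sg j < nth 0 sg i)) * size (nth [::] als j) =
   \sum_(0 <= y < size (nth [::] als j)) ((i < j) && (nth 0 sg j < nth 0 sg i)).
  by rewrite sum_nat_const_nat subn0 mulnC.
rewrite nth_shape; have [e|ne] := eqVneq i j.
  subst j; rewrite mul1n -big_split /= !big_mkord; apply: eq_bigr => y _.
  have := @bpos_lt als i i x y (ltn_ord x) (ltn_ord y).
  have := inflate_cmp inf (ltn_ord y) (ltn_ord x).
  by rewrite /bpos /flatten_index => -> ->; rewrite eqxx ltnn /= addn0.
rewrite mul0n add0n !big_mkord; apply: eq_bigr => y _.
have := @bpos_lt als i j x y (ltn_ord x) (ltn_ord y).
have := inflate_cmp inf (ltn_ord y) (ltn_ord x).
rewrite /bpos /flatten_index => -> ->.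
have /negbTE E : (i : nat) != j by [].
by rewrite E [_ == val i]eq_sym E orbF.
Qed.

(** The parity of the length makes the relation a congruence: the parities of the values and of the
    inversions of an inflation both depend on it. *)
Definition same_type K (s t : seq nat) : Prop :=
  [/\ eqv K s t [::], odd (size s) = odd (size t) &
      odd (inversions s) = odd (inversions t)].

(* The inverse is included because the arguments of an involution on a 2-cycle are inverse to
   each other. *)
Definition same_state K (s t : seq nat) : Prop := same_type K s t /\ same_type K (inv s) (inv t).

Lemma same_type_inflate K sg als bls : inflatable sg als -> inflatable sg bls ->
  (forall i, i < size sg -> same_type K (nth [::] als i) (nth [::] bls i)) ->
  same_type K (inflate sg als) (inflate sg bls).
Proof.
move=> inf inf' h; split.
- by apply: eqv_inflate_nil => // i /h[].
- rewrite (size_inflate inf) (size_inflate inf') !sumnE !big_map.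
  rewrite !(big_nth [::]) !big_mkord (infl_size inf) (infl_size inf').
  by apply: odd_sum => i _; have [] := h i (ltn_ord i).
rewrite !inversions_inflate // !oddD; congr addb.
  by apply: odd_sum => i _; have [] := h i (ltn_ord i).
apply: odd_sum => i _; apply: odd_sum => j _; rewrite !oddM.
by have [_ -> _] := h i (ltn_ord i); have [_ -> _] := h j (ltn_ord j).
Qed.

Lemma same_state_inflate K sg als bls : inflatable sg als -> inflatable sg bls ->
  (forall i, i < size sg -> same_state K (nth [::] als i) (nth [::] bls i)) ->
  same_state K (inflate sg als) (inflate sg bls).
Proof.
move=> inf inf' h; split; first by apply: same_type_inflate => // i /h[].
rewrite !inv_inflate //; apply: same_type_inflate; try exact: inv_inflatable.
move=> j; rewrite size_inv => hj; have [i hi <-] := pv_onto (infl_sg inf) hj.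
by have hsg := infl_sg inf; rewrite !nth_inv_args //; have [] := h i hi.
Qed.

Lemma same_state_inv K s t : is_perm s -> is_perm t -> same_state K s t -> same_state K (inv s) (inv t).
Proof. by move=> hs ht [h1 h2]; rewrite /same_state !invK //; split. Qed.

Lemma same_type_refl K s : same_type K s s.
Proof. by split=> //; apply: eqv_refl. Qed.

Lemma same_type_sym K s t : same_type K s t -> same_type K t s.
Proof. by case=> h1 h2 h3; split=> //; apply: eqv_sym h1 _. Qed.

Lemma same_type_trans K s t u : same_type K s t -> same_type K t u -> same_type K s u.
Proof.
by case=> h1 h2 h3 [h1' h2' h3']; split; rewrite ?h2 ?h3 //; apply: eqv_trans h1 h1' _.
Qed.

Definition pbool (P : Prop) : bool := if excluded_middle_informative P then true else false.

Lemma pboolP (P : Prop) : reflect P (pbool P).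
Proof. by rewrite /pbool; case: excluded_middle_informative => h; constructor. Qed.

(** The invariant [c] may be finer than [E], whereas it is [E] that will be a congruence for
    inflation. The class of [x] is therefore coded by the set of all [c]-values that occur in it. *)
Lemma exact_classes (T : Type) (F : finType) (c : T -> F) (E : T -> T -> Prop) :
  (forall x, E x x) -> (forall x y, E x y -> E y x) ->
  (forall x y z, E x y -> E y z -> E x z) -> (forall x y, c x = c y -> E x y) ->
  exists (Q : finType) (tau : T -> Q), forall x y, tau x = tau y <-> E x y.
Proof.
move=> rf sy tr hc.
exists {set F}, (fun x => [set f | pbool (exists2 y, c y = f & E x y)]) => x y.
split=> [/setP/(_ (c x))|e].
  rewrite !inE; have -> : pbool (exists2 y, c y = c x & E x y) by apply/pboolP; exists x.
  by move=> /esym/pboolP[z /hc ez ey]; apply: (tr _ z); [apply: sy | apply: sy].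
apply/setP => f; rewrite !inE; apply/pboolP/pboolP => -[z ez hz]; exists z => //.
  by apply: tr hz; apply: sy.
exact: tr hz.
Qed.

Theorem finite_state K : exists (Q : finType) (tau : seq nat -> Q),
  forall s t, tau s = tau t <-> same_state K s t.
Proof.
have [F [c hc]] := eqv_finite_index K 0.
pose c1 s := (c s [::], odd (size s), odd (inversions s)).
apply: (@exact_classes _ _ (fun s => (c1 s, c1 (inv s)))).
- by move=> s; split; apply: same_type_refl.
- by move=> s t [h1 h2]; split; apply: same_type_sym.
- by move=> s t u [h1 h2] [h1' h2']; split; [apply: same_type_trans h1' | apply: same_type_trans h2'].
by move=> s t [] e1 e2 e3 e4 e5 e6; split; split=> //; apply: (hc _ [::] _ [::]).
Qed.

(** * Properties decided by the equivalence *)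

Lemma eqvL k s t zs x : eqv k.+1 s t zs -> x < size s ->
  exists2 y, y < size t & eqv k s t ((x, y) :: zs).
Proof. by case=> _ h _ /h. Qed.

Lemma eqvR k s t zs y : eqv k.+1 s t zs -> y < size t ->
  exists2 x, x < size s & eqv k s t ((x, y) :: zs).
Proof. by case=> _ _ h /h. Qed.

(** The spare round is for [y.+1]: if it lay strictly between [y] and [y'], the answer would lie
    strictly between [x] and [x.+1]. *)
Lemma eqv_adj s t zs x y x' y' : eqv 1 s t zs -> (x, y) \in zs -> (x', y') \in zs ->
  y' < size t -> x' = x.+1 -> y' = y.+1.
Proof.
move=> h z1 z2 hy' ex; have [h0 _ h2] := h.
have [/= a1 _ _] := h0 _ _ z1 z2.
case: (ltngtP y' y.+1) => // hy; first by exfalso; lia.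
have hw : y.+1 < size t by lia.
have [u hu e] := h2 _ hw.
have z0 : (u, y.+1) \in (u, y.+1) :: zs by rewrite mem_head.
have z1' : (x, y) \in (u, y.+1) :: zs by rewrite in_cons z1 orbT.
have z2' : (x', y') \in (u, y.+1) :: zs by rewrite in_cons z2 orbT.
have [/= b1 _ _] := e _ _ z1' z0; have [/= b2 _ _] := e _ _ z0 z2'; lia.
Qed.

Lemma eqv_last s t zs x y : eqv 1 s t zs -> (x, y) \in zs -> y < size t ->
  x.+1 = size s -> y.+1 = size t.
Proof.
move=> h z1 hy ex; have [_ _ h2] := h.
case: (ltngtP y.+1 (size t)) => // hw; last by lia.
have [u hu e] := h2 _ hw.
have z0 : (u, y.+1) \in (u, y.+1) :: zs by rewrite mem_head.
have z1' : (x, y) \in (u, y.+1) :: zs by rewrite in_cons z1 orbT.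
have [/= b1 _ _] := e _ _ z1' z0; lia.
Qed.

Lemma eqv_flip k s t zs : eqv k s t zs -> eqv k t s [seq (p.2, p.1) | p <- zs].
Proof.
move=> h; apply: eqv_sym h _ => p /mapP[[x y] q ->] //.
Qed.

(** Three rounds pick the three positions, and the fourth certifies that they are consecutive. *)
Lemma eqv_alternating s t : eqv 4 s t [::] -> alternating s -> alternating t.
Proof.
move=> h alt i i0 hi.
have [|x1 hx1 h3] := eqvR (y := i.-1) h; first by lia.
have [|x2 hx2 h2] := eqvR (y := i) h3; first by lia.
have [x3 hx3 h1] := eqvR h2 hi.
have f := eqv_flip h1; rewrite [map _ _]/= in f.
have e2 : x2 = x1.+1.
  by apply: (eqv_adj f (y' := x2) (x := i.-1) (x' := i)); rewrite ?in_cons ?eqxx ?orbT //; lia.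
have e3 : x3 = x2.+1.
  by apply: (eqv_adj f (y' := x3) (x := i) (x' := i.+1)); rewrite ?in_cons ?eqxx ?orbT //; lia.
have := alt x2; have <- : x1 = x2.-1 by lia.
rewrite -e3 => A.
have m1 : (x1, i.-1) \in [:: (x3, i.+1); (x2, i); (x1, i.-1)] by rewrite !in_cons eqxx !orbT.
have m2 : (x2, i) \in [:: (x3, i.+1); (x2, i); (x1, i.-1)] by rewrite !in_cons eqxx !orbT.
have m3 : (x3, i.+1) \in [:: (x3, i.+1); (x2, i); (x1, i.-1)] by rewrite mem_head.
have [_ /= a12 _] := eqv_atom h1 m1 m2; have [_ /= a21 _] := eqv_atom h1 m2 m1.
have [_ /= a23 _] := eqv_atom h1 m2 m3; have [_ /= a32 _] := eqv_atom h1 m3 m2.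
rewrite -a12 -a21 -a23 -a32; apply: A => //; lia.
Qed.

Lemma eqv_dumont s t : eqv 3 s t [::] -> dumont1 s -> dumont1 t.
Proof.
move=> h dum i hi.
have [x hx h2] := eqvR h hi.
have m : (x, i) \in [:: (x, i)] by rewrite mem_head.
have [_ _ /= eo] := eqv_atom h2 m m.
have [D1 D2] := dum x hx.
have step : x.+1 < size s -> [/\ i.+1 < size t,
    (nth 0 s x < nth 0 s x.+1) = (nth 0 t i < nth 0 t i.+1) &
    (nth 0 s x.+1 < nth 0 s x) = (nth 0 t i.+1 < nth 0 t i)].
  move=> hx1; have [y hy h1] := eqvL h2 hx1.
  have m1 : (x.+1, y) \in [:: (x.+1, y); (x, i)] by rewrite mem_head.
  have m2 : (x, i) \in [:: (x.+1, y); (x, i)] by rewrite !in_cons eqxx !orbT.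
  have e : y = i.+1 by apply: (eqv_adj h1 m2 m1).
  by have [_ a _] := eqv_atom h1 m1 m2; have [_ b _] := eqv_atom h1 m2 m1; rewrite -e.
split; rewrite -eo.
  by move=> /D1[hx1 lt]; have [h1 _ <-] := step hx1.
move=> o; have [hx1|] := ltnP x.+1 (size s).
  have [h1 <- _] := step hx1; right; case: (D2 o) => // e; lia.
move=> ge; left; apply: (eqv_last (eqv_le (isT : 1 <= 2) h2) m) => //; lia.
Qed.

(** One round is for the cut and two are for an entry on either side. This makes canonicity of the
    first argument a condition on its state. *)
Lemma eqv_dec d s t : eqv 3 s t [::] -> dec d s -> dec d t.
Proof.
move=> h /decP[a /cutP[ha hc]].
have [|y hy h2] := eqvL (x := a) h; first by lia.
apply/decP; exists y; apply/cutP; split.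
  have [|w hw h0] := eqvL (x := 0) (eqv_le (isT : 1 <= 2) h2); first by lia.
  have := h0 (0, w) (a, y); rewrite !in_cons !eqxx !orbT => /(_ isT isT)[/= a1 _ _]; lia.
move=> u v hu hv.
have [|u' hu' h1] := eqvR (y := u) h2; first by lia.
have [|v' hv' h0] := eqvR (y := v) h1; first by lia.
have := h0 (u', u) (a, y); have := h0 (v', v) (a, y); have := h0 (u', u) (v', v).
have := h0 (v', v) (u', u).
rewrite !in_cons !eqxx !orbT => /(_ isT isT)[/= _ b2 _] /(_ isT isT)[/= _ b1 _].
move=> /(_ isT isT)[/= a1 _ _] /(_ isT isT)[/= a2 _ _].
rewrite /cmp -b1 -b2; apply: hc; lia.
Qed.

Lemma eqv_movesR r k s t zs J : eqv (r + k) s t zs -> size J = r ->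
  all (fun i => i < size t) J ->
  exists I, [/\ size I = r, all (fun i => i < size s) I & eqv k s t (zip I J ++ zs)].
Proof.
elim: J r zs => [|j J IH] r zs h er; subst r; first by exists [::].
move=> /andP[hj hJ]; have [x hx e] := eqvR h hj.
have [I [e1 e2 e3]] := IH (size J) _ e erefl hJ.
exists (x :: I); rewrite /= e1 hx; split=> //; apply: eqv_mem e3 _ => p.
by rewrite in_cons !mem_cat in_cons orbCA.
Qed.

Lemma eqv_movesL r k s t zs I : eqv (r + k) s t zs -> size I = r ->
  all (fun i => i < size s) I ->
  exists J, [/\ size J = r, all (fun i => i < size t) J & eqv k s t (zip I J ++ zs)].
Proof.
elim: I r zs => [|x I IH] r zs h er; subst r; first by exists [::].
move=> /andP[hx hI]; have [y hy e] := eqvL h hx.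
have [J [e1 e2 e3]] := IH (size I) _ e erefl hI.
exists (y :: J); rewrite /= e1 hy; split=> //; apply: eqv_mem e3 _ => p.
by rewrite in_cons !mem_cat in_cons orbCA.
Qed.

Lemma mem_zip_nth (I J : seq nat) i : size I = size J -> i < size I ->
  (nth 0 I i, nth 0 J i) \in zip I J.
Proof. by move=> e hi; rewrite -nth_zip // mem_nth // size_zip -e minnn. Qed.

Lemma eqv_zip k s t I J zs : eqv k s t (zip I J ++ zs) -> size I = size J ->
  sorted ltn I = sorted ltn J /\ order_iso (occ s I) (occ t J).
Proof.
move=> h e.
have A i j : i < size I -> j < size I ->
    atom s t (nth 0 I i, nth 0 J i) (nth 0 I j, nth 0 J j).
  by move=> hi hj; apply: (eqv_atom h); rewrite mem_cat mem_zip_nth.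
split.
  apply/(sortedP 0)/(sortedP 0) => H i hi.
    have hi' : i.+1 < size I by rewrite e.
    by have [/= <- _ _] := A _ _ (ltnW hi') hi'; apply: H.
  by have [/= -> _ _] := A _ _ (ltnW hi) hi; apply: H; rewrite -e.
split=> [|i j]; rewrite !size_map // => hi hj.
by have [_ /= a _] := A _ _ hi hj; rewrite /occ !(nth_map 0) -?e.
Qed.

Lemma eqv_contains k b s t : size b <= k -> eqv k s t [::] -> contains s b -> contains t b.
Proof.
move=> hk h [I [[sI aI] oI]].
have szI : size I = size b by have [] := oI; rewrite size_map.
have [|J [e1 e2 e3]] := @eqv_movesL (size b) 0 s t [::] I _ szI aI.
  by rewrite addn0; apply: eqv_le hk h.
have [e4 e5] := eqv_zip e3 (etrans szI (esym e1)).
exists J; split; first by split; rewrite // -e4.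
exact: order_iso_trans (order_iso_sym e5) oI.
Qed.

Lemma eqv_blocked k tau dashes s t : size tau < k -> eqv k s t [::] ->
  ~ occurs_blocked s tau dashes -> ~ occurs_blocked t tau dashes.
Proof.
move=> hk h no [J [[sJ aJ] [oJ adj]]]; apply: no.
have szJ : size J = size tau by have [] := oJ; rewrite size_map.
have [|I [e1 e2 e3]] := @eqv_movesR (size tau) 1 s t [::] J _ szJ aJ.
  by apply: eqv_le h; rewrite addn1.
rewrite cats0 in e3; have eIJ := etrans e1 (esym szJ).
have [|e4 e5] := @eqv_zip 1 s t I J [::] _ eIJ; first by rewrite cats0.
exists I; split; first by split; rewrite // e4.
split; first exact: order_iso_trans e5 oJ.
move=> i hi nd; have f := eqv_flip e3.
apply: (eqv_adj f (x := nth 0 J i) (x' := nth 0 J i.+1)).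
- by apply/mapP; exists (nth 0 I i, nth 0 J i); rewrite // mem_zip_nth // e1 ltnW.
- by apply/mapP; exists (nth 0 I i.+1, nth 0 J i.+1); rewrite // mem_zip_nth // e1.
- by apply: (allP e2); rewrite mem_nth // e1.
exact: adj.
Qed.

Lemma zip_mask (T : Type) m (s t : seq T) : size s = size t ->
  zip (mask m s) (mask m t) = mask m (zip s t).
Proof.
elim: m s t => [|b m IH] [|x s] [|y t] //= [e].
by case: b; rewrite /= IH.
Qed.

Lemma size_mask_eq (T : Type) m (s t : seq T) : size s = size t ->
  size (mask m s) = size (mask m t).
Proof.
elim: m s t => [|b m IH] [|x s] [|y t] //= [e].
by case: b; rewrite /= (IH _ _ e).
Qed.

(** At most [size tau] rounds transfer the occurrence of the unbarred part from [t] to [s], and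
    [size tau] further ones transfer its extension back. *)
Lemma eqv_barred k tau bars s t : size tau + size tau <= k -> eqv k s t [::] ->
  avoids_barred s tau bars -> avoids_barred t tau bars.
Proof.
move=> hk h av I' [sI aI] oI; set m := map negb bars in oI.
have szI : size I' = size (mask m tau) by have [] := oI; rewrite size_map.
have szm : size (mask m tau) <= size tau by apply/size_subseq/mask_subseq.
have [|I [e1 e2 e3]] := @eqv_movesR _ (size tau) s t [::] I' _ szI aI.
  by apply: eqv_le h; lia.
have eII := etrans e1 (esym szI).
have [e4 e5] := eqv_zip e3 eII.
have [||J [[sJ aJ] [oJ mJ]]] := av I.
- by split; rewrite // e4.
- exact: order_iso_trans e5 oI.
have szJ : size J = size tau by have [] := oJ; rewrite size_map.
have [|J' [f1 f2 f3]] := @eqv_movesL (size tau) 0 s t (zip I I' ++ [::]) J _ szJ aJ; first by rewrite addn0.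
have eJJ := etrans szJ (esym f1).
have [f4 f5] := eqv_zip f3 eJJ.
exists J'; split; first by split; rewrite // -f4.
split; first exact: order_iso_trans (order_iso_sym f5) oJ.
rewrite -/m in mJ *.
have esz : size (mask m J') = size I' by rewrite -(size_mask_eq m eJJ) mJ.
apply: (@eq_from_nth _ 0) => // i hi; rewrite esz in hi.
(* An index of [I] is paired both with its entry in [I'] and with one in [mask m J']; the atoms
   force the two to agree. *)
have z1 : (nth 0 I i, nth 0 I' i) \in zip J J' ++ zip I I' ++ [::].
  by rewrite !mem_cat mem_zip_nth ?eII ?orbT.
have z2 : (nth 0 I i, nth 0 (mask m J') i) \in zip J J' ++ zip I I' ++ [::].
  rewrite mem_cat -mJ; apply/orP; left; apply: (@mem_mask _ _ m).
  by rewrite -zip_mask // mem_zip_nth ?(size_mask_eq m eJJ) ?esz.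
have [/= a _ _] := eqv_atom f3 z1 z2; have [/= b _ _] := eqv_atom f3 z2 z1.
by rewrite ltnn in a b; lia.
Qed.

(** * Generating functions of lists of permutations *)

Fixpoint choices (T : Type) (Ls : seq (seq T)) : seq (seq T) :=
  if Ls is L :: Ls' then [seq x :: r | x <- L, r <- choices Ls'] else [:: [::]].

Lemma choicesP (T : eqType) (x0 : T) Ls xs :
  reflect (size xs = size Ls /\ forall i, i < size Ls -> nth x0 xs i \in nth [::] Ls i)
    (xs \in choices Ls).
Proof.
elim: Ls xs => [|L Ls IH] xs /=.
  by rewrite inE; apply: (iffP eqP) => [->|[/size0nil]].
apply: (iffP allpairsP) => [[[x r] /= [hx /IH[e h] ->]]|].
  by split=> [|[|i]] //=; [rewrite e | apply: h].
case: xs => [|x r] [] //= [e] h; exists (x, r) => /=; split=> //.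
  exact: (h 0 isT).
by apply/IH; split=> // i hi; apply: (h i.+1).
Qed.

Lemma uniq_choices (T : eqType) (Ls : seq (seq T)) : all uniq Ls -> uniq (choices Ls).
Proof.
elim: Ls => //= L Ls IH /andP[uL uLs]; apply: allpairs_uniq => //; first exact: IH.
by move=> [x r] [y t] _ _ /= [-> ->].
Qed.

Lemma uniq_flatten_map (S T : eqType) (s : seq S) (f : S -> seq T) :
  uniq s -> (forall x, x \in s -> uniq (f x)) ->
  (forall x y z, x \in s -> y \in s -> z \in f x -> z \in f y -> x = y) ->
  uniq (flatten (map f s)).
Proof.
elim: s => //= x s IH /andP[xs us] uf inj; rewrite cat_uniq uf ?mem_head //=.
rewrite IH //; last first.
- by move=> y z t hy hz; apply: inj; rewrite in_cons (hy, hz) orbT.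
- by move=> y hy; apply: uf; rewrite in_cons hy orbT.
rewrite andbT; apply/hasPn => z /flattenP[_ /mapP[y ys ->] zy] /=.
apply/negP => zx; have e : x = y by apply: (inj x y z); rewrite ?mem_head // in_cons ys orbT.
by rewrite e ys in xs.
Qed.

Section GeneratingFunctions.
Local Open Scope ring_scope.

Lemma sum_choices (A : comNzRingType) (T : Type) (x0 : T) (Ls : seq (seq T)) (g : nat -> T -> A) :
  \sum_(xs <- choices Ls) \prod_(0 <= i < size Ls) g i (nth x0 xs i) =
  \prod_(0 <= i < size Ls) \sum_(x <- nth [::] Ls i) g i x.
Proof.
elim: Ls g => [|L Ls IH] g; first by rewrite big_seq1 !big_nil.
rewrite /= big_allpairs_dep /= [RHS]big_nat_recl //= -(IH (fun i => g i.+1)) big_distrl /=.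
apply: eq_bigr => x _; rewrite big_distrr /=; apply: eq_bigr => r _.
by rewrite big_nat_recl.
Qed.

(** One production of the grammar: the choices are sorted by the tuple [qs] of states of their
    entries. The condition [P] depends only on this tuple and the weight is additive, so each tuple
    contributes a product of generating functions. *)
Lemma production_sum (Q : finType) (T : eqType) (x0 : T) (tau : T -> Q)
    (Ls : seq (seq T)) (wt : nat -> T -> nat) (P : pred (seq T)) (wF : seq T -> nat)
    (d : pred (seq Q)) :
  (forall cs, cs \in choices Ls -> P cs -> wF cs = \sum_(0 <= i < size Ls) wt i (nth x0 cs i))%N ->
  (forall cs, cs \in choices Ls -> P cs = d (map tau cs)) ->
  \sum_(cs <- choices Ls | P cs) 'X^(wF cs) =
  \sum_(qs <- choices (nseq (size Ls) (enum Q)) | d qs)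
    \prod_(0 <= i < size Ls) \sum_(c <- nth [::] Ls i | tau c == nth (tau x0) qs i) 'X^(wt i c)
  :> {poly rat}.
Proof.
move=> hw hd.
pose G (cs : seq T) : {poly rat} := \prod_(0 <= i < size Ls) 'X^(wt i (nth x0 cs i)).
transitivity (\sum_(cs <- choices Ls | d (map tau cs)) G cs).
  rewrite big_seq_cond [RHS]big_seq_cond; apply: eq_big => [cs|cs /andP[h1 h2]].
    by case: (boolP (cs \in _)) => //= h; rewrite hd.
  by rewrite hw // expr_sum.
pose QS := choices (nseq (size Ls) (enum Q)).
have uQS : uniq QS by apply: uniq_choices; rewrite all_nseq enum_uniq orbT.
transitivity (\sum_(cs <- choices Ls) \sum_(qs <- QS | d qs) (qs == map tau cs)%:R * G cs).
  rewrite big_seq_cond [RHS]big_seq big_mkcondr /=; apply: eq_bigr => cs hcs.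
  have hq : map tau cs \in QS.
    apply/(choicesP (tau x0)); have /(choicesP x0)[e h] := hcs.
    rewrite size_map e size_nseq; split=> // i hi; rewrite nth_nseq hi.
    by rewrite mem_enum.
  rewrite big_mkcond (bigD1_seq _ hq uQS) /= eqxx mul1r big1 ?addr0 //= => qs ne.
  by rewrite (negbTE ne) mul0r; case: ifP.
rewrite exchange_big /= big_seq_cond [RHS]big_seq_cond; apply: eq_bigr => qs /andP[hqs _].
have /(choicesP (tau x0))[eqs _] := hqs; rewrite size_nseq in eqs.
pose g i x : {poly rat} := (tau x == nth (tau x0) qs i)%:R * 'X^(wt i x).
transitivity (\prod_(0 <= i < size Ls) \sum_(x <- nth [::] Ls i) g i x); last first.
  apply: eq_bigr => i _; rewrite [RHS]big_mkcond; apply: eq_bigr => c _.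
  by rewrite /g; case: eqP => _; rewrite ?mul1r ?mul0r.
rewrite -(sum_choices x0) big_seq [RHS]big_seq; apply: eq_bigr => cs hcs.
have /(choicesP x0)[ecs _] := hcs.
rewrite /g big_split /=; congr (_ * _).
have [->|ne] := eqVneq qs (map tau cs).
  rewrite big_nat_cond big1 // => i /andP[/andP[_ hi] _].
  by rewrite (nth_map x0) ?ecs // eqxx.
have : ~~ all (fun i => tau (nth x0 cs i) == nth (tau x0) qs i) (iota 0 (size Ls)).
  apply: contra ne => /allP h; apply/eqP/(@eq_from_nth _ (tau x0)).
    by rewrite size_map ecs.
  move=> i hi; rewrite eqs in hi; rewrite (nth_map x0) ?ecs //; apply/esym/eqP/h.
  by rewrite mem_iota.
rewrite -has_predC => /hasP[i]; rewrite mem_iota /= => hi /negbTE hne.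
rewrite big_mkord; apply/esym/eqP/prodf_eq0; exists (Ordinal hi) => //.
by rewrite /= hne.
Qed.

End GeneratingFunctions.

(* When [k] is [false], [sg] is an involution and we describe the involutions of the form
   [inflate sg als]: one argument is chosen for each orbit of [sg], at its least index. *)
Definition reps (k : bool) (sg : seq nat) : seq nat :=
  [seq i <- iota 0 (size sg) | k || (i <= pv sg i)].

(** [false] marks an argument that has to be an involution, which happens at the fixed points of an
    involution [sg]; [true] marks an arbitrary argument. *)
Definition kinds (k : bool) (sg : seq nat) : seq bool :=
  [seq k || (pv sg i != i) | i <- reps k sg].

Definition args (k : bool) (sg : seq nat) (cs : seq (seq nat)) : seq (seq nat) :=
  mkseq (fun i => if k || (i <= pv sg i) then nth [::] cs (index i (reps k sg))
                  else inv (nth [::] cs (index (pv sg i) (reps k sg)))) (size sg).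

(* [3 2 1], which is not simple, accounts for the involutions [inflate 321 [:: a; b; inv a]]. *)
Definition canon3 (sg : seq nat) (als : seq (seq nat)) : bool :=
  canon sg als && ((sg == [:: 3; 2; 1]) ==> ~~ dec false (nth [::] als 0)).

Lemma size_kinds k sg : size (kinds k sg) = size (reps k sg).
Proof. exact: size_map. Qed.

Lemma size_args k sg cs : size (args k sg cs) = size sg.
Proof. exact: size_mkseq. Qed.

Lemma reps_uniq k sg : uniq (reps k sg).
Proof. by rewrite filter_uniq ?iota_uniq. Qed.

Lemma mem_reps k sg i : (i \in reps k sg) = (k || (i <= pv sg i)) && (i < size sg).
Proof. by rewrite mem_filter mem_iota. Qed.

Lemma pv_pv sg i : is_perm sg -> inv sg = sg -> i < size sg -> pv sg (pv sg i) = i.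
Proof. by move=> h e hi; rewrite -{1}e pv_inv. Qed.

Lemma mem_reps_pv sg i : is_perm sg -> inv sg = sg -> i < size sg -> ~~ (i <= pv sg i) ->
  pv sg i \in reps false sg.
Proof. by move=> h e hi hn; rewrite mem_reps pv_lt // pv_pv //=; lia. Qed.

Lemma args_inflatable k sg cs : is_perm sg -> (~~ k -> inv sg = sg) ->
  size cs = size (reps k sg) -> all vperm cs -> inflatable sg (args k sg cs).
Proof.
move=> hsg hI ecs hcs; split; rewrite ?size_args //.
apply/(all_nthP [::]) => i; rewrite size_args => hi; rewrite nth_mkseq //.
case: ifP => h.
  by apply: (allP hcs); rewrite mem_nth // ecs index_mem mem_reps h hi.
move/negbT: h; rewrite negb_or => /andP[hk h].
have -> : k = false by apply/negbTE.
apply/inv_vperm/(allP hcs); rewrite mem_nth // ecs (negbTE hk) index_mem.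
by apply: mem_reps_pv => //; apply: hI.
Qed.

Lemma sum_orbits sg (f : nat -> nat) : is_perm sg -> inv sg = sg ->
  \sum_(i < size sg) f (if i <= pv sg i then nat_of_ord i else pv sg i) =
  \sum_(i < size sg | i <= pv sg i) (if pv sg i != i then 2 else 1) * f i.
Proof.
move=> hsg hI; rewrite (bigID (fun i : 'I__ => i <= pv sg i)) /=.
have -> : \sum_(i < size sg | ~~ (i <= pv sg i)) f (if i <= pv sg i then nat_of_ord i else pv sg i) =
   \sum_(i < size sg | i < pv sg i) f i.
  pose h (i : 'I_(size sg)) := Ordinal (pv_lt hsg (ltn_ord i)).
  have hK : involutive h by move=> i; apply: val_inj; rewrite /= pv_pv.
  rewrite (reindex_inj (inv_inj hK)) /=; apply: eq_big => i; rewrite pv_pv // -ltnNge //.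
  by move=> lt; rewrite leqNgt lt.
rewrite [X in _ + X]big_mkcond [X in X + _]big_mkcond [RHS]big_mkcond -big_split /=.
apply: eq_bigr => i _; case: (ltngtP (pv sg i) i) => //= _; lia.
Qed.

(** Here lies the reason for counting kind [true] with weight 2 next to involutions: an argument on
    a 2-cycle occurs twice. For [k = true] every kind is [true], and the factor [w true] is common
    to both sides. *)
Lemma size_inflate_args k sg cs (w : bool -> nat) : is_perm sg ->
  (~~ k -> [/\ inv sg = sg, w true = 2 & w false = 1]) ->
  size cs = size (reps k sg) -> all vperm cs ->
  w k * size (inflate sg (args k sg cs)) =
  \sum_(0 <= j < size (reps k sg)) w (nth true (kinds k sg) j) * size (nth [::] cs j).
Proof.
move=> hsg hI ecs hcs.
have inf : inflatable sg (args k sg cs) by apply: args_inflatable => // /hI[].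
pose rs := reps k sg; pose f r := size (nth [::] cs (index r rs)).
have -> : \sum_(0 <= j < size (reps k sg)) w (nth true (kinds k sg) j) * size (nth [::] cs j) =
    \sum_(r <- rs) w (k || (pv sg r != r)) * f r.
  rewrite [RHS](big_nth 0) big_nat_cond [RHS]big_nat_cond; apply: eq_bigr => j /andP[/andP[_ hj] _].
  by rewrite /kinds (nth_map 0) // /f index_uniq // reps_uniq.
rewrite (size_inflate inf) sumnE big_map (big_nth [::]) size_args big_mkord.
rewrite /rs {1}/reps big_filter -[X in iota _ X]subn0 -/(index_iota 0 (size sg)) big_mkord.
rewrite /f /rs; case: k hI {rs f} inf ecs => /= hI inf ecs.
  by rewrite big_distrr; apply: eq_bigr => i _; rewrite nth_mkseq.
have [hI2 H1 H2] := hI isT.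
pose f r := size (nth [::] cs (index r (reps false sg))).
rewrite H2 mul1n.
transitivity (\sum_(i < size sg | i <= pv sg i) (if pv sg i != i then 2 else 1) * f i).
  rewrite -(sum_orbits f hsg hI2); apply: eq_bigr => i _; rewrite nth_mkseq //=.
  by case: ifP => _; rewrite ?size_inv.
by apply: eq_bigr => i _; case: eqP => _ /=; rewrite ?H1 ?H2.
Qed.

(** * Enumeration by depth of decomposition *)

Section Lists.
Variable Sh : bool -> seq (seq nat).

Definition build (src : bool -> seq (seq nat)) (k : bool) (sg : seq nat) : seq (seq nat) :=
  [seq inflate sg (args k sg cs) |
     cs <- [seq cs <- choices (map src (kinds k sg)) | canon3 sg (args k sg cs)]].

(** The bound [N] on the depth keeps the lists finite and matches the [N]-th iterate of the
    rules. *)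
Fixpoint Lam (N : nat) (k : bool) : seq (seq nat) :=
  if N is N'.+1 then [:: 1] :: flatten [seq build (Lam N') k sg | sg <- Sh k] else [::].

Hypothesis Sh_perm : forall k sg, sg \in Sh k -> is_perm sg.
Hypothesis Sh_gt1 : forall k sg, sg \in Sh k -> 1 < size sg.
Hypothesis Sh_inv : forall sg, sg \in Sh false -> inv sg = sg.

Lemma Sh_inv' k sg : sg \in Sh k -> ~~ k -> inv sg = sg.
Proof. by case: k => // /Sh_inv. Qed.

Lemma choices_kinds (src : bool -> seq (seq nat)) k sg cs :
  reflect (size cs = size (reps k sg) /\
           forall j, j < size cs -> nth [::] cs j \in src (nth true (kinds k sg) j))
    (cs \in choices (map src (kinds k sg))).
Proof.
apply: (iffP (choicesP [::] _ _)); rewrite size_map size_kinds => -[e h]; split=> //.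
  move=> j; rewrite e => hj.
  by have := h j hj; rewrite (nth_map true) // size_kinds.
by move=> j hj; rewrite (nth_map true) ?size_kinds //; apply: h; rewrite e.
Qed.

Lemma mem_build src k sg s : reflect (exists cs, [/\ size cs = size (reps k sg),
    forall j, j < size cs -> nth [::] cs j \in src (nth true (kinds k sg) j),
    canon3 sg (args k sg cs) & s = inflate sg (args k sg cs)]) (s \in build src k sg).
Proof.
apply: (iffP mapP) => [[cs]|[cs [h1 h2 h3 ->]]].
  by rewrite mem_filter => /andP[h1 /choices_kinds[h2 h3]] ->; exists cs.
by exists cs => //; rewrite mem_filter h3; apply/choices_kinds.
Qed.

Lemma mem_Lam N k s : reflect (s = [:: 1] \/ exists2 sg, sg \in Sh k & s \in build (Lam N) k sg)
  (s \in Lam N.+1 k).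
Proof.
rewrite /= in_cons; apply: (iffP orP) => -[].
- by move/eqP; left.
- by move/flattenP=> [_ /mapP[sg h ->] hs]; right; exists sg.
- by move/eqP; left.
- by case=> sg h hs; right; apply/flattenP; exists (build (Lam N) k sg) => //; apply: map_f.
Qed.

Lemma Lam_ind (P : bool -> seq nat -> Prop) :
  (forall k, P k [:: 1]) ->
  (forall k sg cs, sg \in Sh k -> size cs = size (reps k sg) ->
     all vperm cs -> (forall j, j < size cs -> P (nth true (kinds k sg) j) (nth [::] cs j)) ->
     inflatable sg (args k sg cs) -> canon3 sg (args k sg cs) ->
     P k (inflate sg (args k sg cs))) ->
  forall N k s, s \in Lam N k -> P k s.
Proof.
move=> h1 hi N k s hs.
suff : vperm s /\ P k s by case.
elim: N k s hs => // N IH k s /mem_Lam[->//|[sg hsg /mem_build[cs [e h c ->]]]].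
have v : all vperm cs by apply/(all_nthP [::]) => j hj; have [] := IH _ _ (h j hj).
have inf : inflatable sg (args k sg cs).
  by apply: args_inflatable => //; [apply: Sh_perm hsg | apply: Sh_inv' hsg].
split; first by apply: inflate_vperm => //; apply/ltnW/Sh_gt1/hsg.
by apply: hi => // j hj; have [] := IH _ _ (h j hj).
Qed.

Lemma Lam_vperm N k s : s \in Lam N k -> vperm s.
Proof.
apply: (@Lam_ind (fun _ s => vperm s)) => // {}k sg cs hsg _ _ _ inf _.
by apply: inflate_vperm => //; apply/ltnW/Sh_gt1/hsg.
Qed.

Variables (Q : finType) (tau : seq nat -> Q) (w : bool -> nat).
Hypothesis w_inv : forall sg, sg \in Sh false -> w true = 2 /\ w false = 1.
Hypothesis w_gt0 : forall k, 0 < w k.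
Hypothesis tau_inflate : forall sg als bls, inflatable sg als -> inflatable sg bls ->
  (forall i, i < size sg -> tau (nth [::] als i) = tau (nth [::] bls i)) ->
  tau (inflate sg als) = tau (inflate sg bls).
Hypothesis tau_inv : forall s t, is_perm s -> is_perm t -> tau s = tau t -> tau (inv s) = tau (inv t).
Hypothesis tau_dec : forall d s t, tau s = tau t -> dec d s = dec d t.

Lemma Sh_w k sg : sg \in Sh k -> ~~ k -> [/\ inv sg = sg, w true = 2 & w false = 1].
Proof. by case: k => // h _; have [h1 h2] := w_inv h; split=> //; apply: Sh_inv. Qed.

(** Stated by means of some arguments with the given states; by [transP] all arguments with these
    states behave alike. *)
Definition trans (k : bool) (sg : seq nat) (q : Q) (qs : seq Q) : bool :=
  pbool (exists cs, [/\ all vperm cs, size cs = size (reps k sg), map tau cs = qs,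
    canon3 sg (args k sg cs) & tau (inflate sg (args k sg cs)) = q]).

Lemma transP k sg q cs : sg \in Sh k -> all vperm cs -> size cs = size (reps k sg) ->
  canon3 sg (args k sg cs) && (tau (inflate sg (args k sg cs)) == q) =
  trans k sg q (map tau cs).
Proof.
move=> hsg hcs ecs; apply/andP/pboolP => [[h /eqP e]|[bs [hbs ebs ebc h e]]].
  by exists cs.
have hp := Sh_perm hsg.
have inf bs' : all vperm bs' -> size bs' = size (reps k sg) -> inflatable sg (args k sg bs').
  by move=> h1 h2; apply: args_inflatable => //; apply: Sh_inv' hsg.
have te j : j < size (reps k sg) -> tau (nth [::] bs j) = tau (nth [::] cs j).
  move=> hj; have := congr1 (nth (tau [::]) ^~ j) ebc.
  by rewrite /= !(nth_map [::]) ?ebs ?ecs.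
have ta i : i < size sg -> tau (nth [::] (args k sg bs) i) = tau (nth [::] (args k sg cs) i).
  move=> hi; rewrite !nth_mkseq //; case: ifP => hki.
    by apply: te; rewrite index_mem mem_reps hki.
  move/negbT: hki; rewrite negb_or => /andP[hk hki].
  have hI := Sh_inv' hsg hk.
  have hm : pv sg i \in reps k sg by rewrite (negbTE hk); apply: mem_reps_pv.
  apply: tau_inv; last by apply: te; rewrite index_mem.
    by apply/vperm_perm/(allP hbs); rewrite mem_nth // ebs index_mem.
  by apply/vperm_perm/(allP hcs); rewrite mem_nth // ecs index_mem.
have g0 : 0 < size sg by apply/ltnW/Sh_gt1/hsg.
split; last by rewrite -e; apply/eqP/esym/tau_inflate => //; apply: inf.
have td d := tau_dec d (ta 0 g0).
by move: h; rewrite /canon3 /canon /= !td.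
Qed.

Section Rec.
Local Open Scope ring_scope.

Definition gf (N : nat) (i : bool * Q) : {poly rat} :=
  \sum_(c <- Lam N i.1 | tau c == i.2) 'X^(w i.1 * size c)%N.

(* For [w true = 2] a permutation counts together with its inverse. *)
Definition rules (i : bool * Q) : seq (rule (bool * Q)%type) :=
  (if tau [:: 1%N] == i.2 then [:: (w i.1, [::])] else [::]) ++
  flatten [seq [seq (0%N, zip (kinds i.1 sg) qs) |
      qs <- [seq qs <- choices (nseq (size (reps i.1 sg)) (enum Q)) | trans i.1 sg i.2 qs]]
    | sg <- Sh i.1].

Lemma gf_rec N i : gf N.+1 i = reval 'X (gf N) (rules i).
Proof.
case: i => k q; rewrite /gf /reval /rules /= big_cons big_cat /=.
have -> : forall (b : bool) (a c : {poly rat}), (if b then a + c else c) = (if b then a else 0) + c.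
  by move=> [] a c; rewrite ?add0r.
congr (_ + _).
  case: ifP => _; last by rewrite big_nil.
  by rewrite big_seq1 /= big_nil mulr1 muln1.
rewrite !big_flatten !big_map big_seq [RHS]big_seq; apply: eq_bigr => sg hsg.
rewrite [LHS]big_map [LHS]big_filter_cond [RHS]big_map [RHS]big_filter.
have hp := Sh_perm hsg.
pose Ls := map (Lam N) (kinds k sg).
have szL : size Ls = size (reps k sg) by rewrite size_map size_kinds.
have cv cs : cs \in choices Ls -> all vperm cs /\ size cs = size (reps k sg).
  move=> /choices_kinds[e h]; split=> //.
  by apply/(all_nthP [::]) => j /h; apply: Lam_vperm.
rewrite (@production_sum Q _ [::] tau Ls
  (fun j c => w (nth true (kinds k sg) j) * size c)%N
  (fun cs => canon3 sg (args k sg cs) && (tau (inflate sg (args k sg cs)) == q))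
  (fun cs => w k * size (inflate sg (args k sg cs)))%N (trans k sg q)).
- rewrite szL big_seq_cond [RHS]big_seq_cond; apply: eq_bigr => qs /andP[/(choicesP (tau [::]))[e _] _].
  rewrite size_nseq in e.
  rewrite /= expr0 mul1r (big_nth (true, tau [::])) size_zip size_kinds e minnn.
  rewrite big_nat_cond [RHS]big_nat_cond; apply: eq_bigr => j /andP[/andP[_ hj] _].
  by rewrite nth_zip ?size_kinds // (nth_map true) ?size_kinds.
- by move=> cs /cv[h1 h2] _; rewrite szL; apply: size_inflate_args => //; apply: Sh_w.
by move=> cs /cv[h1 h2]; apply: transP.
Qed.

Lemma gf_iter N i : iterR 'X (fun=> 0) rules N i = gf N i.
Proof.
elim: N i => [|N IH] i; first by rewrite /gf big_nil.
by rewrite gf_rec /= addr0; apply: eq_reval.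
Qed.

(** An inflation rule carries no power of [x]. It has at least two letters unless [sg] is a single
    2-cycle, where [21[a, inv a]] has the one letter [a]; this letter is of kind [true], whose level
    is lower. *)
Lemma rules_proper : proper (fun i : bool * Q => ~~ i.1 : nat) rules.
Proof.
move=> [k q] r; rewrite /rules mem_cat => /orP[].
  case: ifP => _ //; rewrite inE => /eqP -> /=; split=> //; left; apply: w_gt0.
move/flattenP=> [_ /mapP[sg hsg ->] /mapP[qs]].
rewrite mem_filter => /andP[_ /(choicesP (tau [::]))[e _]] ->; rewrite size_nseq in e.
have hp := Sh_perm hsg; have g1 := Sh_gt1 hsg.
have sz : size (zip (kinds k sg) qs) = size (reps k sg) by rewrite size_zip size_kinds e minnn.
have kt : k -> kinds k sg = nseq (size (reps k sg)) true.
  by move=> ->; rewrite /kinds; elim: (reps true sg) => //= a l ->.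
have r0 : 0%N \in reps k sg by rewrite mem_reps leq0n orbT (ltnW g1).
have r2 : (1 < size (reps k sg))%N \/ forall x, x \in kinds k sg -> x /\ ~~ k.
  have [lt|le] := ltnP 1 (size (reps k sg)); [by left | right].
  have ers : reps k sg = [:: 0%N] by case: (reps k sg) r0 le => [|a [|]] //=; rewrite inE => /eqP->.
  have no1 : (1%N \in reps k sg) = false by rewrite ers.
  rewrite mem_reps g1 andbT in no1; move/negbT: no1; rewrite negb_or => /andP[nk n1].
  move=> x; rewrite /kinds ers inE => /eqP ->; rewrite nk (negbTE nk) /=; split=> //.
  apply/eqP => p0; have p1 : pv sg 1 = 0%N by move: n1; case: (pv sg 1).
  by have := pv_inj hp (ltnW g1) g1 (etrans p0 (esym p1)).
split=> /=.
- move=> j jz; have := map_f fst jz; rewrite -/unzip1 unzip1_zip ?size_kinds ?e // => h.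
  case: (k) kt h => [/(_ isT) -> |]; last by case: (j.1).
  by rewrite mem_nseq => /andP[_ /eqP ->].
- by move=> z; move: sz; rewrite z /=; case: (reps k sg) r0.
case: r2 => [lt|h]; first by right; left; rewrite sz.
right; right=> j jz; have := map_f fst jz; rewrite -/unzip1 unzip1_zip ?size_kinds ?e // => /h[-> nk].
by rewrite nk.
Qed.

End Rec.
End Lists.

(** * Completeness and uniqueness of the enumeration *)

Definition t321 : seq nat := [:: 3; 2; 1].

Lemma inflate321 a b c :
  inflate t321 [:: a; b; c] = inflate (two false) [:: a; inflate (two false) [:: b; c]].
Proof.
rewrite /inflate /voff /= !cats0.
do ?rewrite big_mkcond !big_ord_recl big_ord0 /=.
rewrite size_cat !size_map map_cat -!map_comp !add0n !addn0; do 2!congr (_ ++ _).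
Qed.

Lemma nsimple321 : ~ is_simple t321.
Proof.
move=> h; have := h 0 2; case=> [|//|[]//].
by split=> //; exists 2.
Qed.

Lemma inflatable2 d a b : vperm a -> vperm b -> inflatable (two d) [:: a; b].
Proof. by move=> ha hb; split; rewrite ?size_two //= ?ha ?hb //; apply: two_perm. Qed.

Lemma inflatable321 a b c : vperm a -> vperm b -> vperm c -> inflatable t321 [:: a; b; c].
Proof. by move=> ha hb hc; split; rewrite //= ha hb hc. Qed.

Lemma inflatable2P d als : inflatable (two d) als ->
  exists a b, [/\ als = [:: a; b], vperm a & vperm b].
Proof.
move=> inf; have e := two_args inf erefl; exists (nth [::] als 0), (nth [::] als 1).
by split=> //; apply: (infl_al inf); rewrite size_two.
Qed.

Lemma args_true sg cs : size cs = size sg -> args true sg cs = cs.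
Proof.
move=> e; rewrite -[RHS](mkseq_nth [::]) /args e; apply/eq_in_map => i; rewrite mem_iota => hi /=.
by rewrite /reps filter_predT -{1}[i](nth_iota 0 0 hi) index_uniq ?size_iota ?iota_uniq.
Qed.

Lemma nth_args_reps k sg cs j : j < size (reps k sg) ->
  nth [::] (args k sg cs) (nth 0 (reps k sg) j) = nth [::] cs j.
Proof.
move=> hj; have := mem_nth 0 hj; rewrite mem_reps => /andP[h1 h2].
by rewrite nth_mkseq // h1 index_uniq // reps_uniq.
Qed.

Lemma args_inj k sg cs cs' : size cs = size (reps k sg) -> size cs' = size (reps k sg) ->
  args k sg cs = args k sg cs' -> cs = cs'.
Proof.
move=> e e' h; apply: (@eq_from_nth _ [::]); rewrite e // => j hj.
by rewrite -(nth_args_reps cs hj) h nth_args_reps.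
Qed.

Lemma inv_args_args sg cs : is_perm sg -> inv sg = sg -> size cs = size (reps false sg) ->
  all vperm cs ->
  (forall j, j < size cs -> ~~ nth true (kinds false sg) j -> inv (nth [::] cs j) = nth [::] cs j) ->
  inv_args sg (args false sg cs) = args false sg cs.
Proof.
move=> hsg hI ecs vcs hk; rewrite /inv_args hI; apply/eq_in_map => i.
rewrite mem_iota => /= hi; have hpi := pv_lt hsg hi.
rewrite nth_mkseq // pv_pv //=.
have vp j : j \in reps false sg -> is_perm (nth [::] cs (index j (reps false sg))).
  by move=> hj; apply/vperm_perm/(allP vcs); rewrite mem_nth // ecs index_mem.
case: (ltngtP i (pv sg i)) => h.
- by rewrite invK //; apply: vp; rewrite mem_reps /= hi ltnW.
- by [].
have hr : i \in reps false sg by rewrite mem_reps /= -h leqnn.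
rewrite -h; apply: hk; first by rewrite ecs index_mem.
by rewrite /kinds (nth_map 0) ?index_mem // nth_index //= negbK; apply/eqP.
Qed.

Section Involutions.
Variables (Sl : seq (seq nat)) (use_inv : bool).
Hypothesis Sl_perm : forall sg : seq nat, sg \in Sl -> is_perm sg.
Hypothesis Sl_simple : forall sg : seq nat, sg \in Sl -> is_simple sg.
Hypothesis Sl_gt1 : forall sg : seq nat, sg \in Sl -> 1 < size sg.
Hypothesis Sl_uniq : uniq Sl.
Hypothesis Sl_inv : forall sg : seq nat, sg \in Sl -> inv sg \in Sl.
Hypothesis Sl_two : forall d, two d \in Sl.

(** If involutions are not asked for, kind [false] has no productions, which leaves the weight of
    kind [true] free to be 1. *)
Definition Sh (k : bool) : seq (seq nat) :=
  if k then Sl else if use_inv then t321 :: [seq sg <- Sl | inv sg == sg] else [::].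

Lemma Sh_cases k sg : sg \in Sh k -> (sg = t321 /\ k = false) \/ sg \in Sl.
Proof.
rewrite /Sh; case: k => //; first by right.
case: use_inv => //; rewrite in_cons mem_filter => /orP[/eqP ->|/andP[_ ->]]; [by left | by right].
Qed.

Lemma Sh_perm k sg : sg \in Sh k -> is_perm sg.
Proof. by case/Sh_cases => [[-> _]|/Sl_perm]. Qed.

Lemma Sh_gt1 k sg : sg \in Sh k -> 1 < size sg.
Proof. by case/Sh_cases => [[-> _]|/Sl_gt1]. Qed.

Lemma Sh_inv sg : sg \in Sh false -> inv sg = sg.
Proof.
rewrite /Sh; case: use_inv => //; rewrite in_cons mem_filter.
by move=> /orP[/eqP ->|/andP[/eqP]].
Qed.

Lemma Sh_uniq k : uniq (Sh k).
Proof.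
rewrite /Sh; case: k => //; case: use_inv => //=; rewrite filter_uniq // andbT.
by rewrite mem_filter; apply/negP => /andP[_ /Sl_simple]; apply: nsimple321.
Qed.

Notation L := (Lam Sh).

Lemma W_inv s : Wclosure Sl s -> Wclosure Sl (inv s).
Proof.
elim=> [|sg als hsg inf _ IH]; first exact: W_one.
rewrite inv_inflate //; apply: W_inflate; [exact: Sl_inv | exact: inv_inflatable |].
move=> a /(nthP [::])[j]; rewrite size_mkseq => hj <-.
have hp := Sl_perm hsg; have [i hi <-] := pv_onto hp hj; rewrite nth_inv_args //.
by apply: IH; rewrite mem_nth // (infl_size inf).
Qed.

Lemma Lam_sound N k s : s \in L N k -> Wclosure Sl s /\ (~~ k -> inv s = s).
Proof.
apply: (@Lam_ind Sh Sh_perm Sh_gt1 Sh_inv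
  (fun k s => Wclosure Sl s /\ (~~ k -> inv s = s))) => {}k.
  by split=> //; exact: W_one.
move=> sg cs hsg ecs vcs IH inf can; split; last first.
  case: k hsg ecs IH inf can => // hsg ecs IH inf can _.
  have hI := Sh_inv hsg.
  rewrite inv_inflate // hI inv_args_args //; first exact: Sh_perm hsg.
  by move=> j hj; have [_] := IH j hj.
have Wa a : a \in args k sg cs -> Wclosure Sl a.
  move=> /(nthP [::])[i]; rewrite size_args => hi <-; rewrite nth_mkseq //.
  have Wcs j : Wclosure Sl (nth [::] cs (index j (reps k sg))) \/ j \notin reps k sg.
    case: (boolP (j \in reps k sg)) => hj; [left | by right].
    by have [] := IH (index j (reps k sg)); rewrite // ecs index_mem.
  case: ifP => h; first by case: (Wcs i) => //; rewrite mem_reps h hi.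
  apply: W_inv; case: (Wcs (pv sg i)) => //.
  move/negbT: h; rewrite negb_or => /andP[/negbTE hk h]; subst k.
  by rewrite mem_reps_pv //; [exact: Sh_perm hsg | exact: Sh_inv].
case/Sh_cases: (hsg) => [[e _]|h]; last exact: W_inflate.
subst sg; have := infl_size inf; case E : (args k t321 cs) => [|a [|b [|c [|]]]] //= _.
rewrite E in inf Wa; have [_ _ /= /and4P[va vb vc _]] := inf.
rewrite inflate321; apply: W_inflate => //.
  by apply: inflatable2 => //; apply: inflate_vperm => //; apply: inflatable2.
move=> x; rewrite !inE => /orP[/eqP->|/eqP->]; first by apply: Wa; rewrite mem_head.
apply: W_inflate => //; first exact: inflatable2.
by move=> y; rewrite !inE => /orP[/eqP->|/eqP->]; apply: Wa; rewrite !in_cons eqxx ?orbT.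
Qed.

Lemma args321 cs : size cs = size (reps false t321) ->
  exists a b, cs = [:: a; b] /\ args false t321 cs = [:: a; b; inv a].
Proof. by case: cs => [|a [|b [|]]] //= _; exists a, b. Qed.

Lemma args_two_false cs : size cs = size (reps false (two false)) ->
  exists a, cs = [:: a] /\ args false (two false) cs = [:: a; inv a].
Proof. by case: cs => [|a [|]] //= _; exists a. Qed.

Lemma canon3_canon sg als : canon3 sg als -> canon sg als.
Proof. by case/andP. Qed.

Lemma canon2 d a b : ~~ dec d a -> canon (two d) [:: a; b].
Proof. by move=> h; apply/canonP => d' e /=; have <- : d = d' by move: e; case: (d); case: (d'). Qed.

Lemma decompose321 cs : size cs = size (reps false t321) -> all vperm cs ->
  canon3 t321 (args false t321 cs) ->
  exists a b, [/\ cs = [:: a; b], vperm a, vperm b, ~~ dec false a &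
    inflate t321 (args false t321 cs) =
    inflate (two false) [:: a; inflate (two false) [:: b; inv a]]].
Proof.
move=> e v can; have [a [b [ecs ea]]] := args321 e.
exists a, b; rewrite ea in can *; subst cs; have /= /and3P[va vb _] := v.
by split=> //; rewrite ?inflate321 //; case/andP: can.
Qed.

Lemma inflatable_nest a b : vperm a -> vperm b ->
  inflatable (two false) [:: a; inflate (two false) [:: b; inv a]].
Proof.
move=> va vb; apply: inflatable2 => //; apply: inflate_vperm => //.
by apply: inflatable2 => //; apply: inv_vperm.
Qed.

(** Uniqueness comes from [inflate_inj], after [t321] has been rewritten as the canonical [21[a,
    21[b, inv a]]]. This is never of the form [21[c, inv c]]: it would force [c = a], and then the
    lengths leave no room for [b]. *)
Lemma inflate_args_inj k sg sg' cs cs' : sg \in Sh k -> sg' \in Sh k ->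
  size cs = size (reps k sg) -> size cs' = size (reps k sg') ->
  all vperm cs -> all vperm cs' ->
  canon3 sg (args k sg cs) -> canon3 sg' (args k sg' cs') ->
  inflate sg (args k sg cs) = inflate sg' (args k sg' cs') -> sg = sg' /\ cs = cs'.
Proof.
move=> h h' e e' v v' c c' E.
have inf s bs : s \in Sh k -> size bs = size (reps k s) -> all vperm bs ->
    inflatable s (args k s bs).
  move=> hs; apply: args_inflatable; first exact: Sh_perm hs.
  by move: hs; case: (k) => // /Sh_inv.
have mixed s cs1 cs2 : s \in Sl -> t321 \in Sh false -> s \in Sh false ->
    size cs1 = size (reps false t321) -> size cs2 = size (reps false s) ->
    all vperm cs1 -> all vperm cs2 -> inflatable s (args false s cs2) ->
    canon3 t321 (args false t321 cs1) -> canon3 s (args false s cs2) ->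
    inflate t321 (args false t321 cs1) = inflate s (args false s cs2) -> False.
  move=> hs ht hs' e1 e2 v1 v2 inf2 c1 c2 E'.
  have [a [b [ecs va vb nd E3]]] := decompose321 e1 v1 c1.
  rewrite E3 in E'.
  have [|||es ea] := inflate_inj (inflatable_nest va vb) inf2 _ (Sl_simple hs) _ (Sl_gt1 hs) _ (canon3_canon c2) E'.
  - by apply: simple_small; rewrite size_two.
  - by rewrite size_two.
  - exact: canon2.
  subst s; have [c0 [_ ea2]] := args_two_false e2; rewrite ea2 in ea.
  case: ea => ea0 ea1; have e0 := congr1 size ea1.
  have i2 := inflatable2 false vb (inv_vperm va).
  have vb0 : 0 < size b by case/andP: vb.
  rewrite (size_inflate2 i2) -ea0 in e0.
  have {}e0 : size b + size (inv a) = size (inv a) := e0.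
  by move: vb0; rewrite (@addIn (size (inv a)) (size b) 0).
case/Sh_cases: (h) => [[es ek]|hs]; case/Sh_cases: (h') => [[es' ek']|hs'].
- subst sg sg' k; split=> //.
  have [a [b [ecs va vb nd E1]]] := decompose321 e v c.
  have [a' [b' [ecs' va' vb' nd' E1']]] := decompose321 e' v' c'.
  rewrite E1 E1' in E.
  have [||||||_ []] := inflate_inj (inflatable_nest va vb) (inflatable_nest va' vb') _ _ _ _ _ _ E.
  - by apply: simple_small; rewrite size_two.
  - by apply: simple_small; rewrite size_two.
  - by rewrite size_two.
  - by rewrite size_two.
  - exact: canon2.
  - exact: canon2.
  move=> ea E2; subst a'.
  have i2 := inflatable2 false vb (inv_vperm va); have i2' := inflatable2 false vb' (inv_vperm va).
  have [|_ [eb]] := inflate2_inj i2 i2' E2; last by rewrite ecs ecs' eb.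
  have e0 := congr1 size E2; rewrite (size_inflate2 i2) (size_inflate2 i2') in e0.
  exact: (addIn (e0 : size b + size (inv a) = size b' + size (inv a))).
- by subst sg k; exfalso; apply: (mixed sg' cs cs') => //; apply: inf.
- by subst sg' k; exfalso; apply: (mixed sg cs' cs) => //; apply: inf.
have [es ea] := inflate_inj (inf _ _ h e v) (inf _ _ h' e' v') (Sl_simple hs) (Sl_simple hs')
  (Sl_gt1 hs) (Sl_gt1 hs') (canon3_canon c) (canon3_canon c') E.
by split=> //; subst sg'; apply: args_inj ea.
Qed.

Lemma Lam_uniq N k : uniq (L N k).
Proof.
elim: N k => // N IH k.
have -> : L N.+1 k = [:: 1] :: flatten [seq build (L N) k sg | sg <- Sh k] by [].
have cv sg cs : size cs = size (reps k sg) ->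
    (forall j, j < size cs -> nth [::] cs j \in L N (nth true (kinds k sg) j)) -> all vperm cs.
  move=> e h; apply/(all_nthP [::]) => j /h; apply: (Lam_vperm Sh_perm Sh_gt1 Sh_inv).
rewrite cons_uniq; apply/andP; split.
  apply/negP => /flattenP[_ /mapP[sg hsg ->] /mem_build[cs [e h c E]]].
  have inf : inflatable sg (args k sg cs).
    apply: args_inflatable (cv _ _ e h) => //; first exact: Sh_perm hsg.
    by move: hsg; case: (k) => // /Sh_inv.
  by have := size_inflate_ge inf; rewrite -E leqNgt (Sh_gt1 hsg).
apply: uniq_flatten_map; first exact: Sh_uniq.
  move=> sg hsg; rewrite map_inj_in_uniq.
    by apply/filter_uniq/uniq_choices/allP => l /mapP[kd _ ->].
  move=> cs cs'; rewrite !mem_filter => /andP[c /choices_kinds[e h]] /andP[c' /choices_kinds[e' h']] E.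
  by have [] := inflate_args_inj hsg hsg e e' (cv _ _ e h) (cv _ _ e' h') c c' E.
move=> sg sg' z hsg hsg' /mem_build[cs [e h c ->]] /mem_build[cs' [e' h' c' E]].
by have [] := inflate_args_inj hsg hsg' e e' (cv _ _ e h) (cv _ _ e' h') c c' E.
Qed.

Section Completeness.
Variable C : seq nat -> Prop.
Hypothesis C_perm : forall s, C s -> is_perm s.
Hypothesis C_down : forall s t, C t -> is_perm s -> emb s t -> C s.
Hypothesis C_simple : forall s, C s -> is_simple s -> 1 < size s -> s \in Sl.

Lemma not321 sg : is_simple sg -> sg != t321.
Proof. by move=> h; apply/eqP => e; apply: nsimple321; rewrite -e. Qed.

Lemma canon3I sg als : canon sg als -> is_simple sg -> canon3 sg als.
Proof. by move=> c h; rewrite /canon3 c (negbTE (not321 h)). Qed.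

(** An involution also has the inverted form of its decomposition. For [size sg > 2] that form is
    canonical too, and uniqueness identifies both; for [12] the first arguments have the same
    length; for [21] the lengths of [a] and [b] have to be compared. *)
Lemma Lam_complete N s : C s -> 0 < size s <= N ->
  s \in L N true /\ (use_inv -> inv s = s -> s \in L N false).
Proof.
elim: N s => [|N IH] s hC; first by lia.
move=> hs; have hp := C_perm hC.
have [s1|s1] := leqP (size s) 1.
  have -> : s = [:: 1].
    case: s hp s1 hs {hC} => [|x [|]] // hp _ _.
    by have := @is_perm_nth _ 0 hp isT; rewrite /=; case: x {hp} => [|[|]].
  by split=> *; apply/mem_Lam; left.
have [sg [als [inf sim g1 can E]]] := decomposition hp s1.
have hsg : sg \in Sl.
  by apply: C_simple => //; apply: (C_down hC (infl_sg inf)); rewrite E; apply: emb_inflate_sg.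
have IHa i : i < size sg -> let a := nth [::] als i in
    a \in L N true /\ (use_inv -> inv a = a -> a \in L N false).
  move=> hi a; have va := infl_al inf hi; apply: IH.
    by apply: (C_down hC (vperm_perm va)); rewrite E; apply: emb_al.
  by case/andP: va => h0 _; rewrite [0 < _]h0; have := size_al_lt inf g1 hi; rewrite -E -/a; lia.
have szr : size (reps true sg) = size sg by rewrite /reps filter_predT size_iota.
have kd : kinds true sg = nseq (size sg) true.
  by rewrite -szr /kinds; elim: (reps true sg) => //= a l ->.
split=> [|ui hI].
  apply/mem_Lam; right; exists sg => //; apply/mem_build; exists als.
  rewrite args_true ?szr ?(infl_size inf) //; split=> //.
    by move=> j hj; rewrite kd nth_nseq hj; have [] := IHa j hj.
  exact: canon3I.
have hsz sg' : sg' \in Sh false -> s \in build (L N) false sg' -> s \in L N.+1 false.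
  by move=> h1 h2; apply/mem_Lam; right; exists sg'.
have ShI sg' : sg' \in Sl -> inv sg' = sg' -> sg' \in Sh false.
  by move=> h1 h2; rewrite /Sh ui in_cons mem_filter h1 h2 eqxx orbT.
have Einv := inv_inflate inf; rewrite -E hI E in Einv.
have inf' := inv_inflatable inf.
have [g2|g2] := ltnP 2 (size sg).
  have [||e1 e2] := inflate_inj inf inf' sim (inv_simple (infl_sg inf) sim) g1 _ can _ Einv.
  - by rewrite size_inv.
  - by apply/canonP => d /(congr1 size); rewrite size_inv size_two; lia.
  have e1' := esym e1.
  have hal i : i < size sg -> nth [::] als i = inv (nth [::] als (pv sg i)).
    by move=> hi; rewrite {1}e2 nth_mkseq // e1'.
  apply: (hsz sg); first exact: ShI.
  pose rs := reps false sg.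
  have ea : args false sg [seq nth [::] als i | i <- rs] = als.
    rewrite -[RHS](mkseq_nth [::]) (infl_size inf); apply/eq_in_map => i.
    rewrite mem_iota => hi; case: ifP => h.
      have hr : i \in rs by rewrite mem_reps h.
      by rewrite (nth_map 0) ?index_mem // nth_index.
    have hr : pv sg i \in rs by apply: mem_reps_pv => //; [exact: infl_sg inf | move: h => /= ->].
    by rewrite (nth_map 0) ?index_mem // nth_index // -hal.
  apply/mem_build; exists [seq nth [::] als i | i <- rs]; rewrite ea size_map; split=> //.
    move=> j hj; have := mem_nth 0 hj; rewrite mem_reps => /andP[_ hr].
    rewrite (nth_map 0) // /kinds (nth_map 0) //=; have [m1 m2] := IHa _ hr.
    by case: eqP => //= e; apply: m2 => //; rewrite [RHS]hal // e.
  exact: canon3I.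
have [|d ed] := @perm2 sg (infl_sg inf); first by lia.
subst sg; have [a [b [eab va vb]]] := inflatable2P inf; subst als.
have [a1 a2] := IHa 0 (ltnW g1); have [b1 b2] := IHa 1 g1; rewrite /= in a1 a2 b1 b2.
rewrite inv_two in Einv inf'.
have nd : ~~ dec d a by have /canonP/(_ d erefl) := can.
case: d hsg can sim g1 g2 inf inf' E Einv IHa szr kd nd => hsg can sim g1 g2 inf inf' E Einv IHa szr kd nd.
  rewrite inv_args_true in Einv inf'.
  have [|_ [ea eb]] := inflate2_inj inf inf' Einv; first by rewrite /= size_inv.
  apply: (hsz (two true)); first exact: ShI.
  apply/mem_build; exists [:: a; b]; split=> //; last exact: canon3I.
  by move=> [|[|j]] //= _; [apply: a2 | apply: b2].
rewrite inv_args_false in Einv inf'.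
have ca : ~ cut false a (size b).
  by move=> h; move/decP: nd; apply; exists (size b).
(* Equal lengths give [b = inv a]; a longer [a] would be cut at [size b] and so be decomposable; a
   longer [b] leads to [t321]. *)
case: (ltngtP (size a) (size b)) => h; last first.
- have [|_ [ea eb]] := inflate2_inj inf inf' Einv; first by rewrite /= size_inv.
  apply: (hsz (two false)); first exact: ShI.
  have eb' : b = inv a by [].
  apply/mem_build; exists [:: a]; split=> //.
  + by move=> [|j].
  + exact: (canon3I (canon2 (inv a) nd)).
  by rewrite E [in LHS]eb'.
- exfalso; apply: ca; apply: (cut_two_lt inf) => //.
  by have := cut_two inf'; rewrite -Einv /= size_inv.
have vib := inv_vperm vb.
(* Here [inv b] is a skew sum of some [x] of length [size a] and some [y], so [s =
   321[a, inv y, inv x]]; comparison with its inverse [321[x, y, inv a]] yields [x = a] and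
   [inv y = y]. *)
have cb : cut false (inv b) (size a).
  apply: (cut_two_lt inf'); last by rewrite /= size_inv.
  by have := cut_two inf; rewrite Einv.
have [xy [ixy exy szx]] := cut_inflate (vperm_perm vib) cb.
have [x [y [exy2 vx vy]]] := inflatable2P ixy; subst xy; rewrite /= in szx.
have viy := inv_vperm vy; have vix := inv_vperm vx; have via := inv_vperm va.
have eb : b = inflate (two false) [:: inv y; inv x].
  by rewrite -[LHS](invK (vperm_perm vb)) exy (inv_inflate ixy) inv_two inv_args_false.
have E3 : s = inflate t321 [:: a; inv y; inv x] by rewrite E inflate321 -eb.
have i3 := inflatable321 va viy vix.
have E4 : s = inflate t321 [:: x; y; inv a].
  rewrite -hI E3 (inv_inflate i3); congr inflate.
  by rewrite -[in RHS](invK (vperm_perm vx)) -[in RHS](invK (vperm_perm vy)).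
have E5 := E4; rewrite {1}E3 !inflate321 in E5.
have i5 : inflatable (two false) [:: a; inflate (two false) [:: inv y; inv x]].
  by apply: inflatable2 => //; apply: inflate_vperm => //; apply: inflatable2.
have i6 : inflatable (two false) [:: x; inflate (two false) [:: y; inv a]].
  by apply: inflatable2 => //; apply: inflate_vperm => //; apply: inflatable2.
have [|_ [eax E7]] := inflate2_inj i5 i6 E5; first by rewrite /= szx.
have [|_ [ey _]] := inflate2_inj (inflatable2 false viy vix) (inflatable2 false vy via) E7.
  by rewrite /= size_inv.
have [y1 y2] : y \in L N true /\ (use_inv -> inv y = y -> y \in L N false).
  rewrite ey in i3 E3; apply: IH.
    by apply: (C_down hC (vperm_perm vy)); rewrite E3; apply: (@emb_al _ _ 1 i3).
  have h1 := @size_al_lt _ _ i3 1 isT isT; rewrite -E3 in h1.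
  have {}h1 : size y < size s := h1.
  by case/andP: vy => -> _; case/andP: hs => _ hs; rewrite -ltnS (leq_trans h1 hs).
apply: (hsz t321); first by rewrite /Sh ui mem_head.
apply/mem_build; exists [:: a; y]; split=> //.
  by move=> [|[|j]] //= _; apply: y2.
by rewrite E3 ey -eax.
Qed.

End Completeness.
End Involutions.

(** * Simple permutations of bounded length and the final count *)

Definition simples (M : nat) : seq (seq nat) :=
  undup [seq sg <- flatten [seq permutations (iota 1 n) | n <- iota 2 M.-1] | pbool (is_simple sg)].

Lemma simplesP M (sg : seq nat) :
  reflect [/\ is_perm sg, is_simple sg & 1 < size sg <= M] (sg \in simples M).
Proof.
rewrite mem_undup mem_filter; apply: (iffP andP).
  move=> [/pboolP h /flattenP[_ /mapP[n hn ->]]]; rewrite mem_permutations => hp.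
  have e := perm_size hp; rewrite size_iota in e; rewrite -e in hp hn.
  by rewrite mem_iota in hn; split=> //; case: (M) hn => [|m] /=; lia.
move=> [h1 h2 h3]; split; first exact/pboolP.
apply/flattenP; exists (permutations (iota 1 (size sg))); last by rewrite mem_permutations.
by apply/map_f; rewrite mem_iota; lia.
Qed.

Lemma leq_sum_mem (T : eqType) (s : seq T) (f : T -> nat) x : x \in s ->
  f x <= \sum_(y <- s) f y.
Proof. by move=> h; rewrite (big_rem x h) /= leq_addr. Qed.

Theorem theorem1p1 (C : seq nat -> Prop) (hC : perm_class C)
  (hfin : exists S : seq (seq nat), forall pi, C pi -> is_simple pi -> pi \in S)
  (use_alt use_even use_dumont use_inv : bool)
  (Bar : seq (seq nat * seq bool))
  (hBar : forall p, p \in Bar -> is_perm p.1 /\ size p.2 = size p.1)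
  (Blk : seq (seq nat * seq bool))
  (hBlk : forall p, p \in Blk -> is_perm p.1 /\ size p.2 = (size p.1).-1)
  (a : nat -> nat)
  (ha : counts (fun pi => C pi /\
                  (use_alt -> alternating pi) /\
                  (use_even -> even_perm pi) /\
                  (use_dumont -> dumont1 pi) /\
                  (use_inv -> involution pi) /\
                  (forall p, p \in Bar -> avoids_barred pi p.1 p.2) /\
                  (forall p, p \in Blk -> ~ occurs_blocked pi p.1 p.2)) a) :
  algebraic_gf a.
Proof.
have [S hS] := hfin; have [C_perm C_cont] := hC.
have C_down s t : C t -> is_perm s -> emb s t -> C s.
  by move=> ct hs /containsP; apply: C_cont.
pose M := (2 + \sum_(s <- S) size s)%N; pose Sl := simples M.
have Sl_perm (sg : seq nat) : sg \in Sl -> is_perm sg by case/simplesP.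
have Sl_simple (sg : seq nat) : sg \in Sl -> is_simple sg by case/simplesP.
have Sl_gt1 (sg : seq nat) : sg \in Sl -> 1 < size sg by case/simplesP => _ _ /andP[].
have Sl_uniq : uniq Sl by apply: undup_uniq.
have Sl_inv (sg : seq nat) : sg \in Sl -> inv sg \in Sl.
  move=> /simplesP[h1 h2 h3]; apply/simplesP; rewrite size_inv.
  by split=> //; [apply: inv_perm | apply: inv_simple].
have Sl_two d : two d \in Sl.
  apply/simplesP; rewrite size_two; split; first exact: two_perm.
    by apply: simple_small; rewrite size_two.
  by rewrite /M.
have C_simple s : C s -> is_simple s -> 1 < size s -> s \in Sl.
  move=> cs ss s1; apply/simplesP; split=> //; first exact: C_perm.
  by rewrite s1 /M (leq_trans (leq_sum_mem size (hS s cs ss))) // leq_addl.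
have [B [hB1 hB2]] := finite_basis Sl_gt1 C.
pose W := Wclosure Sl.
have W_perm s : W s -> is_perm s by move=> /(W_vperm Sl_gt1)/vperm_perm.
have CB s : W s -> (C s <-> forall b, b \in B -> ~ contains s b).
  move=> Ws; split=> [cs b bB cb|h].
    have [Wb nCb] := hB1 b bB; apply: nCb.
    by apply: C_cont cs _ cb; apply: W_perm.
  apply: NNPP => nC; have [b bB e] := hB2 s Ws nC.
  by apply: (h b bB); apply/containsP.
(* Enough rounds for every condition: 4 cover alternation, Dumont permutations and cuts, a forbidden
   pattern takes its length, a barred pattern twice its length, and a blocked one its length plus
   one for adjacency. *)
pose KB := \sum_(b <- B) size b; pose KBar := \sum_(p <- Bar) (size p.1 + size p.1).
pose KBlk := \sum_(p <- Blk) (size p.1).+1; pose K := 4 + KB + KBar + KBlk.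
have hKB b : b \in B -> size b <= KB := leq_sum_mem size (x := b).
have hKBar p : p \in Bar -> size p.1 + size p.1 <= KBar :=
  leq_sum_mem (fun p => size p.1 + size p.1) (x := p).
have hKBlk p : p \in Blk -> size p.1 < KBlk := leq_sum_mem (fun p => (size p.1).+1) (x := p).
have [K3 K4] : 3 <= K /\ 4 <= K by rewrite /K; lia.
have {}hKB b : b \in B -> size b <= K by move=> /hKB; rewrite /K; lia.
have {}hKBar p : p \in Bar -> size p.1 + size p.1 <= K by move=> /hKBar; rewrite /K; lia.
have {}hKBlk p : p \in Blk -> size p.1 < K by move=> /hKBlk; rewrite /K; lia.
have [Q [tau htau]] := finite_state K.
(* Being an involution is not part of [P0]: it is ensured by the list of kind [false]. *)
pose P0 s := [/\ C s, use_alt -> alternating s, use_even -> even_perm s,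
  use_dumont -> dumont1 s &
  (forall p, p \in Bar -> avoids_barred s p.1 p.2) /\
  (forall p, p \in Blk -> ~ occurs_blocked s p.1 p.2)].
have P0_tau s t : W s -> W t -> tau s = tau t -> P0 s -> P0 t.
  move=> Ws Wt /htau[[e1 _ eo] _] [p1 p2 p3 p4 [p5 p6]]; split.
  - apply/(CB t Wt) => b bB cb; move/(CB s Ws): p1 => /(_ b bB); apply.
    by apply: (@eqv_contains K b t s) => //; [apply: hKB | apply: eqv_sym e1 _].
  - by move/p2; apply: eqv_alternating; apply: eqv_le e1.
  - by move/p3; rewrite /even_perm eo.
  - by move/p4; apply: eqv_dumont; apply: eqv_le e1.
  split=> p hp.
    by apply: (eqv_barred _ e1); [apply: hKBar | apply: p5].
  by apply: (eqv_blocked _ e1); [apply: hKBlk | apply: p6].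
pose acc q := pbool (exists s, [/\ W s, tau s = q & P0 s]).
have accP s : W s -> reflect (P0 s) (acc (tau s)).
  move=> Ws; apply: (iffP (pboolP _)) => [[t [Wt e pt]]|ps]; last by exists s.
  exact: P0_tau Wt Ws e pt.
pose w k := if k && use_inv then 2 else 1.
pose Shp := Sh Sl use_inv.
have ShP := Sh_perm (use_inv := use_inv) Sl_perm.
have Sh1 := Sh_gt1 (use_inv := use_inv) Sl_gt1.
have ShI : forall sg, sg \in Shp false -> inv sg = sg by apply: Sh_inv.
have hw sg : sg \in Shp false -> w true = 2 /\ w false = 1.
  by rewrite /Shp /Sh /w; case: (use_inv).
have hw0 k : 0 < w k by rewrite /w; case: ifP.
have tau_infl sg als bls : inflatable sg als -> inflatable sg bls ->
    (forall i, i < size sg -> tau (nth [::] als i) = tau (nth [::] bls i)) ->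
    tau (inflate sg als) = tau (inflate sg bls).
  by move=> i1 i2 h; apply/htau/same_state_inflate => // i hi; apply/htau/h.
have tau_inv s t : is_perm s -> is_perm t -> tau s = tau t -> tau (inv s) = tau (inv t).
  by move=> h1 h2 /htau h; apply/htau/same_state_inv.
have tau_dec d s t : tau s = tau t -> dec d s = dec d t.
  move=> /htau[[e _ _] _].  apply/idP/idP; apply: eqv_dec; first exact: eqv_le K3 e.
  by apply: eqv_sym (eqv_le K3 e) _.
(* Involutions are listed under kind [false], all permutations under kind [true]; either way the
   kind that is counted has weight 1. *)
pose k := ~~ use_inv.
have wk : w k = 1 by rewrite /w /k andNb.
(* The lists contain no empty permutation, so [a 0] enters as a constant. *)
apply: (@rules_algebraic _ (fun i : bool * Q => ~~ i.1 : nat) (rules Shp tau w)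
  (fun i => (i.1 == k) && acc i.2) (a 0)).
  exact: rules_proper.
move=> N n hn.
rewrite (eq_bigr (gf Shp tau w N)) => [|i _]; last exact: gf_iter.
rewrite -(pair_big (fun b => b == k) (fun q => acc q) (fun b q => gf Shp tau w N (b, q))) /=.
rewrite big_pred1_eq /gf /= wk.
have -> : (\sum_(q | acc q) \sum_(c <- Lam Shp N k | tau c == q) 'X^(1 * size c) =
    \sum_(c <- Lam Shp N k | acc (tau c)) 'X^(size c) :> {poly rat})%R.
  rewrite (exchange_big_dep (fun c => acc (tau c))) => [|q c h /eqP -> //].
  apply: eq_bigr => c hc; rewrite mul1n (big_pred1 (tau c)) // => q /=.
  by rewrite eq_sym; case: eqP => [->|]; rewrite ?hc ?andbF.
have Lk c : c \in Lam Shp N k -> W c /\ (use_inv -> inv c = c).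
  move=> /(Lam_sound Sl_perm Sl_gt1 Sl_inv Sl_two)[h1 h2]; split=> // ui.
  by apply: h2; rewrite /k ui.
rewrite coefD coef_sum -polyC_natr coefC.
case: n hn => [_|n hn].
  rewrite eqxx big_seq_cond big1 ?add0r // => c /andP[/(Lam_vperm ShP Sh1 ShI)/andP[c0 _] _].
  by rewrite coefXn; case: (size c) c0.
have [s [us [<- hs]]] := ha n.+1.
rewrite [n.+1 == 0]/= addr0; have -> : size s = size [seq c <- Lam Shp N k | acc (tau c) && (size c == n.+1)].
  apply/perm_size/uniq_perm => // [|c].
    by apply: filter_uniq; apply: Lam_uniq.
  rewrite mem_filter; apply/idP/andP => [/hs[sz [cc [h1 [h2 [h3 [h4 [h5 h6]]]]]]]|].
    have cp := C_perm c cc.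
    have [m1 m2] : c \in Lam Shp N true /\ (use_inv -> inv c = c -> c \in Lam Shp N false).
      have := @Lam_complete Sl use_inv Sl_uniq C C_perm C_down C_simple N c cc. rewrite sz. by apply.
    have cL : c \in Lam Shp N k.
      rewrite /k; case: (boolP use_inv) => // ui; apply: m2 => //.
      by apply/(involutionP cp)/h4.
    split=> //; rewrite sz eqxx andbT; apply/accP; first by have [] := Lk c cL.
    by split.
  move=> [/andP[ac /eqP sz] cL]; have [Wc ic] := Lk c cL.
  have [q1 q2 q3 q4 [q5 q6]] := accP c Wc ac.
  apply/hs; do !split=> //.
  by move=> ui; apply/(involutionP (C_perm c q1))/ic.
rewrite -[size (filter _ _)]sum1_size big_filter natr_sum [RHS]big_mkcondr.
by apply: eq_bigr => c _; rewrite coefXn eq_sym; case: eqP.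
Qed.
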